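(* Let $p:[0,T]\to\mathfrak p$ be a solution to the control-affine system (A) and let $a^{\downarrow}:[0,T]\to\mathfrak w$ be the unique path which satisfies $\pi\circ a^{\downarrow}=\pi\circ p$. Then $a^{\downarrow}$ is a solution to the reduced control system (R) (and hence also to the relaxed differential inclusion (C)).
   Context: Setting. $\mathfrak g$ is a finite-dimensional real semisimple Lie algebra with an involutive automorphism $s$, and $\mathfrak g=\mathfrak k\oplus\mathfrak p$ is the decomposition into the $+1$ and $-1$ eigenspaces of $s$. The symmetric Lie algebra $(\mathfrak g,s)$ is orthogonal, i.e. $\mathfrak k$ is compactly embedded in $\mathfrak g$; fix an inner product on $\mathfrak g$ invariant under $s$ and $\mathrm{ad}_{\mathfrak k}$. $\mathbf G$ is a Lie group with Lie algebra $\mathfrak g$ such that the analytic subgroup $\mathbf K\subseteq\mathbf G$ generated by $\mathfrak k$ is compact (and connected). $\mathbf K$ acts on $\mathfrak p$ by the adjoint action $\mathrm{Ad}$, with quotient map $\pi:\mathfrak p\to\mathfrak p/\mathbf K$. $\mathfrak a\subseteq\mathfrak p$ is a maximal Abelian subspace with Weyl group $\mathbf W=N_{\mathbf K}(\mathfrak a)/Z_{\mathbf K}(\mathfrak a)$ and closed Weyl chamber $\mathfrak w\subseteq\mathfrak a$; every $\mathbf K$-orbit in $\mathfrak p$ meets $\mathfrak w$ in exactly one point. $\Pi_{\mathfrak a}:\mathfrak p\to\mathfrak a$ is the orthogonal projection. $X$ is a vector field on $\mathfrak p$ (a map $\mathfrak p\to\mathfrak p$; no smoothness or boundedness is assumed).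 Let $k_1,\dots,k_m\in\mathfrak k$ generate $\mathfrak k$ as a Lie algebra. System (A): $p'(t)=X(p(t))+\sum_{i=1}^m u_i(t)\,\mathrm{ad}_{k_i}(p(t))$, with arbitrary locally integrable (possibly unbounded) controls $u_i:[0,T]\to\mathbb R$. A solution is an absolutely continuous $p:[0,T]\to\mathfrak p$ satisfying this almost everywhere for some choice of controls. For $K\in\mathbf K$ the induced vector field on $\mathfrak a$ is $X_K(a)=\Pi_{\mathfrak a}\big(\mathrm{Ad}_K^{-1}(X(\mathrm{Ad}_K(a)))\big)$, and $\mathsf{derv}(a)=\{X_K(a):K\in\mathbf K\}$. System (R): $a'(t)=X_{K(t)}(a(t))$ with measurable control function $K:[0,T]\to\mathbf K$. System (C): $a'(t)\in\mathrm{conv}(\mathsf{derv}(a(t)))$. Solutions are absolutely continuous functions $a:[0,T]\to\mathfrak a$ satisfying the respective relation almost everywhere. *)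

(* Defs.v *)
From HB Require Import structures.
From mathcomp Require Import all_boot all_order all_algebra sesquilinear.
From mathcomp Require Import all_classical all_reals all_analysis.

Set Implicit Arguments.
Unset Strict Implicit.
Unset Printing Implicit Defensive.

Import Order.TTheory GRing.Theory Num.Theory.
Import numFieldNormedType.Exports.

Local Open Scope classical_set_scope.
Local Open Scope ring_scope.

HB.mixin Record isTopGroup G of Topological G & Group G := {
  mulg_continuous : continuous (fun x : G * G => (x.1 * x.2)%g);
  invg_continuous : continuous (fun x : G => (x^-1)%g)
}.

#[short(type="topGroupType")]
HB.structure Definition TopGroup :=
  {G of isTopGroup G & Topological G & Group G}.

Section Smooth.
Context (R : realType) (E F : normedModType R).

(* [U] is meant to be open and [E], [F] finite dimensional: the values of [f]
   outside [U] are then irrelevant. *)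
Fixpoint Ck (k : nat) (U : set E) (f : E -> F) : Prop :=
  match k with
  | 0 => forall x, U x -> {for x, continuous f}
  | k.+1 => (forall x, U x -> differentiable f x) /\
            forall v, Ck k U (fun x => 'D_v f x)
  end.

Definition smooth_on (U : set E) (f : E -> F) : Prop := forall k, Ck k U f.

End Smooth.

Record chart (R : realType) (G : topologicalType) (E : normedModType R) :=
  Chart {
    chart_dom : set G;
    chart_map :> G -> E;
    chart_inv : E -> G;
    chart_dom_open : open chart_dom;
    chart_im_open : open (chart_map @` chart_dom);
    chart_mapK : forall g, chart_dom g -> chart_inv (chart_map g) = g;
    chart_map_continuous :
      forall g, chart_dom g -> {for g, continuous chart_map};
    chart_inv_continuous :
      forall x, (chart_map @` chart_dom) x -> {for x, continuous chart_inv}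
  }.

Definition chart_im (R : realType) (G : topologicalType) (E : normedModType R)
  (c : chart G E) : set E := c @` chart_dom c.

Section LieGroup.
Context (R : realType) (G : topGroupType) (E : normedModType R).

Definition smooth_atlas (A : set (chart G E)) : Prop :=
  (forall g, exists2 c, A c & chart_dom c g) /\
  forall c d, A c -> A d ->
    smooth_on [set x | chart_im c x /\ chart_dom d (chart_inv c x)]
              (d \o chart_inv c).

Definition lie_group (A : set (chart G E)) : Prop :=
  [/\ hausdorff_space G, @second_countable G, smooth_atlas A,
      (forall c d e, A c -> A d -> A e ->
        smooth_on
          [set x : E * E | [/\ chart_im c x.1, chart_im d x.2 &
             chart_dom e (chart_inv c x.1 * chart_inv d x.2)%g]]
          (fun x => e (chart_inv c x.1 * chart_inv d x.2)%g)) &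
      (forall c d, A c -> A d ->
        smooth_on
          [set x | chart_im c x /\ chart_dom d (chart_inv c x)^-1%g]
          (fun x => d (chart_inv c x)^-1%g))].

(* A chart [c] centred at the neutral element identifies the tangent space
   there with [E]; [Ad c g] is the differential at the neutral element of
   conjugation by [g], read through this identification. *)
Definition Ad (c : chart G E) (g : G) (y : E) : E :=
  'D_y (fun x => c (g * chart_inv c x * g^-1)%g) 0.

(* [E] with the bracket [br] is the Lie algebra of [G]: the bracket is the
   differential of [Ad] at the neutral element. *)
Definition lie_algebra_of (A : set (chart G E)) (c : chart G E)
    (br : E -> E -> E) : Prop :=
  [/\ A c, chart_dom c 1%g, c 1%g = 0 &
      forall y z, is_derive (0 : R) (1 : R)
        (fun t => Ad c (chart_inv c (t *: y)) z) (br y z)].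

Definition one_parameter_subgroup (c : chart G E) (y : E) (f : R -> G) : Prop :=
  [/\ forall s t, f (s + t) = (f s * f t)%g, continuous f &
      is_derive (0 : R) (1 : R) (c \o f) y].

Definition is_subgroup (H : set G) : Prop :=
  [/\ H 1%g, forall g h, H g -> H h -> H (g * h)%g &
      forall g, H g -> H g^-1%g].

(* [f 1] is the exponential of [y]. *)
Definition analytic_subgroup (c : chart G E) (k : set E) : set G :=
  smallest is_subgroup
    [set g | exists y f, [/\ k y, one_parameter_subgroup c y f & g = f 1]].

End LieGroup.

Section LieAlgebra.
Context (R : realType) (n : nat).
Notation E := 'rV[R]_n.
Variable br : {bilinear E -> E -> E}.

Definition lie_bracket : Prop :=
  (forall x, br x x = 0) /\
  (forall x y z, br x (br y z) + br y (br z x) + br z (br x y) = 0).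

(* Matrices act on row vectors from the right. *)
Definition ad (x : E) : 'M[R]_n := lin1_mx (br x).

Definition killing (x y : E) : R := \tr (ad x *m ad y).

Definition semisimple : Prop :=
  forall x, (forall y, killing x y = 0) -> x = 0.

Definition lie_subalgebra (S : set E) : Prop :=
  [/\ S 0, forall x y, S x -> S y -> S (x + y),
      forall (c : R) x, S x -> S (c *: x) &
      forall x y, S x -> S y -> S (br x y)].

Definition generates (m : nat) (k : 'I_m -> E) (S : set E) : Prop :=
  smallest lie_subalgebra (range k) = S.

Definition expmx (M : 'M[R]_n) : 'M[R]_n :=
  limn (series (fun i => (i`!%:R)^-1 *: (M ^+ i : 'M[R]_n))).

Definition mx_subgroup (H : set 'M[R]_n) : Prop :=
  [/\ H 1%:M, forall M N, H M -> H N -> H (M *m N) &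
      forall M, H M -> H (invmx M)].

Definition compactly_embedded (k : set E) : Prop :=
  compact (smallest mx_subgroup [set expmx (ad x) | x in k]).

Definition involutive_automorphism (s : {linear E -> E}) : Prop :=
  involutive s /\ forall x y, s (br x y) = br (s x) (s y).

Definition fixed_part (s : E -> E) : set E := [set x | s x = x].

Definition anti_fixed_part (s : E -> E) : set E := [set x | s x = - x].

Definition invariant_inner_product (s : E -> E) (ip : {biscalar E}) : Prop :=
  [/\ forall x y, ip x y = ip y x,
      forall x, x != 0 -> 0 < ip x x,
      forall x y, ip (s x) (s y) = ip x y &
      forall k x y, fixed_part s k -> ip (br k x) y = - ip x (br k y)].

Definition abelian_subspace (a : {vspace E}) : Prop :=
  forall x y, x \in a -> y \in a -> br x y = 0.

Definition maximal_abelian (p : set E) (a : {vspace E}) : Prop :=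
  [/\ [set` a] `<=` p, abelian_subspace a &
      forall b : {vspace E}, [set` b] `<=` p -> abelian_subspace b ->
        (a <= b)%VS -> b = a].

(* [mu + i nu] is a root of the complexified Lie algebra with respect to [a],
   with root vector [x + i y]; complex values occur because [ad h], for [h] in
   [a], has real eigenvalues in the noncompact case but imaginary ones in the
   compact case. *)
Definition restricted_root (a : {vspace E}) (mu nu : E -> R) : Prop :=
  (exists2 h, h \in a & mu h != 0 \/ nu h != 0) /\
  exists x y, (x != 0 \/ y != 0) /\
    forall h, h \in a -> br h x = mu h *: x - nu h *: y /\
                         br h y = nu h *: x + mu h *: y.

Definition regular_set (a : {vspace E}) : set E :=
  [set h | h \in a /\
    forall mu nu, restricted_root a mu nu -> mu h != 0 \/ nu h != 0].

Definition closed_weyl_chamber (a : {vspace E}) (w : set E) : Prop :=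
  exists2 h, regular_set a h &
    w = closure (connected_component (regular_set a) h).

Definition orth_proj (ip : {biscalar E}) (a : {vspace E}) (x : E) : E :=
  xget 0 [set y | y \in a /\ forall z, z \in a -> ip (x - y) z = 0].

End LieAlgebra.

Section Control.
Context (R : realType) (n : nat).
Notation E := 'rV[R]_n.

Definition absolutely_continuous_on (T : R) (f : R -> E) : Prop :=
  forall eps : R, 0 < eps -> exists2 delta : R, 0 < delta &
    forall (m : nat) (a b : 'I_m -> R),
      (forall i, 0 <= a i <= b i /\ b i <= T) ->
      (forall i j, i != j -> b i <= a j \/ b j <= a i) ->
      \sum_(i < m) (b i - a i) < delta ->
      \sum_(i < m) `|f (b i) - f (a i)| < eps.

Definition convex_hull (A : set E) : set E :=
  [set v | exists (m : nat) (c : 'I_m -> R) (x : 'I_m -> E),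
     [/\ forall i, 0 <= c i /\ A (x i), \sum_(i < m) c i = 1 &
         v = \sum_(i < m) c i *: x i]].

Definition solution_A (br : E -> E -> E) (p : set E) (X : E -> E)
    (m : nat) (k : 'I_m -> E) (T : R) (f : R -> E) : Prop :=
  [/\ absolutely_continuous_on T f,
      forall t, t \in `[0, T] -> p (f t) &
      exists2 u : 'I_m -> R -> R,
        (forall i, lebesgue_measure.-integrable `[0, T]%classic (EFin \o u i)) &
        {ae lebesgue_measure, forall t, t \in `[0, T] ->
          is_derive t (1 : R) f
            (X (f t) + \sum_(i < m) u i t *: br (k i) (f t))}].

Context (G : topGroupType).

Definition quotient_map (Kg : set G) (act : G -> E -> E) (x : E) : set E :=
  [set act g x | g in Kg].

Definition induced_field (act : G -> E -> E) (proj : E -> E) (X : E -> E)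
    (g : G) (a : E) : E :=
  proj (act g^-1%g (X (act g a))).

Definition derv (Kg : set G) (act : G -> E -> E) (proj : E -> E) (X : E -> E)
    (a : E) : set E :=
  [set induced_field act proj X g a | g in Kg].

Definition measurable_control (Kg : set G) (T : R) (K : R -> G) : Prop :=
  (forall t, t \in `[0, T] -> Kg (K t)) /\
  forall U : set G, open U -> measurable (`[0, T]%classic `&` K @^-1` U).

Definition solution_R (Kg : set G) (act : G -> E -> E) (proj : E -> E)
    (X : E -> E) (a : {vspace E}) (T : R) (f : R -> E) : Prop :=
  [/\ absolutely_continuous_on T f,
      forall t, t \in `[0, T] -> f t \in a &
      exists2 K : R -> G, measurable_control Kg T K &
        {ae lebesgue_measure, forall t, t \in `[0, T] ->
          is_derive t (1 : R) f (induced_field act proj X (K t) (f t))}].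

Definition solution_C (Kg : set G) (act : G -> E -> E) (proj : E -> E)
    (X : E -> E) (a : {vspace E}) (T : R) (f : R -> E) : Prop :=
  [/\ absolutely_continuous_on T f,
      forall t, t \in `[0, T] -> f t \in a &
      {ae lebesgue_measure, forall t, t \in `[0, T] ->
        exists2 v, is_derive t (1 : R) f v &
          convex_hull (derv Kg act proj X (f t)) v}].

End Control.

(* Main.v *)
Require Import Defs.
From HB Require Import structures.
From mathcomp Require Import all_boot all_order all_algebra sesquilinear.
From mathcomp Require Import all_classical all_reals all_analysis.
From mathcomp Require Import ring lra.
Import Order.TTheory GRing.Theory Num.Theory.
Import numFieldNormedType.Exports.
Local Open Scope classical_set_scope.
Local Open Scope ring_scope.

Set Implicit Arguments.
Unset Strict Implicit.

(** The inner product is invariant under [k] only, whereas the arguments call for invariance under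
    all of [g], which the Killing form has. The operator [killing_dual], written [U], mediates:
    [killing br (U x) y = ip x y], it commutes with [s] and with [ad z] for [z] in [k], and it
    preserves [a]. Elements of [k] are shown to vanish by computing their Killing square, since the
    Killing form is negative definite on [k].

    The variations require a one-parameter subgroup in every direction of [k]. It is obtained by
    solving [u t = sq (u (t / 2))] in a chart, where [sq] is squaring in the group; uniqueness of
    solutions with a given tangent then yields commutation and additivity.

    As [X] is arbitrary, the velocity of [p] has no regularity and each time of differentiability
    [t0] is treated by itself. The convex function used there lives on the tangent line,
    [r => ip h (dn (p t0 + r *: v))] with [v] the velocity, for [ip h (dn (p t))] itself need not be
    convex; the two agree to first order because [dn] is Lipschitz. *)

(** The heart of the matter is the inequality [<h, Ad_g x> <= <h, x>] for [h], [x]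
    in the chamber and [g] in [Kg] ([kostant_le]): maximise the left-hand side over
    the compact group [Kg], for a regular [h].  At a maximiser [b = Ad_g x], the first
    variation along one-parameter subgroups shows that [b] commutes with [h], hence
    lies in [a]; the second variation shows that the segment from [h] to [b] meets no
    wall, so that [b] lies in the closed chamber and [b = x].

    Write [dn x] for the chamber point of the orbit of [x].  Then
    [<h, dn x> = max_g <h, Ad_g x>] is convex and Lipschitz in [x] for every [h] in the
    chamber, and [dn] is a contraction, so [adown] inherits absolute continuity
    from [p].  Where [p] is differentiable, convexity gives [<h, adown>] one-sided
    derivatives, which can differ at countably many times only.  At the other times,
    if [p t0 = Ad_K (adown t0)], then [<h, adown t> - <h, Ad_K^-1 (p t)> >= 0] with
    equality at [t0], so both terms have the same derivative; since the chamber spans [a]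
    and [[k, a]] is orthogonal to [a], the derivative of [adown] is the projection
    of [Ad_K^-1 (X (p t0))].  A measurable choice of [K] exists because the set of
    admissible [K] depends on [t] in a closed way. *)

(** * Linear algebra and inner products on row vectors *)

Section LinearAlgebra.
Context (R : realType) (n : nat).
Notation E := 'rV[R]_n.

(** Serves to bound [|x|] by a multiple of [|f x|] on [V]: the left inverse is linear between
    finite-dimensional spaces, hence bounded. *)
Lemma left_inverse_on (m : nat) (V : {vspace E}) (f : {linear E -> 'rV[R]_m}) :
  (forall x, x \in V -> f x = 0 -> x = 0) ->
  exists g : {linear 'rV[R]_m -> E}, forall x, x \in V -> g (f x) = x.
Proof.
move=> f0; pose h : 'Hom(subvs_of V, 'rV[R]_m) := linfun (f \o vsval).
have kh : lker h == 0%VS.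
  apply/eqP/vspaceP => x; rewrite memv_ker memv0 lfunE /=.
  apply/eqP/eqP => [hx|->]; last by rewrite linear0.
  by apply/val_inj; rewrite /= (f0 _ (subvsP x) hx).
exists (vsval \o (h^-1)%VF) => x xV /=.
have -> : f x = h (Subvs xV) by rewrite lfunE.
by rewrite (lker0_lfunK kh).
Qed.

End LinearAlgebra.

(** * Matrices skew for a positive definite form *)

Section TraceSkew.
Context (R : realType).

(** Symmetric elimination, by induction on the size: the first coordinate is split off and the
    induction continues with the Schur complement [S]. The identity [key] completes the square. *)
Lemma congruent_1_of_posdef (n : nat) (P : 'M[R]_n) :
  P^T = P -> (forall u : 'rV[R]_n, u != 0 -> 0 < (u *m P *m u^T) 0 0) ->
  exists2 Q : 'M[R]_n, Q \in unitmx & Q *m P *m Q^T = 1%:M.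
Proof.
elim: n P => [|n IH] P sP pP.
  by exists 1%:M; [exact: unitmx1|apply/matrixP => -[]].
move: P sP pP; rewrite -[n.+1]/(1 + n)%N => P sP pP.
pose a := P 0 0; pose v : 'M[R]_(1, n) := ursubmx P; pose P' : 'M[R]_n := drsubmx P.
have Pb : P = block_mx a%:M v v^T P'.
  rewrite -[LHS]submxK; congr block_mx.
    by apply/matrixP => i j; rewrite !ord1 !mxE /= /a; congr (P _ _); apply/val_inj.
  by rewrite -[in LHS]sP /v; apply/matrixP => i j; rewrite !mxE.
have a0 : 0 < a.
  have := pP (row_mx 1 0).
  rewrite Pb mul_row_block tr_row_mx mul_row_col !trmx0 !mul0mx !mulmx0 !addr0 !trmx1 mulmx1 mul1mx.
  rewrite mxE /= mulr1n; apply; apply/eqP => /(congr1 (fun u : 'rV[R]_(1+n) => lsubmx u 0 0)).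
  rewrite row_mxKl !mxE /= => /eqP; by rewrite oner_eq0.
pose S := P' - a^-1 *: (v^T *m v).
have sP' : P'^T = P' by rewrite /P' -[in RHS]sP; apply/matrixP => i j; rewrite !mxE.
have sS : S^T = S by rewrite /S linearB /= linearZ /= trmx_mul trmxK sP'.
have key (w : 'rV[R]_n) (t : R) :
    row_mx t%:M w *m P *m (row_mx t%:M w)^T =
    w *m S *m w^T + (a * (t + a^-1 * (w *m v^T) 0 0) ^+ 2)%:M.
  rewrite Pb mul_row_block tr_row_mx mul_row_col.
  set b := (w *m v^T) 0 0.
  have wv : w *m v^T = b%:M by rewrite [LHS]mx11_scalar.
  have vw : v *m w^T = b%:M by rewrite -[LHS]trmxK trmx_mul trmxK wv tr_scalar_mx.
  rewrite tr_scalar_mx -!scalar_mxM wv -raddfD /= -scalar_mxM mulmxDl mul_scalar_mx.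
  rewrite -scalemxAl vw /S mulmxBr mulmxBl -scalemxAr -scalemxAl.
  rewrite mulmxA wv mul_scalar_mx -scalemxAl vw -!mul_scalar_mx -!scalar_mxM.
  rewrite addrA -raddfD /= addrC -addrA; congr (_ + _).
  rewrite -raddfN -!raddfD /=; congr (_%:M).
  by field; rewrite gt_eqF.
have [|Q uQ QS] := IH S sS.
  (* This first coordinate makes the completed square vanish, so that only the value of [S] at [w]
     remains. *)
  move=> w w0; have := pP (row_mx (- (a^-1 * (w *m v^T) 0 0))%:M w).
  rewrite key addNr expr0n /= mulr0 raddf0 addr0; apply.
  by apply: contra_neq w0 => /(congr1 rsubmx); rewrite row_mxKr raddf0.
pose r := (Num.sqrt a)^-1.
exists (block_mx r%:M 0 (- (a^-1 *: (Q *m v^T))) Q).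
  rewrite unitmxE det_lblock det_scalar1 unitrM unitfE invr_eq0 sqrtr_eq0 -ltNge a0 /=.
  by rewrite -unitmxE.
rewrite Pb tr_block_mx !mulmx_block !trmx0 !mul0mx !mulmx0 !addr0.
have rar : r * a * r = 1.
  rewrite /r -[X in _ * X * _](sqr_sqrtr (ltW a0)) expr2 mulrA mulVf ?mul1r ?divff //.
    by rewrite sqrtr_eq0 -ltNge.
  by rewrite sqrtr_eq0 -ltNge.
rewrite tr_scalar_mx -!scalar_mxM rar.
have e1 : - (a^-1 *: (Q *m v^T)) *m a%:M + Q *m v^T = 0.
  by rewrite mul_mx_scalar scalerN scalerA divff ?gt_eqF // scale1r addNr.
rewrite e1 mul0mx mul0mx add0r.
have e2 : (r * a)%:M *m (- (a^-1 *: (Q *m v^T)))^T + r%:M *m v *m Q^T = 0 :> 'M[R]_(1, n).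
  rewrite !mul_scalar_mx linearN /= linearZ /= trmx_mul trmxK.
  by rewrite scalerN scalerA -mulrA divff ?gt_eqF // mulr1 scalemxAl addNr.
rewrite e2.
have -> : - (a^-1 *: (Q *m v^T)) *m v + Q *m P' = Q *m S.
  by rewrite mulNmx -scalemxAl -mulmxA scalemxAr addrC -mulmxBr.
by rewrite QS -scalar_mx_block.
Qed.

(** In a basis orthonormal for [P] the matrix becomes a skew-symmetric [N], and the trace of its
    square is minus the sum of the squared entries of [N]. *)
Lemma mxtrace_sqr_skew (n : nat) (P M : 'M[R]_n) :
  P^T = P -> (forall u : 'rV[R]_n, u != 0 -> 0 < (u *m P *m u^T) 0 0) ->
  M *m P = - (P *m M^T) -> 0 <= \tr (M *m M) -> M = 0.
Proof.
move=> sP pP skM trM.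
have [Q uQ QP] := congruent_1_of_posdef sP pP.
pose N := Q *m M *m invmx Q.
have NE : M = invmx Q *m N *m Q by rewrite /N !mulmxA mulVmx // mul1mx mulmxKV.
have PE : P = invmx Q *m (invmx Q)^T.
  rewrite trmx_inv -[LHS](mulKmx uQ) -[in LHS](mulmxK (_ : Q^T \in unitmx) (Q *m P)).
    by rewrite QP mul1mx.
  by rewrite unitmx_tr.
have skN : N^T = - N.
  have h : Q *m (M *m P) *m Q^T = N.
    by rewrite {1}PE /N -!mulmxA; congr (_ *m (_ *m _)); rewrite -trmx_mul mulmxV // trmx1 mulmx1.
  have PM : P *m M^T = - (M *m P) by rewrite skM opprK.
  by rewrite -h !trmx_mul trmxK sP PM -mulmxA mulNmx mulmxN mulmxA.
have trN : \tr (M *m M) = - \sum_i \sum_j N i j ^+ 2.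
  have -> : \tr (M *m M) = \tr (N *m N).
    by rewrite /N -!mulmxA (mulKmx uQ) [RHS]mxtrace_mulC -!mulmxA mulVmx // mulmx1.
  rewrite -[X in _ *m X]trmxK skN linearN /= mulmxN linearN /=; congr (- _).
  clearbody N; rewrite /mxtrace; apply: eq_bigr => i _.
  by rewrite mxE; apply: eq_bigr => j _; rewrite !mxE expr2.
have N0 : N = 0.
  clearbody N; apply/matrixP => i j; rewrite mxE; apply/eqP; rewrite -sqrf_eq0.
  have s0 : \sum_i \sum_j N i j ^+ 2 = 0.
    apply/eqP; rewrite eq_le; apply/andP; split; first by rewrite -oppr_ge0 -trN.
    by apply: sumr_ge0 => ? _; apply: sumr_ge0 => ? _; exact: sqr_ge0.
  have s1 : \sum_j N i j ^+ 2 = 0.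
    apply: (psumr_eq0P (P := predT) _ s0) => // i0 _.
    by apply: sumr_ge0 => j0 _; exact: sqr_ge0.
  by apply/eqP; apply: (psumr_eq0P (P := predT) _ s1) => // j0 _; exact: sqr_ge0.
by rewrite NE N0 mulmx0 mul0mx.
Qed.

End TraceSkew.

Section RowVectors.
Context (R : realType) (n : nat).
Notation E := 'rV[R]_n.

Lemma ler_norm_coord (x : E) i : `|x 0 i| <= `|x|.
Proof.
rewrite [in leRHS]/Num.norm /= mx_normrE.
by rewrite (le_bigmax _ (fun i : 'I_1 * 'I_n => `|x i.1 i.2|) (0, i)).
Qed.

Lemma ler_norm_rV (x : E) (e : R) : 0 <= e -> (forall i, `|x 0 i| <= e) -> `|x| <= e.
Proof.
move=> e0 xe; rewrite [in leLHS]/Num.norm /= mx_normrE.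
by apply: bigmax_le => // -[i j] _ /=; rewrite ord1.
Qed.

Section Bounds.
Context (V : normedModType R).

Lemma linear_rV_bound (f : E -> V) : linear f ->
  exists2 k : R, 0 < k & forall x, `|f x| <= k * `|x|.
Proof.
move=> lf; pose g : {linear E -> V} := HB.pack f (GRing.isLinear.Build _ _ _ _ f lf).
exists (\sum_j `|f 'e_j| + 1) => [|x].
  by rewrite ltr_wpDl // sumr_ge0.
rewrite {1}(row_sum_delta x) -[f _]/(g _) linear_sum /=.
rewrite (le_trans (ler_norm_sum _ _ _)) // mulrDl mul1r ler_wpDr // mulr_suml.
apply: ler_sum => i _; rewrite -[f _]/(g _) linearZ /= normrZ mulrC.
by rewrite ler_wpM2l // ler_norm_coord.
Qed.

Lemma linear_rV_continuous (f : E -> V) : linear f -> continuous f.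
Proof.
move=> lf; pose g : {linear E -> V} := HB.pack f (GRing.isLinear.Build _ _ _ _ f lf).
apply: (@bounded_linear_continuous R E V g).
have [k k0 fk] := linear_rV_bound lf.
apply/linear_boundedP; near=> M => x.
rewrite (le_trans (fk x)) // ler_wpM2r //; near: M; apply: nbhs_pinfty_ge; exact: gtr0_real.
Unshelve. all: by end_near. Qed.

Lemma bilinear_rV_bound (f : E -> E -> V) :
  (forall x, linear (f x)) -> (forall y, linear (f^~ y)) ->
  exists2 k : R, 0 < k & forall x y, `|f x y| <= k * `|x| * `|y|.
Proof.
move=> fr fl.
have /choice[k kP] j : exists k : R, 0 < k /\ forall x, `|f x 'e_j| <= k * `|x|.
  by have [k k0 fk] := linear_rV_bound (fl 'e_j); exists k.
exists (\sum_j k j + 1) => [|x y].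
  by rewrite ltr_wpDl // sumr_ge0 // => j _; apply: ltW; exact: (kP j).1.
pose g : {linear E -> V} := HB.pack (f x) (GRing.isLinear.Build _ _ _ _ (f x) (fr x)).
rewrite {1}(row_sum_delta y) -[f x _]/(g _) linear_sum /=.
rewrite (le_trans (ler_norm_sum _ _ _)) // !mulrDl mul1r ler_wpDr ?mulr_ge0 // !mulr_suml.
apply: ler_sum => i _; rewrite -[f x _]/(g _) linearZ /= normrZ mulrC.
by rewrite ler_pM // ?ler_norm_coord //; exact: (kP i).2.
Qed.

End Bounds.

(** By linearity it suffices to control the basis vectors: estimates at each fixed vector become one
    estimate uniform in [v]. *)
Lemma linear_family_near_id (L : E -> E -> E) :
  (\forall u \near (0 : E), linear (L u)) ->
  (forall j, exists2 C : R, 0 < C & \forall u \near (0 : E), `|L u 'e_j - 'e_j| <= C * `|u|) ->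
  exists2 C : R, 0 < C & \forall u \near (0 : E), forall v, `|L u v - v| <= C * `|u| * `|v|.
Proof.
move=> Ll LC.
have /choice[C CP] j : exists C : R, 0 < C /\ \forall u \near (0 : E), `|L u 'e_j - 'e_j| <= C * `|u|.
  by have [C C0 h] := LC j; exists C.
have C0 : 0 <= \sum_j C j by rewrite sumr_ge0 // => j _; apply: ltW; exact: (CP j).1.
exists (\sum_j C j + 1); first by rewrite ltr_wpDl.
have nC : \forall u \near (0 : E), forall j, `|L u 'e_j - 'e_j| <= C j * `|u|.
  exact: (@filter_forall _ _ _ (nbhs (0 : E)) _ (fun j => (CP j).2)).
apply: filterS2 Ll nC => u lu Cu v.
pose g : {linear E -> E} := HB.pack (L u) (GRing.isLinear.Build _ _ _ _ (L u) lu).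
have -> : L u v - v = \sum_j v 0 j *: (L u 'e_j - 'e_j).
  rewrite {1 2}(row_sum_delta v) -[L u _]/(g _) linear_sum /= -sumrB.
  by apply: eq_bigr => j _; rewrite -[L u _]/(g _) linearZ /= scalerBr.
rewrite (le_trans (ler_norm_sum _ _ _)) //.
apply: (@le_trans _ _ ((\sum_j C j) * `|u| * `|v|)); last first.
  by rewrite ler_wpM2r // ler_wpM2r // lerDl.
rewrite !mulr_suml; apply: ler_sum => j _.
by rewrite normrZ mulrC ler_pM // ler_norm_coord.
Qed.

Lemma vspace_rV_closed (V : {vspace E}) : closed [set` V].
Proof.
have -> : [set` V] = [set x | projv V x - x = 0].
  apply/seteqP; split=> x /=; first by move/projv_id => ->; rewrite subrr.
  by move/eqP; rewrite subr_eq0 => /eqP <-; exact: memv_proj.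
have lc : linear (fun x => projv V x - x).
  by move=> a u v; rewrite linearP opprD addrACA scalerBr.
apply: (closed_comp (f := fun x => projv V x - x) (D := [set 0])).
  by move=> x _; exact: linear_rV_continuous lc x.
by apply: accessible_closed_set1; apply: hausdorff_accessible; exact: norm_hausdorff.
Qed.

End RowVectors.

(** * Inner products: coercivity, Gram coordinates, symmetric maps *)

Section InnerProduct.
Context (R : realType) (n : nat).
Notation E := 'rV[R]_n.
Context (ip : {biscalar E}).
Context (ip_sym : forall x y, ip x y = ip y x).
Context (ip_pos : forall x, x != 0 -> 0 < ip x x).

Lemma ip_ge0 x : 0 <= ip x x.
Proof. by have [->|/ip_pos/ltW//] := eqVneq x 0; rewrite linear0l. Qed.

Lemma ip_eq0 x : ip x x = 0 -> x = 0.
Proof. by move=> h; apply/eqP; apply: contraTT isT => /ip_pos; rewrite h ltxx. Qed.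

Lemma ip_bound : exists2 k : R, 0 < k & forall x y, `|ip x y| <= k * `|x| * `|y|.
Proof.
apply: (@bilinear_rV_bound _ _ R^o) => [x|y] a u v; first exact: linearPr.
by rewrite linearPl.
Qed.

Lemma ip_continuousr x : continuous (ip x).
Proof. by apply: (@linear_rV_continuous _ _ R^o) => a u v; rewrite linearPr. Qed.

Lemma ip_continuousl y : continuous (fun x => ip x y).
Proof. by apply: (@linear_rV_continuous _ _ R^o) => a u v; rewrite linearPl. Qed.

Lemma ip_norm_continuous : continuous (fun x => ip x x).
Proof.
have [k k0 kP] := ip_bound.
move=> x; apply/(@cvgrPdist_lt _ _ _ (nbhs x) (nbhs_filter x)) => e e0.
have d0 : 0 < e / (k * (2 * `|x| + 1) + 1).
  by rewrite divr_gt0 // ltr_wpDl // mulr_ge0 ?ltW // ltr_wpDl // mulr_ge0.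
near=> y.
have -> : ip x x - ip y y = ip x (x - y) + ip (x - y) y.
  by rewrite linearBr linearBl; ring.
have xy : `|x - y| < e / (k * (2 * `|x| + 1) + 1).
  by near: y; apply: (@cvgr_dist_lt _ _ _ (nbhs x) _ id).
have y1 : `|y| <= `|x| + 1.
  have : `|x - y| < 1 by near: y; apply: (@cvgr_dist_lt _ _ _ (nbhs x) _ id).
  by have := ler_distD x y 0; rewrite !subr0 [`|y - x|]distrC; lra.
rewrite (le_lt_trans (ler_normD _ _)) //.
rewrite (le_lt_trans (lerD (kP _ _) (kP _ _))) //.
have -> : k * `|x| * `|x - y| + k * `|x - y| * `|y| = k * (`|x| + `|y|) * `|x - y| by ring.
rewrite (@le_lt_trans _ _ (k * (2 * `|x| + 1) * `|x - y|)) //.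
  by rewrite ler_wpM2r // ler_pM2l //; lra.
have kx : 0 <= k * (2 * `|x| + 1) by rewrite mulr_ge0 ?ltW // ltr_wpDl // mulr_ge0.
move: xy; rewrite ltr_pdivlMr; last by lra.
by have := normr_ge0 (x - y); nra.
Unshelve. all: by end_near. Qed.

(** The constant is the minimum of [ip x x] on the unit sphere, which is compact; if the sphere is
    empty then [E] is zero and any constant will do. *)
Lemma ip_coercive : exists2 c : R, 0 < c & forall x, c * `|x| ^+ 2 <= ip x x.
Proof.
pose S := [set x : E | `|x| = 1].
have [[x0 Sx0]|S0] := pselect (S !=set0); last first.
  exists 1 => // x; have [->|x0] := eqVneq x 0.
    by rewrite normr0 expr0n mulr0 ip_ge0.
  exfalso; apply: S0; exists (`|x|^-1 *: x); rewrite /S /= normrZ normfV normr_id mulVf //.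
  by rewrite normr_eq0.
have cS : compact S.
  apply: bounded_closed_compact.
    exists 1; split; first exact: num_real.
    by move=> M M1 x; rewrite /S /= => ->; exact: ltW.
  apply: (closed_comp (f := fun x : E => `|x|)) (@closed_eq R 1) => x _.
  exact: norm_continuous.
have [] := EVT_min_rV (f := fun x : E => ip x x) (ex_intro _ x0 Sx0) cS.
  by apply: continuous_subspaceT; exact: ip_norm_continuous.
move=> c; rewrite inE => Sc cmin; exists (ip c c).
  apply: ip_pos; apply/eqP => c0; move: Sc; rewrite /S /= c0 normr0 => /esym/eqP.
  by rewrite oner_eq0.
move=> x; have [->|xn0] := eqVneq x 0.
  by rewrite normr0 expr0n mulr0 ip_ge0.
have nx : `|x| != 0 by rewrite normr_eq0.
have := cmin (`|x|^-1 *: x); rewrite inE /S /= normrZ normfV normr_id mulVf // => /(_ erefl).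
rewrite linearZl_LR linearZr_LR /= => h.
rewrite -ler_pdivlMr ?exprn_gt0 ?normr_gt0 // (le_trans h) //.
by rewrite expr2 invfM mulrA [leRHS]mulrC.
Qed.

(** The kernel of this map is the orthogonal complement of [V] and its target has the dimension of
    [V], so projections and complements can be found by counting dimensions. *)
Definition gram (V : {vspace E}) (x : E) : 'rV[R]_(\dim V) :=
  \row_i ip x (vbasis V)`_i.

Lemma gram_is_linear (V : {vspace E}) : linear (gram V).
Proof. by move=> c u v; apply/rowP => i; rewrite !mxE linearPl. Qed.

HB.instance Definition _ V := GRing.isLinear.Build R E _ _ (gram V) (@gram_is_linear V).

Lemma gram_eq0 (V : {vspace E}) x : gram V x = 0 -> forall e, e \in V -> ip x e = 0.
Proof.
move=> gx e eV; rewrite (coord_vbasis eV) linear_sumr big1 // => i _.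
by rewrite linearZr_LR /=; have /rowP/(_ i) := gx; rewrite !mxE => ->; rewrite mulr0.
Qed.

Lemma gram_inj_on (V : {vspace E}) x : x \in V -> gram V x = 0 -> x = 0.
Proof. by move=> xV /gram_eq0/(_ x xV); exact: ip_eq0. Qed.

(** The eigenvalue is the maximum of the Rayleigh quotient on the unit sphere of [W]; at a maximiser
    [x0] the component [y] of [f x0] off the line of [x0] must vanish, or moving in its direction
    would increase the quotient. *)
Lemma symmetric_eigenvector (f : {linear E -> E}) (W : {vspace E}) :
  W != 0%VS -> (forall x, x \in W -> f x \in W) ->
  (forall x y, x \in W -> y \in W -> ip (f x) y = ip x (f y)) ->
  exists q : R, exists2 x, x \in W & x != 0 /\ f x = q *: x.
Proof.
move=> W0 fW fs; have [c c0 cP] := ip_coercive.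
pose S := [set x : E | x \in W /\ ip x x = 1].
have scal x : x != 0 -> ip ((Num.sqrt (ip x x))^-1 *: x) ((Num.sqrt (ip x x))^-1 *: x) = 1.
  move=> x0; have s0 : Num.sqrt (ip x x) != 0 by rewrite sqrtr_eq0 -ltNge ip_pos.
  rewrite linearZl_LR linearZr_LR /= -{3}(sqr_sqrtr (ip_ge0 x)).
  by field.
have S0 : S !=set0.
  exists ((Num.sqrt (ip (vpick W) (vpick W)))^-1 *: vpick W); split.
    by rewrite memvZ // memv_pick.
  by apply: scal; rewrite vpick0.
have cS : compact S.
  apply: bounded_closed_compact.
    exists (c^-1 + 1); split; first exact: num_real.
    move=> M M1 x [_ x1]; apply: le_trans (ltW M1).
    have := cP x; rewrite x1 -ler_pdivlMl // mulr1 => h.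
    by have := normr_ge0 x; nra.
  have -> : S = [set` W] `&` [set x | ip x x = 1] by [].
  apply: closedI; first exact: vspace_rV_closed.
  apply: (closed_comp (f := fun x : E => ip x x)) (@closed_eq R 1) => x _.
  exact: ip_norm_continuous.
have lf : linear f by move=> a u v; rewrite linearP.
have cF : continuous (fun x => ip (f x) x).
  (* Polarisation reduces continuity to that of [ip x x]; it uses the symmetry of [ip] only, since
     [f] is symmetric on [W] alone. *)
  pose P4 x := 4^-1 * (ip (f x + x) (f x + x) - ip (f x - x) (f x - x)).
  have -> : (fun x => ip (f x) x) = P4.
    apply/funext => x; rewrite /P4.
    have -> : ip (f x + x) (f x + x) - ip (f x - x) (f x - x) = 4 * ip (f x) x.
      by rewrite !(linearBl, linearBr, linearDl, linearDr) /= (ip_sym x (f x)); ring.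
    by rewrite mulKf // pnatr_eq0.
  move=> x; apply: (@cvgM R _ (nbhs x)); first exact: cvg_cst.
  apply: (@cvgB R R^o _ (nbhs x)).
    apply: (continuous_comp (f := fun x => f x + x) (g := fun x => ip x x)); last exact: ip_norm_continuous.
    by apply: linear_rV_continuous => a u v; rewrite linearP scalerDr addrACA.
  apply: (continuous_comp (f := fun x => f x - x) (g := fun x => ip x x)); last exact: ip_norm_continuous.
  by apply: linear_rV_continuous => a u v; rewrite linearP scalerBr opprD addrACA.
have [] := EVT_max_rV (f := fun x : E => ip (f x) x) S0 cS.
  exact: continuous_subspaceT.
move=> x0; rewrite inE => -[x0W x01] xmax.
pose q := ip (f x0) x0.
have le_q x : x \in W -> ip (f x) x <= q * ip x x.
  move=> xW; have [->|xn0] := eqVneq x 0; first by rewrite linear0 !linear0l mulr0.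
  have := xmax ((Num.sqrt (ip x x))^-1 *: x); rewrite inE => /(_ (conj (memvZ _ xW) (scal _ xn0))).
  rewrite [f (_ *: _)]linearZ_LR /= linearZl_LR linearZr_LR /= -/q mulrA -expr2 exprVn sqr_sqrtr ?ip_ge0 //.
  by rewrite mulrC ler_pdivrMr // ip_pos.
have x0n0 : x0 != 0.
  by apply/eqP => x00; move: x01; rewrite x00 linear0l => /esym/eqP; rewrite oner_eq0.
exists q, x0 => //; split=> //.
have [y yE] : exists y, y = f x0 - q *: x0 by exists (f x0 - q *: x0).
have yW : y \in W by rewrite yE memvB ?memvZ ?fW.
apply/eqP; rewrite -subr_eq0 -yE; apply/eqP/ip_eq0.
have yyE : ip y y = ip (f x0) y - q * ip x0 y by rewrite {1}yE linearBl linearZl_LR.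
pose C := ip (f y) y - q * ip y y.
have quad t : 2 * t * ip y y + t ^+ 2 * C <= 0.
  have := le_q (x0 + t *: y) (memvD x0W (memvZ t yW)).
  have -> : ip (f (x0 + t *: y)) (x0 + t *: y) =
      q + 2 * t * ip (f x0) y + t ^+ 2 * ip (f y) y.
    rewrite [f (_ + _)]linearD [f (_ *: _)]linearZ_LR !(linearDl, linearDr) /=.
    rewrite !(linearZl_LR, linearZr_LR) /= (fs y x0) // (ip_sym y (f x0)) -/q.
    rewrite -![_ *: _]/(_ * _); ring.
  have -> : ip (x0 + t *: y) (x0 + t *: y) = 1 + 2 * t * ip x0 y + t ^+ 2 * ip y y.
    rewrite !(linearDl, linearDr) /= !(linearZl_LR, linearZr_LR) /= (ip_sym y x0) x01.
    rewrite -![_ *: _]/(_ * _); ring.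
  by rewrite /C yyE; lra.
have yy := ip_ge0 y.
apply/eqP; rewrite eq_le yy andbT.
have d0 : 0 < `|C| + 1 by rewrite ltr_wpDl.
(* With this step length the linear term of [quad] outweighs the quadratic one. *)
have := quad (ip y y / (`|C| + 1)); set z := ip y y => h.
have : z ^+ 2 * (2 * (`|C| + 1) + C) <= 0.
  move: h; have -> : 2 * (z / (`|C| + 1)) * z + (z / (`|C| + 1)) ^+ 2 * C =
     z ^+ 2 * (2 * (`|C| + 1) + C) / (`|C| + 1) ^+ 2 by field; rewrite gt_eqF.
  by rewrite pmulr_lle0 // invr_gt0 exprn_gt0.
have : 0 < 2 * (`|C| + 1) + C by have := ler_norm (- C); rewrite normrN; have := normr_ge0 C; lra.
move=> /pmulr_lle0 -> z2; suff : z ^+ 2 == 0 by rewrite sqrf_eq0 => /eqP ->.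
by rewrite eq_le z2 sqr_ge0.
Qed.

End InnerProduct.

(** * Orthogonal symmetric Lie algebras *)

Section SymmetricLieAlgebra.
Context (R : realType) (n : nat).
Notation E := 'rV[R]_n.
Context (br : {bilinear E -> E -> E}) (hbr : lie_bracket br).
Context (hss : semisimple br).
Context (s : {linear E -> E}) (hs : involutive_automorphism br s).
Context (ip : {biscalar E}) (hip : invariant_inner_product br s ip).

Let ip_sym x y : ip x y = ip y x. Proof. by case: hip. Qed.
Let ip_pos x : x != 0 -> 0 < ip x x. Proof. by case: hip => _ + _ _; exact. Qed.
Let ip_s x y : ip (s x) (s y) = ip x y. Proof. by case: hip. Qed.
Let ip_br z x y : s z = z -> ip (br z x) y = - ip x (br z y).
Proof. by case: hip => _ _ _; apply. Qed.
Let ss x : s (s x) = x. Proof. exact: hs.1. Qed.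
Let s_br x y : s (br x y) = br (s x) (s y). Proof. exact: hs.2. Qed.

Lemma br_self x : br x x = 0. Proof. exact: hbr.1. Qed.

Lemma brC x y : br x y = - br y x.
Proof.
have := br_self (x + y); rewrite linearDl /= !linearDr /= !br_self add0r addr0.
by move/eqP; rewrite addr_eq0 => /eqP.
Qed.

Lemma br_jacobi x y z : br x (br y z) = br (br x y) z + br y (br x z).
Proof.
apply/eqP; rewrite -subr_eq0 opprD addrA; apply/eqP.
rewrite -(hbr.2 x y z) (brC (br x y) z) (brC x z) linearNr opprK opprK.
by rewrite addrAC.
Qed.

Lemma mulmx_ad x v : v *m ad br x = br x v.
Proof. exact: mul_rV_lin1. Qed.

Lemma ad_br x y : ad br (br x y) = ad br y *m ad br x - ad br x *m ad br y.
Proof.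
apply/row_matrixP => i; rewrite !rowE mulmxBr !mulmxA !mulmx_ad.
by rewrite br_jacobi addrK.
Qed.

Lemma ad_is_linear : linear (ad br).
Proof.
move=> a x y; apply/row_matrixP => i.
by rewrite !rowE mulmxDr -scalemxAr !mulmx_ad linearPl.
Qed.

Lemma killing_sym x y : killing br x y = killing br y x.
Proof. exact: mxtrace_mulC. Qed.

Lemma killing_linearl y : scalar (killing br ^~ y).
Proof.
by move=> a u v; rewrite /killing ad_is_linear mulmxDl -scalemxAl mxtraceD mxtraceZ.
Qed.

Lemma killing_linearr x : scalar (killing br x).
Proof. by move=> a u v; rewrite killing_sym killing_linearl !(killing_sym _ x). Qed.

Lemma killing0r x : killing br x 0 = 0.
Proof. by have := killing_linearr x 1 0 0; rewrite scaler0 addr0; lra. Qed.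

Lemma killingNl x y : killing br (- x) y = - killing br x y.
Proof. by rewrite -scaleN1r -[_ *: _]addr0 killing_linearl (killing_sym 0) killing0r; lra. Qed.

Lemma killingNr x y : killing br x (- y) = - killing br x y.
Proof. by rewrite killing_sym killingNl killing_sym. Qed.

Lemma killing_br x y z : killing br (br x y) z = killing br x (br y z).
Proof.
rewrite /killing !ad_br mulmxBl mulmxBr !linearB /= !mulmxA.
by congr (_ - _); rewrite -[in LHS]mulmxA mxtrace_mulC.
Qed.

Lemma killing_s x y : killing br (s x) (s y) = killing br x y.
Proof.
have adS u : ad br (s u) = lin1_mx s *m ad br u *m lin1_mx s.
  apply/row_matrixP => i; rewrite !rowE !mulmxA !mulmx_ad mul_rV_lin1 /=.
  by rewrite [X in br u X]mul_rV_lin1 /= s_br ss.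
have SS : lin1_mx s *m lin1_mx s = 1%:M.
  by apply/row_matrixP => i; rewrite !rowE !mulmxA mulmx1 !mul_rV_lin1 /= ss.
rewrite /killing !adS -!mulmxA (mulmxA (lin1_mx s) (lin1_mx s)) SS mul1mx.
by rewrite mxtrace_mulC -!mulmxA SS mulmx1.
Qed.

Lemma killing_inj x x' : (forall y, killing br x y = killing br x' y) -> x = x'.
Proof.
move=> h; apply/eqP; rewrite -subr_eq0; apply/eqP/hss => y.
rewrite addrC -scaleN1r killing_linearl h; ring.
Qed.

Lemma form_mx (f : E -> E -> R) : (forall y, scalar (f ^~ y)) -> (forall x, scalar (f x)) ->
  forall x y, f x y = (x *m (\matrix_(i, j) f 'e_i 'e_j) *m y^T) 0 0.
Proof.
move=> fl fr x y.
pose gl z : {scalar E} := HB.pack (f ^~ z) (GRing.isLinear.Build _ _ _ _ (f ^~ z) (fl z)).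
pose gr z : {scalar E} := HB.pack (f z) (GRing.isLinear.Build _ _ _ _ (f z) (fr z)).
rewrite {1}(row_sum_delta x) -[f _ y]/(gl y _) linear_sum /=.
rewrite mxE; under [RHS]eq_bigr do rewrite mxE mulr_suml.
rewrite exchange_big; apply: eq_bigr => i _.
rewrite -[f _ y]/(gl y _) linearZ_LR /= {1}(row_sum_delta y) -[f _ _]/(gr _ _) linear_sum /=.
rewrite mulr_sumr; apply: eq_bigr => j _.
by rewrite -[f _ _]/(gr _ _) linearZ_LR /= !mxE; ring.
Qed.

Definition killing_mx : 'M[R]_n := \matrix_(i, j) killing br 'e_i 'e_j.
Definition ip_mx : 'M[R]_n := \matrix_(i, j) ip 'e_i 'e_j.

Lemma killing_mxE x y : killing br x y = (x *m killing_mx *m y^T) 0 0.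
Proof. by apply: form_mx; [exact: killing_linearl|exact: killing_linearr]. Qed.

Lemma ip_mxE x y : ip x y = (x *m ip_mx *m y^T) 0 0.
Proof. by apply: form_mx => z a u v; [rewrite linearPl|rewrite linearPr]. Qed.

Lemma killing_mx_unit : killing_mx \in unitmx.
Proof.
rewrite unitmxE unitfE; apply/det0P => -[v v0 vK]; case/eqP: v0; apply: hss => y.
by rewrite killing_mxE vK mul0mx mxE.
Qed.

(** The operator that expresses [ip] through the Killing form. It transports to [ip] the
    consequences of invariance under [ad x] for [x] in [p], under which [ip] itself need not be
    invariant. *)
Definition killing_dual (x : E) : E := x *m (ip_mx *m invmx killing_mx).

HB.instance Definition _ := GRing.isLinear.Build R E E _ killing_dual
  (fun a u v => linearP (mulmxr (ip_mx *m invmx killing_mx)) a u v).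

Notation U := killing_dual.

Lemma killing_dualE x y : killing br (U x) y = ip x y.
Proof. by rewrite killing_mxE ip_mxE /killing_dual mulmxA mulmxKV ?killing_mx_unit. Qed.

Lemma s_killing_dual x : s (U x) = U (s x).
Proof.
apply: killing_inj => y; rewrite -[X in killing br (s (U x)) X]ss killing_s !killing_dualE.
by rewrite -ip_s ss.
Qed.

Lemma killing_dual_br z x : s z = z -> U (br z x) = br z (U x).
Proof.
move=> zk; apply: killing_inj => y; rewrite killing_dualE ip_br //.
by rewrite -killing_dualE (brC z (U x)) killingNl killing_br.
Qed.

(** For [z] in [k] the map [ad z] is skew for [ip], so the trace of its square is nonpositive and
    vanishes only if [ad z = 0], that is [z = 0] by semisimplicity. *)
Lemma killing_neg_definite z : s z = z -> 0 <= killing br z z -> z = 0.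
Proof.
move=> zk zz; have ad0 : ad br z = 0.
  apply: (mxtrace_sqr_skew (P := ip_mx)) => //.
  - by apply/matrixP => i j; rewrite !mxE ip_sym.
  - by move=> u u0; rewrite -ip_mxE ip_pos.
  - apply/matrixP => i j; have := ip_br 'e_i 'e_j zk.
    rewrite !ip_mxE -!mulmx_ad trmx_mul !mulmxA -!rowE trmx_delta -!mulmxA -!colE !mxE.
    move=> h; transitivity (\sum_l row i (ad br z) 0 l * col j ip_mx l 0).
      by apply: eq_bigr => l _; rewrite !mxE.
    by rewrite h; congr (- _); apply: eq_bigr => l _; rewrite !mxE.
by apply: hss => y; rewrite /killing ad0 mul0mx mxtrace0.
Qed.

Lemma br_pp x y : s x = - x -> s y = - y -> s (br x y) = br x y.
Proof. by move=> xp yp; rewrite s_br xp yp linearNr linearNl opprK. Qed.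

Lemma br_kp z x : s z = z -> s x = - x -> s (br z x) = - br z x.
Proof. by move=> zk xp; rewrite s_br zk xp linearNr. Qed.

Lemma br_pk x z : s x = - x -> s z = z -> s (br x z) = - br x z.
Proof. by move=> xp zk; rewrite s_br zk xp linearNl. Qed.

Lemma killing_dual_p x : s x = - x -> s (U x) = - U x.
Proof. by move=> xp; rewrite s_killing_dual xp linearN. Qed.

(** The element [w = [U x, x]] lies in [k], and its Killing square is [ip x [x, w]], which is zero
    because [ad w] is skew. *)
Lemma br_killing_dual_self x : s x = - x -> br (U x) x = 0.
Proof.
move=> xp; set w := br (U x) x.
have wk : s w = w by apply: br_pp => //; exact: killing_dual_p.
apply: killing_neg_definite => //.
rewrite {1}/w killing_br killing_dualE brC linearNr /=.
suff : ip x (br w x) = 0 by move=> ->; rewrite oppr0.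
have := ip_br x x wk; rewrite ip_sym; lra.
Qed.

(** Polarisation of [br_killing_dual_self]. *)
Lemma br_killing_dual x y : s x = - x -> s y = - y -> br (U x) y = br x (U y).
Proof.
move=> xp yp; have := @br_killing_dual_self (x + y).
rewrite linearD xp yp opprD => /(_ erefl).
rewrite [U _]linearD linearDl /= !linearDr /= !br_killing_dual_self // add0r addr0.
by move/eqP; rewrite addr_eq0 => /eqP ->; rewrite brC opprK.
Qed.

(** * The maximal abelian subspace: roots, regular elements, chambers *)

Section MaximalAbelian.
Context (a : {vspace E}) (ha : maximal_abelian br (anti_fixed_part s) a).

Let a_p x : x \in a -> s x = - x. Proof. by move=> xa; case: ha => + _ _; exact. Qed.
Let a_ab x y : x \in a -> y \in a -> br x y = 0. Proof. by case: ha => _ + _; exact. Qed.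

Lemma maximal_abelian_centralizer x :
  s x = - x -> (forall y, y \in a -> br x y = 0) -> x \in a.
Proof.
move=> xp xa; case: ha => _ _ /(_ (a + <[x]>)%VS) h.
rewrite -h ?addvSl //; first exact: (subvP (addvSr _ _)) (memv_line x).
  move=> _ /memv_addP[y ya [_ /vlineP[c ->] ->]].
  by rewrite /anti_fixed_part /= linearD linearZ /= xp a_p // opprD scalerN.
move=> _ _ /memv_addP[y ya [_ /vlineP[c ->] ->]] /memv_addP[y' ya' [_ /vlineP[c' ->] ->]].
rewrite linearDl /= !linearDr /= !linearZl_LR !linearZr_LR /= br_self (a_ab ya ya').
by rewrite (xa _ ya') (brC y x) (xa _ ya) !(scaler0, oppr0, addr0).
Qed.

(** For [y] in [a] the element [w = [U x, y] = [x, U y]] of [k] commutes with [y], by the Jacobi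
    identity and [[U y, y] = 0]. Its Killing square is the pairing of [U x] with [[y, w]], hence
    zero. *)
Lemma killing_dual_a x : x \in a -> U x \in a.
Proof.
move=> xa; have xp := a_p xa.
apply: maximal_abelian_centralizer => [|y ya]; first exact: killing_dual_p.
have yp := a_p ya.
set w := br (U x) y.
have wk : s w = w by apply: br_pp => //; exact: killing_dual_p.
have wx : br w x = 0.
  have := br_jacobi x (U x) y.
  rewrite (a_ab xa ya) linear0r addr0 (brC x (U x)) br_killing_dual_self // oppr0 linear0l => h.
  by rewrite brC h oppr0.
have wy : br w y = 0.
  rewrite /w br_killing_dual //; have := br_jacobi y x (U y).
  rewrite (a_ab ya xa) linear0l add0r (brC y (U y)) br_killing_dual_self // oppr0 linear0r => h.
  by rewrite brC h oppr0.
apply: killing_neg_definite => //.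
rewrite {1}/w killing_br (brC y w) wy oppr0.
by rewrite killing0r.
Qed.

(** In terms of the Killing form this is, up to sign, the pairing of [z] with [[U y, x]], and both
    [U y] and [x] lie in [a]. *)
Lemma ip_br_ka z x y : s z = z -> x \in a -> y \in a -> ip (br z x) y = 0.
Proof.
move=> zk xa ya; rewrite ip_sym -killing_dualE (brC z x) killingNr -killing_br (a_ab (killing_dual_a ya) xa).
by rewrite killing_sym killing0r oppr0.
Qed.

Lemma br_a_comm h h' x : h \in a -> h' \in a -> br h (br h' x) = br h' (br h x).
Proof. by move=> ka ka'; rewrite br_jacobi (a_ab ka ka') linear0l add0r. Qed.

Lemma killing_dual_br2 h h' x : h \in a -> h' \in a -> s x = - x ->
  U (br h (br h' x)) = br h (br h' (U x)).
Proof.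
move=> ka ka' xp; have zk := br_pp (a_p ka') xp.
rewrite (brC h) linearN /= killing_dual_br // -brC br_jacobi.
rewrite (a_ab (killing_dual_a ka) ka') linear0l add0r.
by rewrite (br_killing_dual (a_p ka) xp) (br_a_comm _ ka' ka).
Qed.

(** A single [ad h] exchanges [k] and [p] and need not be symmetric for [ip]. A product of two
    preserves [p] and commutes with [U] there, so it inherits its symmetry from the Killing form. *)
Lemma ip_br2_sym h h' x y : h \in a -> h' \in a -> s x = - x -> s y = - y ->
  ip (br h (br h' x)) y = ip x (br h (br h' y)).
Proof.
move=> ka ka' xp yp; rewrite -!killing_dualE killing_dual_br2 //.
rewrite (brC h) killingNl killing_br (brC h') killingNl opprK killing_br.
by rewrite br_a_comm.
Qed.

(** The two equations say that the complex number [al + i be] annihilates [x + i y]. *)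
Lemma rotation_eq0 (al be : R) (x y : E) : al *: x - be *: y = 0 -> be *: x + al *: y = 0 ->
  al != 0 \/ be != 0 -> x = 0 /\ y = 0.
Proof.
move=> e1 e2 ab; have ab0 : al ^+ 2 + be ^+ 2 != 0.
  by rewrite paddr_eq0 ?sqr_ge0 // !sqrf_eq0 negb_and; apply/orP.
split; apply: (scalerI ab0); rewrite scaler0.
  rewrite -[RHS](_ : al *: (al *: x - be *: y) + be *: (be *: x + al *: y) = 0).
    by apply/rowP => i; rewrite !mxE; ring.
  by rewrite e1 e2 !scaler0 addr0.
rewrite -[RHS](_ : al *: (be *: x + al *: y) - be *: (al *: x - be *: y) = 0).
  by apply/rowP => i; rewrite !mxE; ring.
by rewrite e1 e2 !scaler0 subr0.
Qed.

Definition p_part : {vspace E} := lker (linfun s + \1)%VF.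

Lemma p_partE x : (x \in p_part) = (s x == - x).
Proof. by rewrite memv_ker add_lfunE lfunE id_lfunE addr_eq0. Qed.

Lemma br_a_s h u : h \in a -> br h (s u) = - s (br h u).
Proof. by move=> ka; rewrite s_br (a_p ka) linearNl opprK. Qed.

(* The components of a root vector [x + i y] in [k] and [p]: [z1 + i z2] and
   [y1 + i y2], up to the factor 2. *)
Lemma root_vector_parts mu nu x y h : h \in a ->
  br h x = mu *: x - nu *: y -> br h y = nu *: x + mu *: y ->
  [/\ br h (x + s x) = mu *: (x - s x) - nu *: (y - s y),
      br h (y + s y) = nu *: (x - s x) + mu *: (y - s y),
      br h (x - s x) = mu *: (x + s x) - nu *: (y + s y) &
      br h (y - s y) = nu *: (x + s x) + mu *: (y + s y)].
Proof.
move=> ka ex ey.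
have es u := br_a_s u ka.
have sx (u v : E) (c d : R) : s (c *: u + d *: v) = c *: s u + d *: s v.
  by rewrite linearD !linearZ.
have esx := sx x y mu (- nu); have esy := sx x y nu mu; rewrite scaleNr in esx.
by split; rewrite !linearDr /= ?linearNr !es ?ex ?ey ?esx ?esy;
  apply/rowP => i; rewrite !mxE; ring.
Qed.

(** If a root vanished at [h], the [p] part of its root vector would commute with [h] and so lie in
    [a]. At an [h'] where the root is nonzero, this forces the [k] part to be zero; the root vector
    is then in [a], and [ad h'] kills it, a contradiction. *)
Lemma centralizer_regular h : h \in a ->
  (forall x, s x = - x -> br h x = 0 -> x \in a) -> regular_set br a h.
Proof.
move=> ka hc; split=> // mu nu [[h' ka' hmn'] [x [y [xy0 root]]]].
have [mu0|] := eqVneq (mu h) 0; last by left.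
have [nu0|] := eqVneq (nu h) 0; last by right.
exfalso.
have [ex ey] := root h ka; rewrite mu0 nu0 !scale0r subr0 add0r in ex ey.
have [ex' ey'] := root h' ka'.
have pa u : br h u = 0 -> u - s u \in a.
  move=> hu; apply: hc; first by rewrite linearB /= ss opprB.
  by rewrite linearBr /= br_a_s // hu linear0 oppr0 subr0.
have [ezx ezy epx epy] := root_vector_parts ka' ex' ey'.
have [px py] := (pa _ ex, pa _ ey).
rewrite !(a_ab ka') // in epx epy.
have [zx zy] := rotation_eq0 (esym epx) (esym epy) hmn'.
have half u : u + s u = 0 -> u - s u \in a -> u \in a.
  move=> /eqP; rewrite addr_eq0 => /eqP us; rewrite -us -mulr2n -scaler_nat => ua.
  by rewrite -[u](scalerK (_ : 2%:R != 0 :> R)) ?pnatr_eq0 // memvZ.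
have xa : x \in a := half _ zx px; have ya : y \in a := half _ zy py.
rewrite !(a_ab ka') // in ex' ey'.
by have [x0 y0] := rotation_eq0 (esym ex') (esym ey') hmn'; move: xy0; rewrite x0 y0 eqxx => -[].
Qed.

(** The span of [y] and [[h1, y]] is stable under [ad h'] for all [h'] in [a], and yields a root
    proportional to [q]: a real one if [q h1 > 0], an imaginary one if [q h1 < 0]. It vanishes at
    [h], because [ad h] kills [y] and therefore [[h1, y]]. *)
Lemma common_eigenvector_not_regular y h1 (q : E -> R) h :
  y != 0 -> s y = - y -> h1 \in a -> h \in a ->
  (forall h', h' \in a -> br h' (br h1 y) = q h' *: y) -> q h1 != 0 ->
  br h y = 0 -> ~ regular_set br a h.
Proof.
move=> y0 yp ka1 ka qE q1 hy [_ reg].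
have qh : q h = 0.
  apply/eqP; have /eqP := qE h ka; rewrite br_a_comm // hy linear0r eq_sym scaler_eq0.
  by rewrite (negPf y0) orbF.
have brE h' : h' \in a -> br h' y = (q h' / q h1) *: br h1 y.
  move=> ka'; set k := q h' / q h1; apply/eqP; rewrite -subr_eq0.
  (* The element [h2] is chosen with [q h2 = 0], so that it kills [[h1, y]]. Then [q h1 *: [h2, y] =
     [h2, [h1, [h1, y]]] = 0]. *)
  rewrite -linearZl_LR -linearBl /=; set h2 := h' - k *: h1.
  have ka2 : h2 \in a by rewrite memvB ?memvZ.
  have h20 : br h2 (br h1 y) = 0.
    by rewrite linearBl /= linearZl_LR /= !qE // scalerA divfK // subrr.
  apply/eqP/(scalerI q1); rewrite scaler0 -linearZr_LR -qE //.
  by rewrite br_a_comm // h20 linear0r.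
have [q1pos|q1neg] := ltrP 0 (q h1).
  pose l := Num.sqrt (q h1); have ll : l * l = q h1 by rewrite -expr2 sqr_sqrtr ?ltW.
  have l0 : l != 0 by rewrite sqrtr_eq0 -ltNge.
  have : restricted_root br a (fun h' => q h' / l) (fun=> 0).
    split; first by exists h1 => //; left; rewrite mulf_neq0 ?invr_eq0.
    (* A real eigenvector. It is nonzero because its [p] part is [y] and its other term lies in
       [k]. *)
    exists (y + l^-1 *: br h1 y), 0; split.
      left; apply: contra_neq y0 => e.
      have : s (y + l^-1 *: br h1 y) = 0 by rewrite e linear0.
      rewrite linearD linearZ /= (br_pp (a_p ka1) yp) yp => e'.
      have : 2%:R *: y = 0.
        rewrite -[RHS](subrr (0 : E)) -{1}e -e'; apply/rowP => i; rewrite !mxE; ring.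
      by move/eqP; rewrite scaler_eq0 pnatr_eq0 => /eqP.
    move=> h' ka'; rewrite !linear0r !scaler0 addr0 subr0 scale0r; split=> //.
    rewrite linearDr /= linearZr_LR /= brE // qE // scalerDr !scalerA addrC; congr (_ *: _ + _ *: _).
      by rewrite mulrC.
    by rewrite -ll; field.
  by move=> /reg; rewrite qh mul0r eqxx => -[].
pose l := Num.sqrt (- q h1); have ll : l * l = - q h1 by rewrite -expr2 sqr_sqrtr // oppr_ge0.
have l0 : l != 0 by rewrite sqrtr_eq0 -ltNge oppr_gt0 lt_neqAle q1.
have : restricted_root br a (fun=> 0) (fun h' => - q h' / l).
  split; first by exists h1 => //; right; rewrite mulf_neq0 ?invr_eq0 ?oppr_eq0.
  exists y, (- l^-1 *: br h1 y); split; first by left.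
  move=> h' ka'; rewrite !scale0r addr0 sub0r; split.
    rewrite brE // scalerA -scaleNr; congr (_ *: _).
    by rewrite -[q h1]opprK -ll; field.
  by rewrite linearZr_LR /= qE // scalerA; congr (_ *: _); field.
by move=> /reg; rewrite qh oppr0 mul0r eqxx => -[].
Qed.

(* Otherwise the orthogonal complement of [a] in the centralizer contains a
   common eigenvector of the commuting symmetric maps [ad h' \o ad h'']: take
   an invariant subspace of minimal dimension. *)
Lemma regular_centralizer h x :
  regular_set br a h -> s x = - x -> br h x = 0 -> x \in a.
Proof.
move=> reg xp hx; have ka : h \in a by case: reg.
apply: contrapT => xa.
pose Z := (p_part :&: lker (linfun (br h)))%VS.
have ZP u : u \in Z <-> s u = - u /\ br h u = 0.
  rewrite memv_cap p_partE memv_ker lfunE /=.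
  by split=> [/andP[/eqP up /eqP hu]|[-> ->]] //; rewrite !eqxx.
have aZ : (a <= Z)%VS by apply/subvP => u ua; apply/ZP; rewrite a_p // a_ab.
pose V := (Z :&: lker (linfun (gram ip a)))%VS.
have VP u : u \in V -> [/\ s u = - u, br h u = 0 & forall e, e \in a -> ip u e = 0].
  rewrite memv_cap memv_ker lfunE /= => /andP[/ZP[up hu] /eqP gu]; split=> //.
  exact: gram_eq0.
have V0 : V != 0%VS.
  (* Were [V] zero, [gram] would embed [Z] into a space of dimension [\dim a]; then [a = Z],
     although [x] lies in [Z] and not in [a]. *)
  apply/eqP => V0; have := limg_ker_dim (linfun (gram ip a)) Z.
  rewrite -/V V0 dimv0 add0n => dimZ.
  have : (\dim Z <= \dim a)%N.
    rewrite -dimZ (leq_trans (dimvS (subvf _))) // dimvf.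
    by rewrite dim_matrix mul1r.
  move=> le; apply: xa; have /eqP -> : a == Z by rewrite eqEdim aZ.
  exact/ZP.
apply: xa.
pose inv (W : {vspace E}) := forall h' h'' u, h' \in a -> h'' \in a -> u \in W ->
  br h' (br h'' u) \in W.
have invV : inv V.
  move=> h' h'' u ka' ka'' uV; have [up hu uperp] := VP u uV.
  have u2p : s (br h' (br h'' u)) = - br h' (br h'' u).
    by apply: br_pk (a_p ka') _; apply: br_pp (a_p ka'') up.
  rewrite memv_cap memv_ker lfunE /=; apply/andP; split.
    apply/ZP; split=> //.
    by rewrite br_a_comm // (br_a_comm _ ka ka'') hu !linear0r.
  apply/eqP/rowP => i; rewrite !mxE ip_br2_sym //; last first.
    by apply/a_p/vbasis_mem/mem_nth; rewrite size_tuple.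
  rewrite (a_ab ka'') ?linear0r ?linear0r //.
  by apply/vbasis_mem/mem_nth; rewrite size_tuple.
pose P d := `[< exists W : {vspace E}, [/\ (W <= V)%VS, W != 0%VS, inv W & \dim W = d] >].
have exP : exists d, P d by exists (\dim V); apply/asboolP; exists V.
case: (ex_minnP exP) => d /asboolP[W [WV W0 invW dimW]] dmin.
have scal h' h'' : h' \in a -> h'' \in a -> exists q : R, forall u, u \in W ->
    br h' (br h'' u) = q *: u.
  move=> ka' ka''.
  pose f : {linear E -> E} := br h' \o br h''.
  have fsym u v : u \in W -> v \in W -> ip (f u) v = ip u (f v).
    by move=> /(subvP WV)/VP[up _ _] /(subvP WV)/VP[vp _ _]; exact: ip_br2_sym.
  have fW u : u \in W -> f u \in W by move=> uW; exact: invW.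
  have [q [u uW [u0 fu]]] := symmetric_eigenvector ip_sym ip_pos W0 fW fsym.
  (* The eigenspace inside [W] is again invariant, since all these maps commute; by minimality it is
     the whole of [W], on which the map is thus a scalar. *)
  exists q; pose W' := (W :&: lker (linfun f - q *: \1%VF))%VS.
  have W'P v : v \in W' <-> v \in W /\ f v = q *: v.
    rewrite memv_cap memv_ker add_lfunE opp_lfunE scale_lfunE id_lfunE lfunE subr_eq0.
    by split=> [/andP[-> /eqP]|[-> /eqP]].
  have W'E : W' = W.
    apply/eqP; rewrite eqEdim capvSl dimW /=; apply: dmin; apply/asboolP; exists W'; split=> //.
    - by apply: subv_trans WV; exact: capvSl.
    - by apply: contra_neq u0 => W'0; apply/eqP; rewrite -memv0 -W'0; apply/W'P.
    - move=> k' k'' v kk' kk'' /W'P[vW fv]; apply/W'P; split; first exact: invW.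
      rewrite /f /= !(br_a_comm _ ka'' kk') (br_a_comm _ ka'' kk'') (br_a_comm _ ka' kk').
      by rewrite (br_a_comm _ ka' kk'') -[br h' _]/(f v) fv !linearZr_LR.
  by move=> v; rewrite -{1}W'E => /W'P[].
pose y := vpick W.
have y0 : y != 0 by rewrite vpick0.
have yW : y \in W by exact: memv_pick.
have [yp hy yperp] := VP y (subvP WV _ yW).
have [[h1 ka1 h1y]|nh1] := pselect (exists2 h1, h1 \in a & br h1 y <> 0); last first.
  exfalso; have ya : y \in a.
    apply: maximal_abelian_centralizer => // e ea; rewrite brC.
    by apply: contrapT => ne; apply: nh1; exists e => // e0; apply: ne; rewrite e0 oppr0.
  by have := ip_pos y0; rewrite yperp // ltxx.
have qP h' : exists q : R, h' \in a -> br h' (br h1 y) = q *: y.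
  have [ka'|_] := boolP (h' \in a); last by exists 0.
  by have [q qE] := scal h' h1 ka' ka1; exists q => _; exact: qE.
have /choice[q qE] := qP.
exfalso; apply: (@common_eigenvector_not_regular y h1 q h) => //.
(* If [q h1 = 0], then [h1] kills [[h1, y]], which lies in [k] and thus has Killing square zero. *)
apply/eqP => q0; apply: h1y; have := qE h1 ka1; rewrite q0 scale0r => z0.
have zk := br_pp (a_p ka1) yp.
apply: killing_neg_definite => //.
by rewrite {1}(brC h1 y) killingNl killing_br z0 killing0r oppr0.
Qed.

(** Since the centralizer of [h] in [p] is [a], the map [ad h] is injective on a complement of [a]
    in [p], with bounded left inverse [g]. Injectivity survives a small perturbation, and
    [centralizer_regular] turns it back into regularity. *)
Lemma regular_near h e : regular_set br a h -> e \in a ->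
  exists2 t : R, 0 < t & forall r, 0 <= r <= t -> regular_set br a (h + r *: e).
Proof.
move=> reg ea; have ka : h \in a by case: reg.
have [|g gE] := @left_inverse_on R n n (p_part :\: a)%VS (br h); last first.
  have [k k0 kP] : exists2 k : R, 0 < k & forall x, `|g x| <= k * `|x|.
    by apply: linear_rV_bound => c u v; rewrite linearP.
  have [l l0 lP] : exists2 l : R, 0 < l & forall x, `|br e x| <= l * `|x|.
    by apply: linear_rV_bound => c u v; rewrite linearPr.
  (* Below this bound the perturbation costs at most half of [|v|], hence [|v| <= |v| / 2]. *)
  exists (2 * k * l)^-1; first by rewrite invr_gt0 !mulr_gt0.
  move=> r /andP[r0 rt].
  have ha' : h + r *: e \in a by rewrite memvD ?memvZ.
  apply: centralizer_regular => // x xp hx.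
  have : x \in p_part by rewrite p_partE xp.
  rewrite -(addv_diff_cap p_part a) => /memv_addP[v vp [u /memv_capP[_ ua] xE]].
  suff v0 : v = 0 by rewrite xE v0 add0r.
  have : br (h + r *: e) v = 0.
    by have := hx; rewrite xE linearDr /= (a_ab ha' ua) addr0.
  rewrite linearDl /= linearZl_LR /= => /eqP; rewrite addr_eq0 => /eqP hv.
  have nv : `|v| <= k * (r * (l * `|v|)).
    have := kP (br h v); rewrite gE // hv normrN normrZ ger0_norm // => /le_trans; apply.
    by rewrite ler_pM2l // ler_wpM2l.
  have krl : k * r * l <= 2^-1.
    have := rt; rewrite -(ler_pM2l (mulr_gt0 k0 l0)) => h1.
    rewrite mulrAC (le_trans h1) //.
    have -> : k * l / (2 * k * l) = 2^-1 by field; rewrite !gt_eqF.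
    by [].
  apply/eqP; rewrite -normr_eq0 eq_le normr_ge0 andbT.
  have : `|v| <= 2^-1 * `|v|.
    apply: le_trans nv _; rewrite !mulrA ler_wpM2r //.
  lra.
move=> x xV hx; apply/eqP; rewrite -memv0 -(capv_diff p_part a) memv_cap xV /=.
apply: (regular_centralizer reg) hx.
by apply/eqP; rewrite -p_partE; apply: subvP xV; exact: diffvSl.
Qed.

Lemma segment_component h e t : 0 <= t ->
  (forall r, 0 <= r <= t -> regular_set br a (h + r *: e)) ->
  connected_component (regular_set br a) h (h + t *: e).
Proof.
move=> t0 reg.
pose f r : E := h + r *: e.
suff : f @` `[0, t] `<=` connected_component (regular_set br a) h.
  by apply; exists t; rewrite /= ?in_itv /= ?lexx ?t0.
apply: connected_component_max.
- by exists 0; rewrite /= ?in_itv /= ?lexx ?t0 // /f scale0r addr0.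
- by move=> _ [r + <-]; rewrite /= in_itv /= => rt; exact: reg.
- apply: connected_continuous_connected; first exact: segment_connected.
  apply: continuous_subspaceT => r; apply: cvgD; first exact: cvg_cst.
  exact: scalel_continuous.
Qed.

(** The real part of the Hermitian product of [(m1 + i n1) zeta] and [(m2 + i n2) zeta] for
    [zeta = u + i v]. *)
Lemma ip_rotation (m1 n1 m2 n2 : R) (u v : E) :
  (m1 * m2 + n1 * n2) * (ip u u + ip v v) =
  ip (m1 *: u - n1 *: v) (m2 *: u - n2 *: v) + ip (n1 *: u + m1 *: v) (n2 *: u + m2 *: v).
Proof.
rewrite !(linearBl, linearDl) /= !(linearBr, linearDr) /= !linearZl_LR /= !linearZr_LR /=.
by rewrite (ip_sym v u) -![_ *: _]/(_ * _); ring.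
Qed.

(** The last two hypotheses are the first and second variation of [ip h] along the orbit of [b], in
    the directions of [k]. *)
Lemma critical_in_closure h b : regular_set br a h -> s b = - b ->
  (forall z, s z = z -> ip h (br z b) = 0) ->
  (forall z, s z = z -> ip h (br z (br z b)) <= 0) ->
  closure (connected_component (regular_set br a) h) b.
Proof.
move=> reg bp crit1 crit2; have ka : h \in a by case: reg.
have kp := a_p ka.
have bUh : br b (U h) = 0.
  (* This element of [k] has Killing square [ip h [w, b]], which is a first variation. *)
  set w := br b (U h).
  have wk : s w = w by apply: br_pp => //; exact: killing_dual_p.
  apply: killing_neg_definite => //.
  rewrite {1}/w (brC b) killingNl killing_br (brC b w) killingNr opprK.
  by rewrite killing_dualE crit1.
have hUb : br h (U b) = 0 by rewrite -br_killing_dual // brC bUh oppr0.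
(* Since [U b] commutes with the regular [h], it lies in [a]; and [U], being injective, maps [a]
   onto itself. *)
have ba : b \in a.
  have Uba : U b \in a by apply: (regular_centralizer reg) => //; exact: killing_dual_p.
  have Uinj x : U x = 0 -> x = 0.
    by move=> Ux; apply: (ip_eq0 ip_pos); rewrite -killing_dualE Ux killing_sym killing0r.
  have : (linfun U @: a)%VS == a.
    rewrite eqEdim; apply/andP; split.
      by apply/subvP => _ /memv_imgP[u ua ->]; rewrite lfunE /= killing_dual_a.
    rewrite limg_dim_eq //; apply/eqP; rewrite -subv0; apply/subvP => u.
    by rewrite memv_cap memv_ker lfunE memv0 /= => /andP[_ /eqP/Uinj ->].
  move=> /eqP Ua; move: Uba; rewrite -{1}Ua => /memv_imgP[b' b'a]; rewrite lfunE /= => Ubb'.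
  suff -> : b = b' by [].
  by apply/eqP; rewrite -subr_eq0; apply/eqP/Uinj; rewrite linearB /= Ubb' subrr.
have regt t : 0 <= t < 1 -> regular_set br a (h + t *: (b - h)).
  move=> /andP[t0 t1]; split; first by rewrite memvD ?memvZ ?memvB.
  move=> mu nu rt; case: (rt) => _ [x [y [xy0 root]]].
  have hmn : mu h != 0 \/ nu h != 0 by case: reg => _; apply.
  have [muT0|] := eqVneq (mu (h + t *: (b - h))) 0; last by left.
  have [nuT0|] := eqVneq (nu (h + t *: (b - h))) 0; last by right.
  exfalso.
  have [ex ey] := root _ ka; have [fx fy] := root _ ba.
  have kta : h + t *: (b - h) \in a by rewrite memvD ?memvZ ?memvB.
  have [gx gy] := root _ kta; rewrite muT0 nuT0 !scale0r subr0 add0r in gx gy.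
  (* The functions [mu] and [nu] are not assumed linear; that they are affine along the segment is
     read off from the root vector. *)
  pose M := (1 - t) * mu h + t * mu b; pose N := (1 - t) * nu h + t * nu b.
  have MN1 : M *: x - N *: y = 0.
    rewrite -gx linearDl /= linearZl_LR /= linearBl /= ex fx.
    by apply/rowP => i; rewrite !mxE /M /N; ring.
  have MN2 : N *: x + M *: y = 0.
    rewrite -gy linearDl /= linearZl_LR /= linearBl /= ey fy.
    by apply/rowP => i; rewrite !mxE /M /N; ring.
  have [M0 N0] : M = 0 /\ N = 0.
    have [M0|M0] := eqVneq M 0; have [N0|N0] := eqVneq N 0 => //; exfalso.
    - by have [x0 y0] := rotation_eq0 MN1 MN2 (or_intror N0); move: xy0; rewrite x0 y0 eqxx => -[].
    - by have [x0 y0] := rotation_eq0 MN1 MN2 (or_introl M0); move: xy0; rewrite x0 y0 eqxx => -[].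
    - by have [x0 y0] := rotation_eq0 MN1 MN2 (or_introl M0); move: xy0; rewrite x0 y0 eqxx => -[].
  have [hz1 hz2 hy1 hy2] := root_vector_parts ka ex ey.
  have [bz1 bz2 _ _] := root_vector_parts ba fx fy.
  have zk u : s (u + s u) = u + s u by rewrite linearD /= ss addrC.
  (* The second variation in the direction [u + s u] of [k], one bracket being moved across by
     skewness. *)
  have pos u : 0 <= ip (br h (u + s u)) (br b (u + s u)).
    have := crit2 _ (zk u); rewrite -[ip h _]opprK -ip_br // oppr_le0.
    by rewrite (brC _ h) (brC _ b) linearNl linearNr opprK.
  set z1 := x + s x in hz1 hz2 hy1 hy2 bz1 bz2.
  set z2 := y + s y in hz1 hz2 hy1 hy2 bz1 bz2.
  set y1 := x - s x in hz1 hz2 hy1 hy2 bz1 bz2.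
  set y2 := y - s y in hz1 hz2 hy1 hy2 bz1 bz2.
  (* The squared length of the [p] part of the root vector. By [ip_rotation] the second variations
     add up to [S] times the real part of the root at [h] times its conjugate at [b]. *)
  pose S := ip y1 y1 + ip y2 y2.
  have sum : (mu h * mu b + nu h * nu b) * S =
      ip (br h z1) (br b z1) + ip (br h z2) (br b z2).
    by rewrite hz1 hz2 bz1 bz2; exact: ip_rotation.
  have S0 : 0 <= S by rewrite addr_ge0 // ip_ge0.
  have prod_ge0 : 0 <= (mu h * mu b + nu h * nu b) * S.
    by rewrite sum addr_ge0 //; exact: pos.
  have mn : 0 < mu h ^+ 2 + nu h ^+ 2.
    by rewrite lt_neqAle addr_ge0 ?sqr_ge0 // andbT eq_sym paddr_eq0 ?sqr_ge0 // !sqrf_eq0 negb_and; apply/orP.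
  (* As the root vanishes at parameter [t], [t] times its value at [b] is [-(1 - t)] times its value
     at [h]. The sign now contradicts [prod_ge0] unless [S = 0]. *)
  have : t * ((mu h * mu b + nu h * nu b) * S) = - ((1 - t) * (mu h ^+ 2 + nu h ^+ 2) * S).
    have -> : t * ((mu h * mu b + nu h * nu b) * S) = (mu h * (t * mu b) + nu h * (t * nu b)) * S by ring.
    have -> : t * mu b = - ((1 - t) * mu h) by apply/eqP; rewrite -addr_eq0 addrC -/M M0.
    have -> : t * nu b = - ((1 - t) * nu h) by apply/eqP; rewrite -addr_eq0 addrC -/N N0.
    ring.
  move=> eqS; have S_le0 : S <= 0.
    have : 0 <= - ((1 - t) * (mu h ^+ 2 + nu h ^+ 2) * S) by rewrite -eqS mulr_ge0.
    by rewrite oppr_ge0 pmulr_rle0 // mulr_gt0 // subr_gt0.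
  have yy1 : ip y1 y1 = 0.
    apply/eqP; rewrite eq_le ip_ge0 // andbT.
    by have := ip_ge0 ip_pos y2; rewrite /S in S_le0; lra.
  have yy2 : ip y2 y2 = 0.
    apply/eqP; rewrite eq_le ip_ge0 // andbT.
    by have := ip_ge0 ip_pos y1; rewrite /S in S_le0; lra.
  have y10 := ip_eq0 ip_pos yy1; have y20 := ip_eq0 ip_pos yy2.
  (* The [p] part is zero; as the root is nonzero at [h], so is the [k] part. *)
  rewrite y10 linear0r in hy1; rewrite y20 linear0r in hy2.
  have [z10 z20] := rotation_eq0 (esym hy1) (esym hy2) hmn.
  have x0 : 2%:R *: x = 0.
    rewrite -[RHS](_ : z1 + y1 = 0); last by rewrite z10 y10 addr0.
    by rewrite /z1 /y1; apply/rowP => i; rewrite !mxE; ring.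
  have y0 : 2%:R *: y = 0.
    rewrite -[RHS](_ : z2 + y2 = 0); last by rewrite z20 y20 addr0.
    by rewrite /z2 /y2; apply/rowP => i; rewrite !mxE; ring.
  move: x0 y0 xy0 => /eqP + /eqP; rewrite !scaler_eq0 pnatr_eq0 /= => -> ->.
  by case.
pose f t : E := h + t *: (b - h).
have fb : f t @[t --> (1 : R)^'-] --> b.
  have -> : b = f 1 by rewrite /f scale1r addrC subrK.
  apply: cvg_at_left_filter; apply: cvgD; first exact: cvg_cst.
  exact: scalel_continuous.
move=> V /fb Vt.
near (1 : R)^'- => t.
exists (f t); split; last by near: t.
apply: segment_component => [|r /andP[r0 rt]].
  by near: t; exact: nbhs_left_ge.
apply: regt; rewrite r0 (le_lt_trans rt) //.
Unshelve. all: by end_near. Qed.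

End MaximalAbelian.
End SymmetricLieAlgebra.

(** * Derivatives and functional equations *)

HB.instance Definition _ (R : realType) (m n : nat) := Complete.on 'M[R]_(m, n).

Section Differential.
Context (R : realType) (V W : normedModType R).

Lemma differentiable_eps (f : V -> W) (x : V) : differentiable f x ->
  forall e : R, 0 < e -> \forall y \near x, `|f y - f x - 'd f x (y - x)| <= e * `|y - x|.
Proof.
move=> df e e0; have /diff_locallyP[_ /eqaddoP/(_ e e0)] := df.
rewrite near_simpl => h.
have : \forall y \near x, `|(f \o shift x - (cst (f x) + 'd f x)) (y - x)| <= e * `|(y - x : V)|.
  by move: h; rewrite (near_shift x 0) sub0r; apply: filterS => y; rewrite /= addrC.
by apply: filterS => y /=; rewrite !fctE /= subrK opprD addrA.
Qed.

Lemma differentiable_near_lipschitz (f : V -> W) (x : V) : differentiable f x ->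
  exists2 C : R, 0 < C & \forall y \near x, `|f y - f x| <= C * `|y - x|.
Proof.
move=> df; have [k k0 kP] := linear_lipschitz (diff_continuous df).
exists (k + 1); first by rewrite addr_gt0.
apply: filterS (differentiable_eps df ltr01) => y; rewrite mul1r => h.
rewrite -[f y - f x](subrK ('d f x (y - x))) (le_trans (ler_normD _ _)) // mulrDl mul1r.
by rewrite addrC lerD.
Qed.

Lemma differentiable_of_eps (f : V -> W) (x : V) (L : {linear V -> W}) : continuous L ->
  (forall e : R, 0 < e -> \forall y \near x, `|f y - f x - L (y - x)| <= e * `|y - x|) ->
  differentiable f x /\ 'd f x = L :> (V -> W).
Proof.
move=> cL h.
have eqf : f \o shift x = cst (f x) + L +o_ (0 : V) id.
  apply/eqaddoP => e e0; rewrite near_simpl.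
  move: (h e e0); rewrite (near_shift 0 x) subr0; apply: filterS => y.
  by rewrite /= !fctE /= addrK opprD addrA.
have dE := diff_unique cL eqf; split=> //.
by apply/diff_locallyP; rewrite dE.
Qed.

Lemma near_eq_differentiable (f g : V -> W) (x : V) :
  (\forall y \near x, f y = g y) -> differentiable f x ->
  differentiable g x /\ 'd g x = 'd f x :> (V -> W).
Proof.
move=> fg df; apply: differentiable_of_eps => [|e e0]; first exact: diff_continuous.
have fgx := nbhs_singleton fg.
near=> y; have <- : f y = g y by near: y.
by rewrite -fgx; near: y; exact: differentiable_eps.
Unshelve. all: by end_near. Qed.

End Differential.

(** Identities read in charts hold only near the base point, so the chain rule is stated for a
    function [h] that agrees with the composite there. *)
Lemma diff_near_comp (R : realType) (U V W : normedModType R) (f : V -> W) (g : U -> V)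
    (h : U -> W) (x : U) (z : V) :
  g x = z -> (\forall y \near x, f (g y) = h y) -> differentiable g x ->
  differentiable f z -> differentiable h x /\ forall y, 'd h x y = 'd f z ('d g x y).
Proof.
move=> <- fgh dg df.
have [dh hE] := near_eq_differentiable fgh (differentiable_comp dg df).
by split=> // y; rewrite hE diff_comp.
Qed.

Lemma diff_chain (R : realType) (U V W : normedModType R) (f : V -> W) (g : U -> V)
    (x : U) (z : V) :
  g x = z -> differentiable g x -> differentiable f z ->
  differentiable (f \o g) x /\ forall y, 'd (f \o g) x y = 'd f z ('d g x y).
Proof.
move=> <- dg df; split=> [|y]; first exact: differentiable_comp.
by rewrite diff_comp.
Qed.

Lemma diff_pairl (R : realType) (V W : normedModType R) (u : W) (x v : V) :
  differentiable (fun y => (y, u)) x /\ 'd (fun y => (y, u)) x v = (v, 0).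
Proof.
have h := is_diff_pair (is_diff_id x) (is_diff_cst u x).
by split; [exact: ex_diff|rewrite diff_val].
Qed.

Lemma diff_pairr (R : realType) (V W : normedModType R) (u : W) (x v : V) :
  differentiable (fun y => (u, y)) x /\ 'd (fun y => (u, y)) x v = (0, v).
Proof.
have h := is_diff_pair (is_diff_cst u x) (is_diff_id x).
by split; [exact: ex_diff|rewrite diff_val].
Qed.

Lemma diff_graph (R : realType) (V W : normedModType R) (g : V -> W) (x v : V) :
  differentiable g x ->
  differentiable (fun y => (y, g y)) x /\ 'd (fun y => (y, g y)) x v = (v, 'd g x v).
Proof.
move=> /differentiableP dg; have h := is_diff_pair (is_diff_id x) dg.
by split; [exact: ex_diff|rewrite diff_val].
Qed.

Lemma diff_line (R : realType) (V : normedModType R) (y d : V) (t : R) :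
  differentiable (fun t : R => y + t *: d) t /\ 'd (fun t : R => y + t *: d) t 1 = d.
Proof.
have h := is_diffD (is_diff_cst y t) (is_diff_scalel t d).
by split; [exact: ex_diff|rewrite diff_val /= add0r scale1r].
Qed.

Lemma is_derive_of_eps (R : realType) (V : normedModType R) (f : R -> V) (x : R) (v : V) :
  (forall ep : R, 0 < ep ->
    \forall y \near x, `|f y - f x - (y - x) *: v| <= ep * `|y - x|) ->
  is_derive x (1 : R) f v.
Proof.
move=> h; have lin : linear (fun t : R => t *: v) by move=> a s t; rewrite scalerDl scalerA.
pose L : {linear R -> V} := HB.pack (fun t : R => t *: v)
  (GRing.isLinear.Build R R V _ (fun t : R => t *: v) lin).
have [|df dfE] := @differentiable_of_eps _ _ _ f x L _ h; first exact: scalel_continuous.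
apply: DeriveDef; first exact: diff_derivable.
by rewrite deriveE // dfE /= scale1r.
Qed.

Lemma is_derive_eps (R : realType) (V : normedModType R) (f : R -> V) (x : R) (v : V) :
  is_derive x (1 : R) f v -> forall ep : R, 0 < ep ->
  \forall y \near x, `|f y - f x - (y - x) *: v| <= ep * `|y - x|.
Proof.
move=> [df dv] ep ep0; have dfx : differentiable f x by apply/derivable1_diffP.
apply: filterS (differentiable_eps dfx ep0) => y.
have -> : 'd f x (y - x) = (y - x) *: v.
  by rewrite -dv deriveE // -linearZ /= [_ *: 1]mulr1.
by [].
Qed.

Lemma is_derive_coord (R : realType) (n : nat) (f : R -> 'rV[R]_n) (t : R) (i : 'I_n) :
  differentiable f t -> is_derive t (1 : R) (fun t => f t 0 i : R) ('d f t 1 0 i).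
Proof.
move=> df; have dc := @differentiable_coord R 1 n (f t) 0 i.
have [dg dgE] := diff_chain (erefl (f t)) df dc.
apply: DeriveDef; first exact: diff_derivable.
rewrite deriveE // dgE.
have gl : linear (fun N : 'rV[R]_n => N 0 i : R^o) by move=> a u v; rewrite !mxE.
pose g : {linear 'rV[R]_n -> R^o} := HB.pack (fun N : 'rV[R]_n => N 0 i : R^o)
  (GRing.isLinear.Build R 'rV[R]_n R^o _ (fun N : 'rV[R]_n => N 0 i : R^o) gl).
rewrite -[fun N : 'rV[R]_n => N 0 i]/(g : _ -> _) diff_lin //.
exact: coord_continuous.
Qed.

Lemma diff_diag (R : realType) (V : normedModType R) (x v : V) :
  differentiable (fun y => (y, y)) x /\ 'd (fun y => (y, y)) x v = (v, v).
Proof.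
have h := is_diff_pair (is_diff_id x) (is_diff_id x).
by split; [exact: ex_diff|rewrite diff_val].
Qed.

Lemma norm_pair (R : realType) (V W : normedModType R) (x : V) (y : W) :
  `|(x, y)| = Num.max `|x| `|y|.
Proof. by []. Qed.

Lemma pair_split (V W : zmodType) (v : V) (w : W) : (v, w) = (v, 0) + (0, w).
Proof. by rewrite -[RHS]/(v + 0, 0 + w) addr0 add0r. Qed.

(** * The halving equation [u t = sq (u (t / 2))] *)

Section Squaring.
Context (R : realType) (E : completeNormedModType R).
Context (sq : E -> E) (r C : R) (r0 : 0 < r) (C0 : 0 < C).
Context (sq0 : sq 0 = 0).
Context (sq_lip : forall x y, `|x| <= r -> `|y| <= r ->
  `|sq x - sq y - 2 *: (x - y)| <= C * Num.max `|x| `|y| * `|x - y|).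

Let sq_quad x : `|x| <= r -> `|sq x - 2 *: x| <= C * `|x| ^+ 2.
Proof.
move=> xr; have := @sq_lip x 0 xr; rewrite normr0 sq0 !subr0 => /(_ (ltW r0)).
by rewrite max_l // -mulrA -expr2.
Qed.

Let sq_lip2 x y M : `|x| <= M -> `|y| <= M -> M <= r ->
  `|sq x - sq y| <= (2 + C * M) * `|x - y|.
Proof.
move=> xM yM Mr; have h := sq_lip (le_trans xM Mr) (le_trans yM Mr).
rewrite -[sq x - sq y](subrK (2 *: (x - y))) (le_trans (ler_normD _ _)) //.
rewrite normrZ normr_nat [leRHS]mulrDl [leRHS]addrC lerD2r (le_trans h) // ler_wpM2r //.
by rewrite ler_pM2l // ge_max xM.
Qed.

(* For [u (2 t) = sq (u t)] and [v] alike, [rho t := |u t - v t|] satisfies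
   [rho t <= 2 (1 + D t) rho (t / 2)], hence
   [rho t <= 2 ^ j (1 + 4 D t) rho (t / 2 ^ j)], and the right-hand side tends
   to 0 when [rho t = o(t)]. *)
Lemma halving_unique (D d : R) (rho : R -> R) : 0 < D -> 0 < d -> 2 * D * d <= 1 ->
  (forall t, 0 <= t <= d -> 0 <= rho t <= 2 * (1 + D * t) * rho (t / 2)) ->
  (forall e, 0 < e -> exists2 d', 0 < d' & forall t, 0 <= t <= d' -> rho t <= e * t) ->
  forall t, 0 <= t <= d -> rho t = 0.
Proof.
move=> D0 d0 Dd rhoP rho_o; have Dt_ge0 u : 0 <= u -> 0 <= D * u by exact: mulr_ge0 (ltW D0).
have iter (j : nat) t : 0 <= t <= d -> rho t <= 2 ^+ j * (1 + 4 * D * t) * rho (t / 2 ^+ j).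
  elim: j t => [|j IH] t /andP[t0 td].
    have /andP[rt _] := rhoP t ltac:(by rewrite t0).
    by rewrite expr0 mul1r divr1 ler_peMl //; have := Dt_ge0 t t0; lra.
  have /andP[rt le1] := rhoP t ltac:(by rewrite t0).
  have t2 : 0 <= t / 2 <= d by rewrite divr_ge0 //= (le_trans _ td) // ler_pdivrMr //; lra.
  have := IH _ t2; rewrite -[t / 2 / _]mulrA -invfM -exprS => IHt.
  have tj : 0 <= t / 2 ^+ j.+1 <= d.
    rewrite divr_ge0 ?exprn_ge0 //= (le_trans _ td) // ler_pdivrMr ?exprn_gt0 //.
    by rewrite ler_peMr // exprn_ege1 //; lra.
  have /andP[rj _] := rhoP _ tj.
  apply: (le_trans le1).
  have Dt0 := Dt_ge0 t t0; have h1 : 0 <= 2 * (1 + D * t) by lra.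
  apply: (le_trans (ler_wpM2l h1 IHt)).
  (* The induction closes because [(1 + x) * (1 + 2 * x) <= 1 + 4 * x] as soon as [2 * x <= 1]. *)
  have Dt : 2 * (D * t) <= 1 by rewrite mulrA (le_trans _ Dd) // ler_pM2l // mulr_gt0.
  have -> : 2 * (1 + D * t) * (2 ^+ j * (1 + 4 * D * (t / 2)) * rho (t / 2 ^+ j.+1)) =
    2 ^+ j.+1 * ((1 + D * t) * (1 + 2 * (D * t))) * rho (t / 2 ^+ j.+1).
    by rewrite exprS; field.
  rewrite ler_wpM2r // ler_wpM2l ?exprn_ge0 //.
  by nra.
move=> t /andP[t0 td]; have /andP[rt _] := rhoP t ltac:(by rewrite t0).
apply/eqP; rewrite eq_le rt andbT; apply/ler_addgt0Pr => e e0; rewrite add0r.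
have D4 : 0 <= 1 + 4 * D * t by have := Dt_ge0 t t0; lra.
have K0 : 0 < (1 + 4 * D * t) * t + 1 by rewrite ltr_wpDl // mulr_ge0.
have [d' d'0 small] := rho_o (e / ((1 + 4 * D * t) * t + 1)) (divr_gt0 e0 K0).
have [j tj] : exists j : nat, t / 2 ^+ j <= d'.
  have [j jP] : exists j : nat, t / d' < j%:R.
    by exists (Num.bound (t / d')); apply: archi_boundP; rewrite divr_ge0 // ltW.
  exists j; rewrite ler_pdivrMr ?exprn_gt0 // mulrC -ler_pdivrMr //.
  rewrite (le_trans (ltW jP)) // -natrX ler_nat; exact: ltnW (ltn_expl _ _).
apply: (le_trans (iter j t _)); first by rewrite t0.
have tj0 : 0 <= t / 2 ^+ j by rewrite divr_ge0 ?exprn_ge0.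
apply: (@le_trans _ _ (2 ^+ j * (1 + 4 * D * t) * (e / ((1 + 4 * D * t) * t + 1) * (t / 2 ^+ j)))).
  by rewrite ler_wpM2l ?mulr_ge0 ?exprn_ge0 // small // tj0.
have -> : 2 ^+ j * (1 + 4 * D * t) * (e / ((1 + 4 * D * t) * t + 1) * (t / 2 ^+ j)) =
   e * (((1 + 4 * D * t) * t) / ((1 + 4 * D * t) * t + 1)).
  by field; rewrite (gt_eqF K0) expf_neq0.
rewrite ler_piMr //; first exact: ltW.
by rewrite ler_pdivrMr // mul1r lerDl.
Qed.

(** On vectors of norm at most [K * t / 2] the map [sq] is Lipschitz with constant at most
    [2 * (1 + C * K * t)], so [halving_unique] applies to [|v t - w t|] with [D = C * K]. *)
Lemma doubling_unique (v w : R -> E) (d K : R) : 0 < d -> 0 < K ->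
  (forall t, 0 <= t <= d -> [/\ `|v t| <= r, `|v t| <= K * t & v t = sq (v (t / 2))]) ->
  (forall t, 0 <= t <= d -> [/\ `|w t| <= r, `|w t| <= K * t & w t = sq (w (t / 2))]) ->
  (forall e, 0 < e -> exists2 d', 0 < d' & forall t, 0 <= t <= d' -> `|v t - w t| <= e * t) ->
  exists2 d', 0 < d' & forall t, 0 <= t <= d' -> v t = w t.
Proof.
move=> d0 K0 vP wP vw; pose d1 := Num.min d (2 * (C * K))^-1.
have CK : 0 < C * K by rewrite mulr_gt0.
have d10 : 0 < d1 by rewrite lt_min d0 invr_gt0 mulr_gt0.
exists d1 => // t tt; apply/eqP; rewrite -subr_eq0 -normr_eq0; apply/eqP.
apply: (@halving_unique (C * K) d1 (fun t => `|v t - w t|)) tt => //.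
  have : 2 * (C * K) * d1 <= 2 * (C * K) * (2 * (C * K))^-1.
    by rewrite ler_pM2l ?mulr_gt0 // ge_min lexx orbT.
  by rewrite divff // mulf_neq0 ?pnatr_eq0 // gt_eqF.
move=> {}t /andP[t0 td]; rewrite normr_ge0 /=.
have tt : 0 <= t <= d by rewrite t0 (le_trans td) // ge_min lexx.
have t2 : 0 <= t / 2 <= d by have /andP[] := tt; move=> *; apply/andP; split; lra.
have [_ _ ->] := vP t tt; have [_ _ ->] := wP t tt.
have [v1 v2 _] := vP _ t2; have [w1 w2 _] := wP _ t2.
have := sq_lip v1 w1; set x := v (t / 2); set y := w (t / 2) => h.
have M : Num.max `|x| `|y| <= K * (t / 2) by rewrite ge_max v2.
have h1 : C * Num.max `|x| `|y| * `|x - y| <= C * (K * (t / 2)) * `|x - y|.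
  by rewrite ler_wpM2r // ler_pM2l.
have h2 : `|sq x - sq y| <= `|sq x - sq y - 2 *: (x - y)| + `|2 *: (x - y)|.
  by rewrite -{1}(subrK (2 *: (x - y)) (sq x - sq y)) ler_normD.
rewrite normrZ normr_nat in h2.
have : 0 <= C * K * t * `|x - y| by rewrite mulr_ge0 // mulr_ge0 // ltW.
lra.
Qed.

Section Orbit.
Context (z : E).

(** The [j]-fold image under [sq] of [(t / 2 ^ j) *: z], in analogy with the exponential as the
    limit of [(1 + t z / N) ^ N] for [N = 2 ^ j]. *)
Fixpoint halving_iter (j : nat) (t : R) : E :=
  if j is j'.+1 then sq (halving_iter j' (t / 2)) else t *: z.

Let K := C * (`|z| + 1) ^+ 2 + 1.

(** On the ball in question [sq] is 3-Lipschitz, whereas halving [t] divides a bound in [t ^ 2] by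
    4: successive iterates differ by at most [K * t ^ 2 * (3 / 4) ^ j] and converge. *)
Lemma halving_solution_exists : exists d K : R, [/\ 0 < d, 0 < K &
  exists u : R -> E, forall t, 0 <= t <= d ->
    [/\ `|u t| <= r, `|u t - t *: z| <= K * t ^+ 2 & u t = sq (u (t / 2))]].
Proof.
have K1 : 1 <= K by rewrite lerDr mulr_ge0 ?sqr_ge0 // ltW.
have [d [d0 dK dr dC]] : exists d, [/\ 0 < d, K * d <= 1, d * (`|z| + 1) <= r &
    C * (d * (`|z| + 1)) <= 1].
  have z0 : 0 < `|z| + 1 by rewrite ltr_wpDl.
  have K0 : 0 < K by apply: lt_le_trans K1.
  exists (Num.min K^-1 (Num.min (r / (`|z| + 1)) (C^-1 / (`|z| + 1)))).
  have p3 : 0 < C^-1 / (`|z| + 1) by rewrite divr_gt0 // invr_gt0.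
  have p2 : 0 < r / (`|z| + 1) by rewrite divr_gt0.
  have p1 : 0 < K^-1 by rewrite invr_gt0.
  split.
  - by rewrite !lt_min p1 p2 p3.
  - by rewrite -ler_pdivlMl // mulr1 ge_min lexx.
  - by rewrite -ler_pdivlMr // !ge_min lexx orbT.
  - by rewrite -ler_pdivlMl // mulr1 -ler_pdivlMr // !ge_min lexx !orbT.
(* The constant [K] reproduces itself: the error at [t] is at most [K * (t / 2) ^ 2] from [sq_quad]
   plus [2 * K * (t / 2) ^ 2] by induction, which is below [K * t ^ 2]. *)
have est j t : 0 <= t <= d ->
    `|halving_iter j t - t *: z| <= K * t ^+ 2 /\ `|halving_iter j t| <= t * (`|z| + 1).
  have second (x : E) u : 0 <= u <= d -> `|x - u *: z| <= K * u ^+ 2 -> `|x| <= u * (`|z| + 1).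
    move=> /andP[u0 ud] h; rewrite -[x](subrK (u *: z)) (le_trans (ler_normD _ _)) //.
    rewrite normrZ ger0_norm // mulrDr mulr1 addrC lerD2l (le_trans h) //.
    rewrite expr2 mulrA ler_piMl // (le_trans _ dK) // ler_wpM2l //.
    by apply: le_trans K1.
  elim: j t => [|j IH] t tt; have /andP[t0 td] := tt.
    have h : `|halving_iter 0 t - t *: z| <= K * t ^+ 2.
      by rewrite /= subrr normr0 mulr_ge0 ?sqr_ge0 //; apply: le_trans K1.
    by split=> //; exact: second h.
  suff h : `|halving_iter j.+1 t - t *: z| <= K * t ^+ 2 by split=> //; exact: second h.
  have t2 : 0 <= t / 2 <= d by apply/andP; split; lra.
  have [h1 h2] := IH _ t2; rewrite /=; set x := halving_iter j (t / 2) in h1 h2 *.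
  have xr : `|x| <= r.
    by rewrite (le_trans h2) // (le_trans _ dr) // ler_wpM2r ?addr_ge0 //; lra.
  have q := sq_quad xr.
  have -> : sq x - t *: z = (sq x - 2 *: x) + 2 *: (x - (t / 2) *: z).
    by rewrite scalerBr scalerA mulrCA divff ?pnatr_eq0 // mulr1 addrA subrK.
  rewrite (le_trans (ler_normD _ _)) // normrZ normr_nat.
  have x2 : C * `|x| ^+ 2 <= K * (t / 2) ^+ 2.
    have : `|x| ^+ 2 <= (t / 2 * (`|z| + 1)) ^+ 2.
      by rewrite lerXn2r ?nnegrE // mulr_ge0 ?addr_ge0 //; lra.
    rewrite -(ler_pM2l C0) => /le_trans; apply.
    by rewrite exprMn mulrCA mulrC ler_wpM2r ?sqr_ge0 // lerDl.
  by have := K1; have := sqr_ge0 t; nra.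
have step j t : 0 <= t <= d ->
    `|halving_iter j.+1 t - halving_iter j t| <= K * t ^+ 2 * (3 / 4) ^+ j.
  elim: j t => [|j IH] t tt; have /andP[t0 td] := tt.
    by rewrite expr0 mulr1; have [] := est 1%N t tt.
  have t2 : 0 <= t / 2 <= d by apply/andP; split; lra.
  have M1 : t / 2 * (`|z| + 1) <= d * (`|z| + 1) by rewrite ler_wpM2r ?addr_ge0 //; lra.
  have [_ h1] := est j.+1 _ t2; have [_ h2] := est j _ t2.
  have := sq_lip2 (le_trans h1 M1) (le_trans h2 M1) dr.
  move/le_trans; apply; apply: (@le_trans _ _ (3 * (K * (t / 2) ^+ 2 * (3 / 4) ^+ j))).
    by rewrite ler_pM // ?IH //; [rewrite addr_ge0 // ?mulr_ge0 ?addr_ge0 // ltW|lra].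
  by rewrite [_ ^+ j.+1]exprS; move: ((3 / 4) ^+ j) => q; lra.
have cv t : 0 <= t <= d -> cvgn (halving_iter ^~ t).
  move=> tt; pose v := telescope (halving_iter ^~ t).
  have : cvgn (series v).
    apply: normed_cvg.
    apply: (@series_le_cvg _ _ (geometric (K * t ^+ 2) (3 / 4))).
    - by move=> j /=.
    - move=> j; have q0 : 0 <= 3 / 4 :> R by lra.
      by rewrite /= mulr_ge0 ?exprn_ge0 // mulr_ge0 ?sqr_ge0 // (le_trans _ K1).
    - by move=> j; exact: step.
    - by apply: is_cvg_geometric_series; rewrite ger0_norm; lra.
  rewrite telescopeK => /(is_cvgD (is_cvg_cst (halving_iter 0 t))).
  by congr (cvgn _); apply/funext => j; rewrite !fctE /= addrC subrK.
pose u t := limn (halving_iter ^~ t).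
exists d, K; split=> //; first exact: lt_le_trans K1.
exists u => t tt; have /andP[t0 td] := tt.
have cvt : halving_iter j t @[j --> \oo] --> u t := cv t tt.
have bnd (s : R) : 0 <= s <= d -> `|u s - s *: z| <= K * s ^+ 2 /\ `|u s| <= s * (`|z| + 1).
  move=> ss; have cvs : halving_iter j s @[j --> \oo] --> u s := cv s ss.
  split.
    have : `|halving_iter j s - s *: z| @[j --> \oo] --> `|u s - s *: z|.
      by apply: cvg_norm; apply: cvgB => //; exact: cvg_cst.
    by move/cvgr_to_le; apply; near=> j; have [] := est j s ss.
  have : `|halving_iter j s| @[j --> \oo] --> `|u s| by apply: cvg_norm.
  by move/cvgr_to_le; apply; near=> j; have [] := est j s ss.
have ball (s x : R) : 0 <= s <= d -> x <= s * (`|z| + 1) -> x <= r.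
  by move=> /andP[_ sd] /le_trans; apply; rewrite (le_trans _ dr) // ler_wpM2r ?addr_ge0.
have [b1 b2] := bnd t tt; split=> //; first exact: ball b2.
have t2 : 0 <= t / 2 <= d by apply/andP; split; lra.
have [c1 c2] := bnd _ t2.
have cvt2 : halving_iter j (t / 2) @[j --> \oo] --> u (t / 2) := cv _ t2.
have cvt' : sq (halving_iter j (t / 2)) @[j --> \oo] --> u t.
  by move: cvt; rewrite -(cvg_shiftS (halving_iter ^~ t)).
apply: (cvg_unique (@norm_hausdorff _ E) cvt').
apply/cvgrPdist_le => e e0.
have q0 : 0 < 2 + C * r by rewrite addr_gt0 // mulr_gt0.
near=> j.
have [_ h2] := est j _ t2.
rewrite (le_trans (sq_lip2 (ball _ _ t2 c2) (ball _ _ t2 h2) (lexx r))) //.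
rewrite -ler_pdivlMl //.
by near: j; apply: cvgr_dist_le => //; rewrite mulr_gt0 ?invr_gt0.
Unshelve. all: by end_near. Qed.

End Orbit.

End Squaring.

Section Projection.
Context (R : realType) (n : nat).
Notation E := 'rV[R]_n.
Context (ip : {biscalar E}).
Context (ip_sym : forall x y, ip x y = ip y x).
Context (ip_pos : forall x, x != 0 -> 0 < ip x x).

(** As [orth_proj] is defined by choice, existence has to be shown: [gram] is injective on [a], and
    its target has the dimension of [a]. *)
Lemma orth_projP (a : {vspace E}) (x : E) :
  orth_proj ip a x \in a /\ forall z, z \in a -> ip (x - orth_proj ip a x) z = 0.
Proof.
suff [y ya yx] : exists2 y, y \in a & gram ip a y = gram ip a x.
  have h : exists y, [set y | y \in a /\ forall z, z \in a -> ip (x - y) z = 0] y.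
    exists y; split=> //; apply: gram_eq0.
    by rewrite linearB /= yx subrr.
  exact: (xgetPex 0 h).
pose f := linfun (gram ip a).
have kf : (a :&: lker f = 0)%VS.
  apply/eqP; rewrite -subv0; apply/subvP => y; rewrite memv_cap memv_ker lfunE /= => /andP[ya /eqP gy].
  by rewrite memv0 (gram_inj_on ip_pos ya gy).
have fE : (f @: a)%VS = fullv.
  apply/eqP; rewrite eqEdim subvf (limg_dim_eq kf) dimvf.
  by apply: eq_leq; exact: (mul1n (\dim a)).
have : gram ip a x \in (f @: a)%VS by rewrite fE memvf.
by move=> /memv_imgP[y ya yE]; exists y => //; rewrite yE lfunE.
Qed.

(** Transfers contractions for [ip] to the sup norm of [E], in which absolute continuity and
    derivatives are expressed. The constant [k / c + 1] dominates the square root of [k / c]. *)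
Lemma ip_le_norm_le : exists2 L : R, 0 < L &
  forall x y, ip x x <= ip y y -> `|x| <= L * `|y|.
Proof.
have [c c0 cP] := ip_coercive ip_pos; have [k k0 kP] := ip_bound ip.
have kc0 : 0 < k / c by rewrite divr_gt0.
have L0 : 0 < k / c + 1 by rewrite addr_gt0.
exists (k / c + 1) => // x y xy.
rewrite -(@ler_pXn2r _ 2) ?nnegrE ?mulr_ge0 ?(ltW L0) // -(ler_pM2l c0).
apply: (le_trans (cP x)); apply: (le_trans xy); apply: (le_trans (ler_norm _)).
apply: (le_trans (kP y y)).
have -> : k * `|y| * `|y| = c * (k / c * `|y| ^+ 2) by field; rewrite gt_eqF.
rewrite exprMn ler_pM2l // ler_wpM2r ?sqr_ge0 //.
by move: (k / c) kc0 => u u0; have := sqr_ge0 u; rewrite sqrrD expr1n mulr1 => ?; lra.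
Qed.

(** A vector of [a] is recovered from its Gram coordinates by a bounded linear map, which carries
    the first-order estimates of the coordinates over to [f]. *)
Lemma is_derive_pairings (a : {vspace E}) (f : R -> E) (t : R) (y : E) :
  y \in a -> (\forall r \near t, f r \in a) ->
  (forall i : 'I_(\dim a), is_derive t (1 : R) (fun r => ip (vbasis a)`_i (f r) : R) (ip (vbasis a)`_i y)) ->
  is_derive t (1 : R) f y.
Proof.
move=> ya fa df.
have [g gE] := left_inverse_on (fun x xa => @gram_inj_on _ _ ip ip_pos a x xa).
have [k k0 kP] := linear_rV_bound (linearP g).
apply: is_derive_of_eps => ep ep0; have e1 : 0 < ep / k by rewrite divr_gt0.
have h2 : \forall r \near t, forall i : 'I_(\dim a),
    `|ip (vbasis a)`_i (f r) - ip (vbasis a)`_i (f t) - (r - t) *: (ip (vbasis a)`_i y : R^o)| <= ep / k * `|r - t|.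
  apply: (@filter_forall _ _ (fun (i : 'I_(\dim a)) r => `|ip (vbasis a)`_i (f r) - ip (vbasis a)`_i (f t) -
    (r - t) *: (ip (vbasis a)`_i y : R^o)| <= ep / k * `|r - t|) (nbhs t)) => i.
  exact: (is_derive_eps (df i) e1).
have ft := nbhs_singleton fa.
apply: filterS2 fa h2 => r fr hr; set x := f r - f t - (r - t) *: y.
have xa : x \in a by rewrite !memvB // memvZ.
rewrite -(gE x xa) (le_trans (kP _)) // mulrC -ler_pdivlMr // mulrAC.
apply: ler_norm_rV => [|i]; first by rewrite mulr_ge0 // ltW.
rewrite mxE ip_sym; apply: le_trans (hr i); rewrite /x linearB /= linearB /= linearZr_LR /=.
by [].
Qed.

End Projection.

(** * Charts and the adjoint action *)

Section LieGroupCharts.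
Context (R : realType) (n : nat).
Notation E := 'rV[R]_n.
Context (G : topGroupType) (A : set (chart G E)) (hG : lie_group A).
Context (c : chart G E) (Ac : A c) (c_dom1 : chart_dom c 1%g) (c1 : c 1%g = 0).

Local Notation e := (chart_inv c).

Lemma chart_inv0 : e 0 = 1%g.
Proof. by rewrite -c1 chart_mapK. Qed.

Lemma chart_im_near (d : chart G E) g : chart_dom d g -> \forall x \near d g, chart_im d x.
Proof.
by move=> dg; apply: open_nbhs_nbhs; split; [exact: chart_im_open|exists g].
Qed.

Lemma chart_inv_dom (d : chart G E) x : chart_im d x -> chart_dom d (chart_inv d x).
Proof. by move=> [g dg <-]; rewrite chart_mapK. Qed.

Lemma chart_invK (d : chart G E) x : chart_im d x -> d (chart_inv d x) = x.
Proof. by move=> [g dg <-]; rewrite chart_mapK. Qed.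

Lemma chart_dom_near (d : chart G E) g : chart_dom d g -> \forall h \near g, chart_dom d h.
Proof. by move=> dg; apply: open_nbhs_nbhs; split=> //; exact: chart_dom_open. Qed.

Lemma chart_inv_cvg (d : chart G E) g : chart_dom d g -> chart_inv d x @[x --> d g] --> g.
Proof.
move=> dg; rewrite -[X in _ --> X](chart_mapK dg).
by apply: chart_inv_continuous; exists g.
Qed.

Lemma chart_inv_cvg0 : e x @[x --> (0 : E)] --> (1%g : G).
Proof. by rewrite -c1; exact: chart_inv_cvg. Qed.

Lemma cvg_mulg (T : Type) (F : set_system T) {FF : Filter F} (f g : T -> G) (a b : G) :
  f x @[x --> F] --> a -> g x @[x --> F] --> b -> (f x * g x)%g @[x --> F] --> (a * b)%g.
Proof.
move=> fa gb; apply: (@cvg_comp _ _ _ (fun x => (f x, g x)) (fun p : G * G => (p.1 * p.2)%g) F (nbhs (a, b))).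
  exact: cvg_pair.
exact: (@mulg_continuous G (a, b)).
Qed.

Lemma cvg_invg (T : Type) (F : set_system T) {FF : Filter F} (f : T -> G) (a : G) :
  f x @[x --> F] --> a -> (f x)^-1%g @[x --> F] --> a^-1%g.
Proof. by move=> fa; apply: cvg_comp fa _; exact: (@invg_continuous G a). Qed.

Lemma chart_mul_differentiable (d1 d2 d3 : chart G E) g h : A d1 -> A d2 -> A d3 ->
  chart_dom d1 g -> chart_dom d2 h -> chart_dom d3 (g * h)%g ->
  differentiable (fun x : E * E => d3 (chart_inv d1 x.1 * chart_inv d2 x.2)%g) (d1 g, d2 h).
Proof.
move=> A1 A2 A3 g1 h2 gh3; case: hG => _ _ _ /(_ d1 d2 d3 A1 A2 A3 1%N)[+ _] _; apply.
by split; rewrite /= ?chart_mapK //; [exists g|exists h].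
Qed.

Lemma chart_cover g : exists2 d, A d & chart_dom d g.
Proof. by case: hG => _ _ [+ _] _ _; apply. Qed.

Definition conj_chart (g : G) (x : E) : E := c (g * e x * g^-1)%g.

Lemma conj_chart0 g : conj_chart g 0 = 0.
Proof. by rewrite /conj_chart chart_inv0 mulg1 mulgV. Qed.

Lemma conj_chart_dom g : \forall x \near (0 : E), chart_dom c (g * e x * g^-1)%g.
Proof.
have cv : (g * e x * g^-1)%g @[x --> (0 : E)] --> (1%g : G).
  rewrite -[X in _ --> X](mulgV g) -[X in (X * _)%g](mulg1 g).
  have cg : (g * e x)%g @[x --> (0 : E)] --> (g * 1)%g.
    by apply: (@cvg_mulg _ (nbhs (0 : E)) _ (fun=> g)); [exact: cvg_cst|exact: chart_inv_cvg0].
  by apply: (@cvg_mulg _ (nbhs (0 : E)) _ _ (fun=> g^-1%g) _ _ cg); exact: cvg_cst.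
exact: (cv _ (chart_dom_near c_dom1)).
Qed.

(** Smoothness of the product is available only in charts, and [g] may lie outside the domain of
    [c]. Conjugation is therefore factored through a chart [d] at [g]: left translation from [c] to
    [d], then right translation from [d] to [c]. *)
Lemma conj_chart_differentiable g : differentiable (conj_chart g) 0.
Proof.
have [d Ad gd] := chart_cover g.
have [d' Ad' gd'] := chart_cover g^-1%g.
have diffl : differentiable (fun x => d (g * e x)%g) 0.
  have := @chart_mul_differentiable d c d g 1%g Ad Ac Ad gd c_dom1.
  rewrite mulg1 c1 => /(_ gd) h.
  have -> : (fun x => d (g * e x)%g) =
    (fun x : E * E => d (chart_inv d x.1 * e x.2)%g) \o (fun x => (d g, x)).
    by apply/funext => x /=; rewrite chart_mapK.
  by apply: differentiable_comp => //; apply: differentiable_pair.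
have diffr : differentiable (fun y => c (chart_inv d y * g^-1)%g) (d g).
  have := @chart_mul_differentiable d d' c g g^-1%g Ad Ad' Ac gd gd'.
  rewrite mulgV => /(_ c_dom1) h.
  have -> : (fun y => c (chart_inv d y * g^-1)%g) =
    (fun x : E * E => c (chart_inv d x.1 * chart_inv d' x.2)%g) \o (fun y => (y, d' g^-1%g)).
    by apply/funext => x /=; rewrite chart_mapK.
  by apply: differentiable_comp => //; apply: differentiable_pair.
have dgE : d g = d (g * e 0)%g by rewrite chart_inv0 mulg1.
rewrite dgE in diffr.
have [|//] := @near_eq_differentiable _ _ _ _ (conj_chart g) 0 _ (differentiable_comp diffl diffr).
have cv : (g * e x)%g @[x --> (0 : E)] --> g.
  rewrite -[X in _ --> X](mulg1 g).
  by apply: (@cvg_mulg _ (nbhs (0 : E)) _ (fun=> g)); [exact: cvg_cst|exact: chart_inv_cvg0].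
have gd0 : \forall x \near (0 : E), chart_dom d (g * e x)%g := cv _ (chart_dom_near gd).
by apply: filterS gd0 => x dx; rewrite /= chart_mapK.
Qed.

Lemma AdE g y : Ad c g y = 'd (conj_chart g) 0 y.
Proof. by rewrite /Ad deriveE //; exact: conj_chart_differentiable. Qed.

Lemma Ad_linear g : linear (Ad c g).
Proof. by move=> a u v; rewrite !AdE linearP. Qed.

Lemma AdB g x y : Ad c g (x - y) = Ad c g x - Ad c g y.
Proof. by rewrite [x - y]addrC -scaleN1r Ad_linear scaleN1r [LHS]addrC. Qed.

Lemma Ad0 g : Ad c g 0 = 0.
Proof. by have := AdB g 0 0; rewrite !subrr. Qed.

Lemma AdZ g a x : Ad c g (a *: x) = a *: Ad c g x.
Proof. by have := Ad_linear g a x 0; rewrite Ad0 !addr0. Qed.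

Lemma AdD g x y : Ad c g (x + y) = Ad c g x + Ad c g y.
Proof. by have := Ad_linear g 1 x y; rewrite !scale1r. Qed.

Lemma Ad1 y : Ad c 1%g y = y.
Proof.
rewrite AdE; have [|_ ->] := @near_eq_differentiable _ _ _ id (conj_chart 1%g) 0 _ (@ex_diff _ _ _ _ _ _ _ (is_diff_id (0 : E))).
  have := chart_im_near c_dom1; rewrite c1; apply: filterS => x xc.
  by rewrite /conj_chart invg1 mulg1 mul1g chart_invK.
by rewrite diff_val.
Qed.

Lemma AdM g h y : Ad c (g * h)%g y = Ad c g (Ad c h y).
Proof.
rewrite !AdE.
have dg := conj_chart_differentiable g; have dh := conj_chart_differentiable h.
have nE : \forall x \near (0 : E), conj_chart g (conj_chart h x) = conj_chart (g * h)%g x.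
  apply: filterS (conj_chart_dom h) => x dx.
  by rewrite /conj_chart chart_mapK // invgM !mulgA.
by have [_] := diff_near_comp (conj_chart0 h) nE dh dg; apply.
Qed.

Lemma Ad_invK g : cancel (Ad c g) (Ad c g^-1%g).
Proof. by move=> y; rewrite -AdM mulVg Ad1. Qed.

Lemma AdK_inv g : cancel (Ad c g^-1%g) (Ad c g).
Proof. by move=> y; rewrite -AdM mulgV Ad1. Qed.

End LieGroupCharts.

(** * Product, squaring and inversion in a chart at the neutral element *)

Section LocalEstimates.
Context (R : realType) (n : nat).
Notation E := 'rV[R]_n.
Context (G : topGroupType) (A : set (chart G E)) (hG : lie_group A).
Context (c : chart G E) (Ac : A c) (c_dom1 : chart_dom c 1%g) (c1 : c 1%g = 0).

Local Notation e := (chart_inv c).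

Let e0 : e 0 = 1%g := chart_inv0 c_dom1 c1.

Let im_near0 : \forall x \near (0 : E), chart_im c x.
Proof. by have := chart_im_near c_dom1; rewrite c1. Qed.

Definition mul_chart (x : E * E) : E := c (e x.1 * e x.2)%g.
Notation m := mul_chart.

Let mul_dom (x : E * E) := [/\ chart_im c x.1, chart_im c x.2 & chart_dom c (e x.1 * e x.2)%g].

Lemma mul_chart_smooth x : mul_dom x ->
  differentiable m x /\ forall v, differentiable (fun x => 'D_v m x) x.
Proof.
move=> hx; case: hG => _ _ _ /(_ c c c Ac Ac Ac 2%N)[+ d2] _ => /(_ x hx) d1.
by split=> // v; have [+ _] := d2 v; apply.
Qed.

Lemma mul_chart_r0 x : chart_im c x -> m (x, 0) = x.
Proof. by move=> xc; rewrite /m /= e0 mulg1 chart_invK. Qed.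

Lemma mul_chart_0r x : chart_im c x -> m (0, x) = x.
Proof. by move=> xc; rewrite /m /= e0 mul1g chart_invK. Qed.

Let im0 : chart_im c 0. Proof. by exists 1%g. Qed.

Let mul_dom_r0 x : chart_im c x -> mul_dom (x, 0).
Proof. by move=> xc; split=> //=; rewrite e0 mulg1; exact: chart_inv_dom. Qed.

Let mul_dom_0r x : chart_im c x -> mul_dom (0, x).
Proof. by move=> xc; split=> //=; rewrite e0 mul1g; exact: chart_inv_dom. Qed.

Lemma mul_dom_ball : exists2 r : R, 0 < r & forall x y, `|x| <= r -> `|y| <= r -> mul_dom (x, y).
Proof.
have cv : (e x.1 * e x.2)%g @[x --> ((0, 0) : E * E)] --> (1 * 1 : G)%g.
  have h := chart_inv_cvg0 c_dom1 c1.
  apply: (@cvg_mulg _ _ (nbhs ((0, 0) : E * E)) _ (fun x => e x.1) (fun x => e x.2)).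
    by apply: cvg_comp h; exact: cvg_fst.
  by apply: cvg_comp h; exact: cvg_snd.
rewrite mulg1 in cv.
have [[/= V1 V2] [/= nV1 nV2] V12] : \forall x \near ((0, 0) : E * E), chart_dom c (e x.1 * e x.2)%g.
  exact: (cv _ (chart_dom_near c_dom1)).
have : \forall x \near (0 : E), [/\ V1 x, V2 x & chart_im c x].
  by near=> x; split; near: x.
move=> /nbhs_normP[r /= r0 rP]; exists (r / 2); first by rewrite divr_gt0.
move=> x y xr yr.
have bl z : `|z| <= r / 2 -> ball_ Num.norm (0 : E) r z.
  by move=> zr; rewrite /ball_ /= sub0r normrN (le_lt_trans zr) //; lra.
have [x1 _ x3] := rP x (bl x xr); have [_ y2 y3] := rP y (bl y yr).
by split=> //=; exact: (V12 (x, y)).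
Unshelve. all: by end_near. Qed.

(** The restriction of [m] to either axis is the identity, the chart being centred at the neutral
    element. *)
Lemma diff_mul_chart00 v w : 'd m (0, 0) (v, w) = v + w.
Proof.
have [d00 _] := mul_chart_smooth (mul_dom_r0 im0).
rewrite (pair_split v w) linearD; congr (_ + _).
  have [dp _] := diff_pairl (0 : E) (0 : E) v.
  have nE : \forall x \near (0 : E), m (x, 0) = x.
    by apply: filterS im_near0 => x; exact: mul_chart_r0.
  have [_ /(_ v)] := diff_near_comp (erefl ((0 : E), (0 : E))) nE dp d00.
  by rewrite (diff_pairl (0 : E) (0 : E) v).2 => <-; rewrite diff_val.
have [dp _] := diff_pairr (0 : E) (0 : E) w.
have nE : \forall x \near (0 : E), m (0, x) = x.
  by apply: filterS im_near0 => x; exact: mul_chart_0r.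
have [_ /(_ w)] := diff_near_comp (erefl ((0 : E), (0 : E))) nE dp d00.
by rewrite (diff_pairr (0 : E) (0 : E) w).2 => <-; rewrite diff_val.
Qed.

Lemma mul_chart_near_add ep : 0 < ep -> exists2 q : R, 0 < q &
  forall x y, `|x| <= q -> `|y| <= q -> `|m (x, y) - (x + y)| <= ep * (`|x| + `|y|).
Proof.
move=> ep0; have [d00 _] := mul_chart_smooth (mul_dom_r0 im0).
have m00 : m (0, 0) = 0 by rewrite mul_chart_r0.
have /nbhs_normP[q /= q0 qP] := differentiable_eps d00 ep0.
exists (q / 2) => [|x y xq yq]; first by rewrite divr_gt0.
have nxy : `|((x, y) : E * E)| <= `|x| + `|y|.
  by rewrite norm_pair ge_max lerDl lerDr !normr_ge0.
have -> : m (x, y) - (x + y) = m (x, y) - m (0, 0) - 'd m (0, 0) ((x, y) - (0, 0)).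
  rewrite m00 subr0; congr (_ - _).
  have -> : (x, y) - (0, 0) = (x, y) by rewrite -[LHS]/(x - 0, y - 0) !subr0.
  exact: esym (diff_mul_chart00 x y).
have h : `|((x, y) : E * E) - (0, 0)| <= `|x| + `|y|.
  have -> : (x, y) - (0, 0) = (x, y) :> E * E by rewrite -[LHS]/(x - 0, y - 0) !subr0.
  exact: nxy.
apply: le_trans (qP (x, y) _) _.
  by rewrite /ball_ /= distrC (le_lt_trans _ (_ : q / 2 < q)) //; [|lra];
     rewrite -[(x, y) - _]/(x - 0, y - 0) !subr0 norm_pair ge_max xq.
by rewrite ler_pM2l.
Qed.

(** Differentiates [(g x g^-1) g = g x] at the neutral element. This expresses [Ad] through first
    derivatives of [m], which are themselves differentiable in [u]. *)
Lemma Ad_mul_chart u y : chart_im c u ->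
  'd m (0, u) (Ad c (e u) y, 0) = 'd m (u, 0) (0, y).
Proof.
move=> uc; have [d1 _] := mul_chart_smooth (mul_dom_0r uc).
have [d2 _] := mul_chart_smooth (mul_dom_r0 uc).
have [dr drE] := diff_pairr u (0 : E) y.
have dF := conj_chart_differentiable hG Ac c_dom1 c1 (e u).
have F0 := conj_chart0 c_dom1 c1 (e u).
have [dl _] := diff_pairl u (0 : E) y.
have [dFu dFuE] := diff_chain F0 dF dl.
have nE1 : \forall x \near (0 : E), m (conj_chart c (e u) x, u) = m (u, x).
  apply: filterS (conj_chart_dom c_dom1 c1 (e u)) => x dx.
  by rewrite /m /conj_chart /= chart_mapK // -mulgA mulVg mulg1.
have F0u : (conj_chart c (e u) 0, u) = (0, u) by rewrite F0.
have [_ /(_ y) E1] := diff_near_comp F0u nE1 dFu d1.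
have [_ /(_ y) E2] := diff_chain (erefl (u, (0 : E))) dr d2.
have E3 : 'd ((fun x => (x, u)) \o conj_chart c (e u)) 0 y = (Ad c (e u) y, 0).
  apply: etrans (dFuE y) (etrans (diff_pairl _ _ _).2 _).
  exact: (congr1 (fun v => (v, 0)) (esym (AdE hG Ac c_dom1 c1 (e u) y))).
exact: etrans (congr1 ('d m (0, u)) (esym E3)) (etrans (esym E1) (etrans E2 (congr1 ('d m (u, 0)) drE))).
Qed.

(** In the chart, [P ^~ u] and [Q ^~ u] are the differentials at the neutral element of right and
    left translation by [e u]; [PQ] below says that [Ad] turns the one into the other. *)
Let P v u := 'D_((v, 0) : E * E) m (0, u).
Let Q v u := 'D_((0, v) : E * E) m (u, 0).

Let P_diff v : differentiable (P v) 0.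
Proof.
have [_ /(_ (v, 0)) d] := mul_chart_smooth (mul_dom_0r im0).
have [dr _] := diff_pairr (0 : E) (0 : E) v.
by have [] := diff_chain (erefl ((0 : E), (0 : E))) dr d.
Qed.

Let Q_diff v : differentiable (Q v) 0.
Proof.
have [_ /(_ (0, v)) d] := mul_chart_smooth (mul_dom_r0 im0).
have [dl _] := diff_pairl (0 : E) (0 : E) v.
by have [] := diff_chain (erefl ((0 : E), (0 : E))) dl d.
Qed.

Let PE v u : chart_im c u -> P v u = 'd m (0, u) (v, 0).
Proof. by move=> uc; rewrite /P deriveE //; exact: (mul_chart_smooth (mul_dom_0r uc)).1. Qed.

Let QE v u : chart_im c u -> Q v u = 'd m (u, 0) (0, v).
Proof. by move=> uc; rewrite /Q deriveE //; exact: (mul_chart_smooth (mul_dom_r0 uc)).1. Qed.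

Let P0 v : P v 0 = v. Proof. by rewrite PE // diff_mul_chart00 addr0. Qed.
Let Q0 v : Q v 0 = v. Proof. by rewrite QE // diff_mul_chart00 add0r. Qed.

Let P_linear u : chart_im c u -> linear (P ^~ u).
Proof.
move=> uc a x y; rewrite !PE // -linearP; congr ('d m (0, u) _).
by rewrite -[RHS]/(a *: x + y, a *: (0 : E) + 0) scaler0 addr0.
Qed.

Let Q_linear u : chart_im c u -> linear (Q ^~ u).
Proof.
move=> uc a x y; rewrite !QE // -linearP; congr ('d m (u, 0) _).
by rewrite -[RHS]/(a *: (0 : E) + 0, a *: x + y) scaler0 addr0.
Qed.

Let P_near : exists2 C : R, 0 < C & \forall u \near (0 : E), forall v, `|P v u - v| <= C * `|u| * `|v|.
Proof.
apply: (@linear_family_near_id R n (fun u v => P v u)).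
  by apply: filterS im_near0 => u; exact: P_linear.
move=> j; have [C C0 h] := differentiable_near_lipschitz (P_diff 'e_j).
by exists C => //; apply: filterS h => u; rewrite P0 subr0.
Qed.

Let Q_near : exists2 C : R, 0 < C & \forall u \near (0 : E), forall v, `|Q v u - v| <= C * `|u| * `|v|.
Proof.
apply: (@linear_family_near_id R n (fun u v => Q v u)).
  by apply: filterS im_near0 => u; exact: Q_linear.
move=> j; have [C C0 h] := differentiable_near_lipschitz (Q_diff 'e_j).
by exists C => //; apply: filterS h => u; rewrite Q0 subr0.
Qed.

Let PQ u y : chart_im c u -> P (Ad c (e u) y) u = Q y u.
Proof. by move=> uc; exact: etrans (PE _ uc) (etrans (Ad_mul_chart y uc) (esym (QE y uc))). Qed.

Let near0_le (r : R) : 0 < r -> \forall u \near (0 : E), `|u| <= r.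
Proof.
move=> r0; apply/nbhs_normP; exists r => // u; rewrite /ball_ /= sub0r normrN.
exact: ltW.
Qed.

(** With [w = Ad c (e u) y], the relation [PQ] gives [w - y = (Q y u - y) - (P w u - w)]. For small
    [u] the contribution of [w - y] on the right is absorbed on the left. *)
Lemma Ad_near_id : exists2 C : R, 0 < C &
  \forall u \near (0 : E), forall y, `|Ad c (e u) y - y| <= C * `|u| * `|y|.
Proof.
have [C1 C10 P1] := P_near; have [C2 C20 Q1] := Q_near.
pose C := C1 + C2; have C0 : 0 < C by rewrite addr_gt0.
exists (4 * C); first by rewrite mulr_gt0.
near=> u => y; set w := Ad c (e u) y.
have uc : chart_im c u by near: u.
have Pu : forall v, `|P v u - v| <= C1 * `|u| * `|v| by near: u.
have Qu : forall v, `|Q v u - v| <= C2 * `|u| * `|v| by near: u.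
have uC : `|u| <= (2 * C)^-1 by near: u; apply: near0_le; rewrite invr_gt0 mulr_gt0.
have Cu : C * `|u| <= 2^-1.
  have : C * `|u| <= C * (2 * C)^-1 by rewrite ler_pM2l.
  by have -> : C * (2 * C)^-1 = 2^-1 by field; rewrite gt_eqF.
have wy : w - y = (Q y u - y) - (P w u - w) by rewrite PQ // opprB [RHS]addrC addrA subrK.
have wle : `|w| <= `|w - y| + `|y| by rewrite -{1}(subrK y w) ler_normD.
have h : `|w - y| <= C2 * `|u| * `|y| + C1 * `|u| * `|w|.
  by rewrite {1}wy (le_trans (ler_normB _ _)) // lerD.
have u0 := normr_ge0 u; have y0 := normr_ge0 y; have wy0 := normr_ge0 (w - y).
have h1 : C1 * `|u| * `|w| <= C1 * `|u| * (`|w - y| + `|y|).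
  by rewrite ler_wpM2l // mulr_ge0 // ltW.
have h2 : C * `|u| * `|w - y| <= 2^-1 * `|w - y| by rewrite ler_wpM2r.
have h3 : 0 <= C2 * `|u| * `|w - y| by rewrite !mulr_ge0 // ltW.
have h4 : 0 <= C2 * `|u| * `|y| by rewrite !mulr_ge0 // ltW.
have h5 : 0 <= C1 * `|u| * `|y| by rewrite !mulr_ge0 // ltW.
by rewrite /C in h2 *; lra.
Unshelve. all: by end_near. Qed.

(** The differential is that of [Q y] minus that of [P y]. The remaining term
    [P (w - y) u - (w - y)] is of second order, being bounded by a multiple of [|u| * |w - y|]. *)
Lemma Ad_differentiable y : exists L : {linear E -> E}, forall ep : R, 0 < ep ->
  \forall u \near (0 : E), `|Ad c (e u) y - y - L u| <= ep * `|u|.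
Proof.
have lin (f : E -> E) : differentiable f 0 -> f 0 = y ->
    exists L : {linear E -> E}, forall ep : R, 0 < ep ->
    \forall u \near (0 : E), `|f u - y - L u| <= ep * `|u|.
  move=> df f0; exists ('d f 0) => ep ep0.
  by apply: filterS (differentiable_eps df ep0) => u; rewrite f0 !subr0.
have [LQ LQP] := lin _ (Q_diff y) (Q0 y).
have [LP LPP] := lin _ (P_diff y) (P0 y).
exists (LQ \- LP) => ep ep0.
have [C1 C10 P1] := P_near; have [C2 C20 A1] := Ad_near_id.
have e3 : 0 < ep / 3 by rewrite divr_gt0.
have dQ := LQP _ e3; have dP := LPP _ e3.
have D0 : 0 < C1 * C2 * (`|y| + 1) by rewrite !mulr_gt0 // ltr_wpDl.
near=> u; set w := Ad c (e u) y.
have uc : chart_im c u by near: u.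
have Pu : forall v, `|P v u - v| <= C1 * `|u| * `|v| by near: u.
have Au : forall y, `|Ad c (e u) y - y| <= C2 * `|u| * `|y| by near: u.
have dQu : `|Q y u - y - LQ u| <= ep / 3 * `|u| by near: u.
have dPu : `|P y u - y - LP u| <= ep / 3 * `|u| by near: u.
have uC : `|u| <= ep / 3 / (C1 * C2 * (`|y| + 1)) by near: u; apply: near0_le; rewrite divr_gt0.
have Pwy : P (w - y) u = P w u - P y u.
  have := P_linear uc (-1) y w; rewrite !scaleN1r (addrC (- y)) [in X in _ = X -> _]addrC.
  exact.
have wy : w - y - (LQ \- LP) u =
    (Q y u - y - LQ u) - (P y u - y - LP u) - (P (w - y) u - (w - y)).
  rewrite Pwy PQ // /=; apply/rowP => i; rewrite !mxE; ring.
rewrite wy (le_trans (ler_normB _ _)) //.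
rewrite (le_trans (lerD (ler_normB _ _) (Pu _))) //.
have h1 : C1 * `|u| * `|w - y| <= C1 * `|u| * (C2 * `|u| * `|y|).
  by apply: ler_wpM2l; [rewrite mulr_ge0 ?(ltW C10)|exact: Au].
have h2 : `|u| * (C1 * C2 * (`|y| + 1)) <= ep / 3 by rewrite -ler_pdivlMr.
have h3 : C1 * `|u| * (C2 * `|u| * `|y|) <= ep / 3 * `|u|.
  apply: le_trans (ler_wpM2r (normr_ge0 u) h2).
  have : 0 <= C1 * C2 * `|u| * `|u| by rewrite !mulr_ge0 ?(ltW C10) ?(ltW C20).
  nra.
have := normr_ge0 u; lra.
Unshelve. all: by end_near. Qed.

(** Half the differential at [u] of the squaring map [x => m (x, x)]. *)
Let D v u := 2^-1 *: 'D_((v, v) : E * E) m (u, u).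

Let D_near : exists2 C : R, 0 < C & \forall u \near (0 : E), forall v, `|D v u - v| <= C * `|u| * `|v|.
Proof.
have [r r0 rP] := mul_dom_ball.
have dom_near : \forall u \near (0 : E), mul_dom (u, u).
  by apply: filterS (near0_le r0) => u ur; exact: rP.
apply: (@linear_family_near_id R n (fun u v => D v u)).
  apply: filterS dom_near => u du a x y.
  have [d _] := mul_chart_smooth du.
  rewrite /D !deriveE // scalerA mulrC -scalerA -scalerDr -linearP.
  by congr (_ *: 'd m (u, u) _).
move=> j.
have [_ /(_ ('e_j, 'e_j)) d] := mul_chart_smooth (mul_dom_r0 im0).
have [dd _] := diff_diag (0 : E) 'e_j.
have [dDj _] := diff_chain (erefl ((0 : E), (0 : E))) dd d.
have [C C0 h] := differentiable_near_lipschitz dDj.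
exists C => //; apply: filterS h => u; rewrite subr0 => h.
have D0 : 'e_j = 2^-1 *: 'D_(('e_j, 'e_j) : E * E) m (0, 0).
  rewrite deriveE; last exact: (mul_chart_smooth (mul_dom_r0 im0)).1.
  rewrite diff_mul_chart00 scalerDr -scalerDl.
  have -> : 2^-1 + 2^-1 = 1 :> R by field.
  by rewrite scale1r.
pose F : E -> E := 'D_(('e_j, 'e_j) : E * E) m \o (fun y => (y, y)).
have -> : D 'e_j u - 'e_j = 2^-1 *: (F u - F 0) by rewrite scalerBr; congr (_ - _); exact: D0.
rewrite normrZ ger0_norm ?invr_ge0 //.
have := normr_ge0 (F u - F 0); rewrite -/F in h; lra.
Qed.

(** The mean value theorem on the segment from [y] to [x], one coordinate at a time: the
    differential of squaring there is [2 *: D], close to twice the identity. This is the hypothesis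
    on [sq] in the halving equation. *)
Lemma sq_chart_estimate : exists r C : R, [/\ 0 < r, 0 < C,
  forall x y, `|x| <= r -> `|y| <= r -> mul_dom (x, y) &
  forall x y, `|x| <= r -> `|y| <= r ->
    `|m (x, x) - m (y, y) - 2 *: (x - y)| <= C * Num.max `|x| `|y| * `|x - y|].
Proof.
have [r1 r10 r1P] := mul_dom_ball.
have [C C0 /nbhs_normP[r2 /= r20 r2P]] := D_near.
pose r := Num.min r1 (r2 / 2).
exists r, (2 * C); split.
- by rewrite lt_min r10 divr_gt0.
- by rewrite mulr_gt0.
- by move=> x y; rewrite !le_min => /andP[xr _] /andP[yr _]; exact: r1P.
move=> x y xr yr; set d := x - y; set M := Num.max _ _.
have Mr : M <= r by rewrite ge_max xr.
have seg (t : R) : 0 <= t <= 1 -> `|y + t *: d| <= M.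
  move=> /andP[t0 t1].
  have -> : y + t *: d = (1 - t) *: y + t *: x by apply/rowP => i; rewrite !mxE; ring.
  rewrite (le_trans (ler_normD _ _)) // !normrZ !ger0_norm ?subr_ge0 //.
  have xM : `|x| <= M by rewrite le_max lexx.
  have yM : `|y| <= M by rewrite le_max lexx orbT.
  have := ler_wpM2l t0 xM; have := @ler_wpM2l _ (1 - t) _ _ _ yM; rewrite subr_ge0 => /(_ t1).
  lra.
have bound (t : R) v : 0 <= t <= 1 -> `|D v (y + t *: d) - v| <= C * M * `|v|.
  move=> tt; have sM := seg t tt.
  apply: le_trans (r2P _ _ v) _.
    rewrite /ball_ /= sub0r normrN (le_lt_trans (le_trans sM Mr)) //.
    by rewrite /r gt_min; apply/orP; right; lra.
  by rewrite ler_wpM2r // ler_pM2l.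
pose psi t : E := m (y + t *: d, y + t *: d).
have dpsi (t : R) : 0 <= t <= 1 -> differentiable psi t /\ 'd psi t 1 = 2 *: D d (y + t *: d).
  move=> tt.
  have dom : mul_dom (y + t *: d, y + t *: d).
    have h : `|y + t *: d| <= r1.
      by rewrite (le_trans (seg t tt)) // (le_trans Mr) // /r ge_min lexx.
    exact: r1P.
  have [dm _] := mul_chart_smooth dom.
  have [dl dlE] := diff_line y d t.
  have [dd _] := diff_diag (y + t *: d) d.
  have [dld dldE] := @diff_chain R _ _ _ _ (fun t : R => y + t *: d) t _ (erefl _) dl dd.
  have [dp dpE] := @diff_chain R _ _ _ _ ((fun x => (x, x)) \o (fun t : R => y + t *: d)) t _ (erefl _) dld dm.
  split; first exact: dp.
  have E1 : 'd ((fun x => (x, x)) \o (fun t : R => y + t *: d)) t 1 = (d, d).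
    by apply: etrans (dldE 1) _; rewrite dlE; exact: (diff_diag _ _).2.
  apply: etrans (dpE 1) (etrans (congr1 ('d m _) E1) _).
  by rewrite /D scalerA divff ?pnatr_eq0 // scale1r deriveE.
apply: ler_norm_rV => [|i].
  by rewrite mulr_ge0 // mulr_ge0 ?mulr_ge0 ?(ltW C0) // le_max normr_ge0.
have dcoord (t : R) : t \in `]0, 1[ -> is_derive t (1 : R) (fun t => psi t 0 i : R) ((2 *: D d (y + t *: d)) 0 i).
  rewrite in_itv /= => /andP[t0 t1]; have [h1 <-] := dpsi t ltac:(by rewrite !ltW).
  exact: is_derive_coord.
have cpsi : {within `[0, 1], continuous (fun t => psi t 0 i : R)}.
  apply: derivable_within_continuous => t; rewrite in_itv /= => tt.
  by have [h1 _] := dpsi t tt; have [h2 _] := is_derive_coord i h1.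
have [t tt tE] := MVT ltr01 dcoord cpsi.
have {}tt : 0 <= t <= 1 by move: tt; rewrite in_itv /= => /andP[t0 t1]; rewrite !ltW.
have -> : (m (x, x) - m (y, y) - 2 *: d) 0 i = (2 *: (D d (y + t *: d) - d)) 0 i.
  move: tE; rewrite subr0 mulr1 /psi scale1r scale0r addr0.
  have -> : y + d = x by rewrite addrC subrK.
  have cB (u v : E) : (u - v) 0 i = u 0 i - v 0 i by rewrite !mxE.
  move=> tE'; apply: etrans (etrans (cB _ _) (congr1 (fun z => z - (2 *: d) 0 i) (etrans (cB _ _) tE'))) _.
  by rewrite (scalerBr 2 (D d (y + t *: d)) d); exact: esym (cB _ _).
apply: le_trans (ler_norm_coord _ _) _; rewrite normrZ normr_nat.
by have := bound t d tt; lra.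
Qed.

Definition inv_chart (x : E) : E := c (e x)^-1%g.

(** Differentiating [m (u, inv_chart u) = 0] shows that inversion has differential [-1]. It governs
    one-parameter subgroups at negative times. *)
Lemma inv_chart_near ep : 0 < ep ->
  \forall u \near (0 : E), [/\ chart_im c u, chart_dom c (e u)^-1%g & `|inv_chart u + u| <= ep * `|u|].
Proof.
move=> ep0.
have di : differentiable inv_chart 0.
  case: hG => _ _ _ _ /(_ c c Ac Ac 1%N)[+ _]; apply.
  by split=> //; rewrite e0 invg1.
have i0 : inv_chart 0 = 0 by rewrite /inv_chart e0 invg1 c1.
have cvi : (e u)^-1%g @[u --> (0 : E)] --> (1%g : G).
  rewrite -[X in _ --> X]invg1.
  by apply: (@cvg_invg _ _ (nbhs (0 : E))); exact: chart_inv_cvg0.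
have idom : \forall u \near (0 : E), chart_dom c (e u)^-1%g := cvi _ (chart_dom_near c_dom1).
have nE : \forall u \near (0 : E), m (u, inv_chart u) = (cst 0 : E -> E) u.
  by apply: filterS idom => u du; rewrite /m /inv_chart /= chart_mapK // mulgV c1.
have [d00 _] := mul_chart_smooth (mul_dom_r0 im0).
have dE v : 'd inv_chart 0 v = - v.
  have [dg dgE] := diff_graph v di.
  have g0 : (0, inv_chart 0) = ((0 : E), (0 : E)) by rewrite i0.
  have [_ /(_ v) h] := diff_near_comp g0 nE dg d00.
  have z : 'd (cst (0 : E) : E -> E) 0 v = 0 by rewrite diff_cst.
  have S : v + 'd inv_chart 0 v = 0.
    apply: etrans (esym (diff_mul_chart00 v ('d inv_chart 0 v))) _.
    exact: etrans (congr1 ('d m (0, 0)) (esym dgE)) (etrans (esym h) z).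
  exact: esym (addr0_eq S).
have h := differentiable_eps di ep0.
apply: filterS3 im_near0 idom h => u h1 h2; rewrite i0 !subr0 dE opprK => h3.
by split.
Qed.

End LocalEstimates.

(** * One-parameter subgroups *)

(** The extension to [t >= 0] is [g (t / N) ^ N] for any large [N]; to all real times, it is the
    quotient of the values at the positive and negative parts. *)
Lemma extend_local_semigroup (R : realType) (G : groupType) (g : R -> G) (d : R) :
  0 < d ->
  (forall s t, 0 <= s -> 0 <= t -> s + t <= d -> g (s + t) = (g s * g t)%g) ->
  exists f : R -> G, (forall s t, f (s + t) = (f s * f t)%g) /\
    forall t, 0 <= t <= d -> f t = g t /\ f (- t) = (g t)^-1%g.
Proof.
move=> d0 gD.
have g0 : g 0 = 1%g.
  have := gD 0 0 (lexx 0) (lexx 0) ltac:(by rewrite addr0 ltW); rewrite addr0 => h.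
  by apply: (mulgI (g 0)); rewrite mulg1 -h.
have gX (k : nat) x : 0 <= x -> k%:R * x <= d -> g (k%:R * x) = (g x ^+ k)%g.
  elim: k => [|k IH] x0; first by rewrite mul0r g0 expg0.
  rewrite -natr1 mulrDl mul1r => kx; rewrite gD ?mulr_ge0 //; last by rewrite expgSr IH //; lra.
have gC s t : 0 <= s -> 0 <= t -> s + t <= d -> commute (g s) (g t).
  by move=> s0 t0 st; rewrite /commute -!gD // addrC.
(* For [t >= 0] this [N] exceeds [t / d], so [t / N] is in the range where [g] is additive. Two
   choices [N] and [M] are compared through [t / (N * M)]. *)
pose F t := let N := (Num.bound (t / d)).+1 in (g (t / N%:R)%R ^+ N)%g.
have bnd t : 0 <= t -> t / (Num.bound (t / d)).+1%:R <= d.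
  move=> t0; rewrite ler_pdivrMr // mulrC -ler_pdivrMr //.
  rewrite (le_trans (ltW (archi_boundP _))) ?divr_ge0 ?(ltW d0) //.
  by rewrite ler_nat.
have FE t (N : nat) : (0 < N)%N -> 0 <= t -> t / N%:R <= d -> F t = (g (t / N%:R)%R ^+ N)%g.
  move=> N0 t0 tN; rewrite /F; set M := (Num.bound (t / d)).+1.
  have tM : t / M%:R <= d := bnd t t0.
  have NR : N%:R != 0 :> R by rewrite pnatr_eq0 -lt0n.
  have MR : M%:R != 0 :> R by rewrite pnatr_eq0.
  have sub1 : t / M%:R = N%:R * (t / (N * M)%:R) by rewrite natrM; field; rewrite NR MR.
  have sub2 : t / N%:R = M%:R * (t / (N * M)%:R) by rewrite natrM; field; rewrite NR MR.
  have p0 : 0 <= t / (N * M)%:R by rewrite divr_ge0.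
  rewrite sub1 sub2 in tM tN *.
  by rewrite !gX // -!expgnA mulnC.
have FD s t : 0 <= s -> 0 <= t -> F (s + t) = (F s * F t)%g.
  move=> s0 t0; pose N := (Num.bound ((s + t) / d)).+1.
  have st0 : 0 <= s + t by rewrite addr_ge0.
  have stN : (s + t) / N%:R <= d := bnd _ st0.
  have sN : 0 <= s / N%:R by rewrite divr_ge0.
  have tN : 0 <= t / N%:R by rewrite divr_ge0.
  rewrite mulrDl in stN.
  rewrite (FE _ N) // ?mulrDl // (FE s N) // ?(FE t N) //; [|lra|lra].
  by rewrite gD // expgMn //; exact: gC.
have Fg t : 0 <= t <= d -> F t = g t.
  by move=> /andP[t0 td]; rewrite (FE t 1%N) // ?divr1 // expg1.
have FC s t : 0 <= s -> 0 <= t -> commute (F s) (F t).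
  by move=> s0 t0; rewrite /commute -!FD // addrC.
clear FE bnd; clearbody F; pose f t := (F (Num.max t 0) * (F (Num.max (- t) 0))^-1)%g.
have max0 (x : R) : 0 <= Num.max x 0 by rewrite le_max lexx orbT.
have maxB (x : R) : Num.max x 0 - Num.max (- x) 0 = x.
  have [x0|x0] := lerP x 0; first by rewrite max_l ?oppr_ge0 // sub0r opprK.
  by rewrite max_r ?oppr_le0 ?(ltW x0) // subr0.
(* The value depends on the difference [a - b] only, however it is written. *)
have fE a b : 0 <= a -> 0 <= b -> f (a - b) = (F a * (F b)^-1)%g.
  move=> a0 b0; rewrite /f; set p := Num.max _ _; set q := Num.max _ _.
  have pq : p + b = a + q by have := maxB (a - b); rewrite -/p -/q; lra.
  have p0 : 0 <= p by exact: max0.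
  have q0 : 0 <= q by exact: max0.
  have := congr1 F pq; rewrite !FD // => h.
  apply: (mulIg (F b)); rewrite mulgVK; apply: (mulIg (F q)).
  by rewrite -(mulgA _ (F b)) (FC b q b0 q0 : (F b * F q = F q * F b)%g) (mulgA _ (F q)) mulgVK.
exists f; split=> [s t|t /andP[t0 td]].
  rewrite -{1}(maxB s) -{1}(maxB t).
  have -> : Num.max s 0 - Num.max (- s) 0 + (Num.max t 0 - Num.max (- t) 0) =
    (Num.max s 0 + Num.max t 0) - (Num.max (- s) 0 + Num.max (- t) 0) by ring.
  rewrite fE ?addr_ge0 // !FD // invgM /f -!mulgA; congr (_ * _)%g.
  rewrite mulgA; apply/esym/commuteM; first by apply/commute_sym/commuteV/commute_sym; exact: FC.
  by apply/commuteV/commute_sym/commuteV; exact: FC.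
have F0 : F 0 = 1%g by rewrite Fg ?lexx ?(ltW d0).
have fF x : 0 <= x -> f x = F x.
  by move=> x0; have := fE x 0 x0 (lexx 0); rewrite subr0 F0 invg1 mulg1.
split; first by rewrite fF // Fg // t0.
by have := fE 0 t (lexx 0) t0; rewrite sub0r F0 mul1g => ->; rewrite Fg // t0.
Qed.

Section OneParameter.
Context (R : realType) (n : nat).
Notation E := 'rV[R]_n.
Context (G : topGroupType) (A : set (chart G E)) (hG : lie_group A).
Context (c : chart G E) (br : {bilinear E -> E -> E}) (hbr : lie_bracket br).
Context (hc : lie_algebra_of A c br).

Local Notation e := (chart_inv c).
Notation m := (mul_chart c).

Let Ac : A c. Proof. by case: hc. Qed.
Let c_dom1 : chart_dom c 1%g. Proof. by case: hc. Qed.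
Let c1 : c 1%g = 0. Proof. by case: hc. Qed.
Let e0 : e 0 = 1%g. Proof. exact: chart_inv0. Qed.

Lemma near_scale (P : E -> Prop) (z : E) : (\forall u \near (0 : E), P u) ->
  \forall t \near (0 : R), P (t *: z).
Proof.
move=> nP; have cv : t *: z @[t --> (0 : R)] --> (0 : E).
  by rewrite -[X in _ --> X](scale0r z); exact: scalel_continuous.
exact: (cv _ nP).
Qed.

(** The definition of the Lie algebra gives derivatives of [Ad] along lines only; as the full
    differential exists, they determine it. *)
Lemma Ad_differentiable_br y ep : 0 < ep ->
  \forall u \near (0 : E), `|Ad c (e u) y - y - br u y| <= ep * `|u|.
Proof.
have [L LP] := Ad_differentiable hG Ac c_dom1 c1 y.
suff LE z : L z = br z y by move=> ep0; apply: filterS (LP ep ep0) => u; rewrite LE.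
pose phi (t : R) := Ad c (e (t *: z)) y.
have phi0 : phi 0 = y by rewrite /phi scale0r e0 (Ad1 hG Ac c_dom1 c1).
have [_ _ _ /(_ z y) [_ <-]] := hc.
suff [_ ->] : is_derive (0 : R) (1 : R) phi (L z) by [].
apply: is_derive_of_eps => ep' ep0.
have ez : 0 < ep' / (`|z| + 1) by rewrite divr_gt0 // ltr_wpDl.
apply: filterS (near_scale z (LP _ ez)) => t; rewrite !subr0 phi0 /= linearZ /= normrZ.
move=> /le_trans; apply; rewrite mulrCA mulrC ler_wpM2r //.
by rewrite mulrAC ler_pdivrMr ?ltr_wpDl // ler_pM2l // lerDl.
Qed.

Section Existence.
Context (z : E) (r C d K : R) (u : R -> E).
Context (r0 : 0 < r) (C0 : 0 < C) (d0 : 0 < d) (K0 : 0 < K).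
Context (dom : forall x y, `|x| <= r -> `|y| <= r ->
  [/\ chart_im c x, chart_im c y & chart_dom c (e x * e y)%g]).
Context (sqP : forall x y, `|x| <= r -> `|y| <= r ->
    `|m (x, x) - m (y, y) - 2 *: (x - y)| <= C * Num.max `|x| `|y| * `|x - y|).
Context (uP : forall t, 0 <= t <= d ->
  [/\ `|u t| <= r, `|u t - t *: z| <= K * t ^+ 2 & u t = m (u (t / 2), u (t / 2))]).

Let g t := e (u t).
Let K1 := `|z| + K * d + 1.

Let half t : 0 <= t <= d -> 0 <= t / 2 <= d.
Proof. by move=> /andP[t0 td]; apply/andP; split; lra. Qed.

Let K1_gt0 : 0 < K1.
Proof. by rewrite ltr_wpDl // addr_ge0 // mulr_ge0 // ltW. Qed.

Let u_le t : 0 <= t <= d -> `|u t| <= K1 * t.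
Proof.
move=> tt; have [_ h _] := uP tt; have /andP[t0 td] := tt.
rewrite -(subrK (t *: z) (u t)) (le_trans (ler_normD _ _)) // normrZ ger0_norm //.
have h1 : K * t ^+ 2 <= K * d * t by rewrite expr2 mulrA ler_wpM2r // ler_wpM2l // ltW.
rewrite /K1 !mulrDl mul1r (mulrC t); lra.
Qed.

Let u0 : u 0 = 0.
Proof.
have := @u_le 0; rewrite lexx (ltW d0) mulr0 normr_le0 => /(_ isT) /eqP.
exact.
Qed.

Let gD2 t : 0 <= t <= d -> g t = (g (t / 2) * g (t / 2))%g.
Proof.
move=> tt; have [_ _ uE] := uP tt; have [h _ _] := uP (half tt).
by rewrite /g [in LHS]uE chart_mapK //; have [_ _] := dom h h.
Qed.

(** Carries facts from arbitrarily short times to all of [[0, d]]. *)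
Let g_pow (j : nat) t : 0 <= t <= d -> g t = (g (t / 2 ^+ j)%R ^+ (2 ^ j))%g.
Proof.
elim: j t => [|j IH] t tt; first by rewrite expr0 divr1 expg1.
rewrite gD2 // (IH _ (half tt)) -mulrA -invfM -exprS -expgnDr; congr (_ ^+ _)%g.
by rewrite expnS mul2n addnn.
Qed.

Let u_cvg (P : E -> Prop) : (\forall x \near (0 : E), P x) ->
  exists2 d', 0 < d' & d' <= d /\ forall t, 0 <= t <= d' -> P (u t).
Proof.
move=> /nbhs_normP[q /= q0 qP]; exists (Num.min d (q / (2 * K1))).
  by rewrite lt_min d0 divr_gt0 // mulr_gt0.
split; first by rewrite ge_min lexx.
move=> t /andP[t0]; rewrite le_min => /andP[td tq].
apply: qP; rewrite /ball_ /= sub0r normrN (le_lt_trans (u_le _)) ?t0 //.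
have : K1 * t <= K1 * (q / (2 * K1)) by rewrite ler_pM2l.
have -> : K1 * (q / (2 * K1)) = q / 2 by field; rewrite gt_eqF.
lra.
Qed.

(* [phi t := Ad (g t) z - z] satisfies [phi t = o(t)] since [[z, z] = 0], and
   [phi (2 t) = Ad (g t) (phi t) + phi t]. *)
Let Ad_g_z : exists2 d', 0 < d' & d' <= d /\ forall t, 0 <= t <= d' -> Ad c (g t) z = z.
Proof.
have [C' C'0 /u_cvg[d1 d10 [d1d AdP]]] := Ad_near_id hG Ac c_dom1 c1.
have CK : 0 < C' * K1 by rewrite mulr_gt0.
pose d' := Num.min d1 (2 * (C' * K1))^-1.
have d'0 : 0 < d' by rewrite lt_min d10 invr_gt0 mulr_gt0.
have d'd : d' <= d by rewrite (le_trans _ d1d) // ge_min lexx.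
exists d' => //; split=> // t tt; apply/eqP; rewrite -subr_eq0 -normr_eq0; apply/eqP.
apply: (@halving_unique R (C' * K1) d' (fun t => `|Ad c (g t) z - z|)) tt => //.
- have : 2 * (C' * K1) * d' <= 2 * (C' * K1) * (2 * (C' * K1))^-1.
    by rewrite ler_pM2l ?mulr_gt0 // ge_min lexx orbT.
  by rewrite divff // mulf_neq0 ?pnatr_eq0 // gt_eqF.
- move=> {}t /andP[t0 td]; rewrite normr_ge0 /=.
  have tt : 0 <= t <= d by rewrite t0 (le_trans td).
  have t2 : 0 <= t / 2 <= d1.
    by have : d' <= d1 by [rewrite ge_min lexx]; move=> h; apply/andP; split; lra.
  rewrite gD2 // (AdM hG Ac c_dom1 c1); set w := Ad c (g (t / 2)) z.
  have -> : Ad c (g (t / 2)) w - z = (Ad c (g (t / 2)) (w - z) - (w - z)) + 2 *: (w - z).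
    have gen (w1 w2 w3 : E) : w1 - w3 = (w1 - w2) - (w2 - w3) + 2 *: (w2 - w3).
      by apply/rowP => i; rewrite !mxE; ring.
    by rewrite (AdB hG Ac c_dom1 c1); exact: gen.
  rewrite (le_trans (ler_normD _ _)) // normrZ normr_nat.
  have h1 := AdP _ t2 (w - z).
  have h2 : C' * `|u (t / 2)| * `|w - z| <= C' * (K1 * (t / 2)) * `|w - z|.
    by rewrite ler_wpM2r // ler_wpM2l ?u_le ?half // ltW.
  have : 0 <= C' * K1 * t * `|w - z| by rewrite mulr_ge0 // mulr_ge0 // ltW.
  lra.
- move=> ep ep0.
  have [kb kb0 kbP] : exists2 k : R, 0 < k & forall x y, `|br x y| <= k * `|x| * `|y|.
    by apply: bilinear_rV_bound => [x|y] a x' y'; [exact: linearPr|exact: linearPl].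
  have ep1 : 0 < ep / (2 * K1) by rewrite divr_gt0 // mulr_gt0.
  have [d2 d20 [d2d h2]] := u_cvg (Ad_differentiable_br z ep1).
  have q0 : 0 < kb * K * `|z| + 1 by rewrite ltr_wpDl // !mulr_ge0 // ltW.
  exists (Num.min d2 (ep / (2 * (kb * K * `|z| + 1)))).
    by rewrite lt_min d20 divr_gt0 // mulr_gt0.
  move=> {}t /andP[t0]; rewrite le_min => /andP[td2 td3].
  have tt : 0 <= t <= d by rewrite t0 (le_trans td2).
  have h := h2 t ltac:(by rewrite t0).
  (* Since [u t] differs from [t *: z] by [O(t ^ 2)], so small is its bracket with [z]. *)
  have bz : br (u t) z = br (u t - t *: z) z.
    by rewrite linearBl /= linearZl_LR /= hbr.1 scaler0 subr0.
  have h3 := kbP (u t - t *: z) z; rewrite -bz in h3.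
  have [_ h4 _] := uP tt.
  have h5 : kb * `|u t - t *: z| * `|z| <= kb * (K * t ^+ 2) * `|z|.
    by rewrite ler_wpM2r // ler_wpM2l // ltW.
  have h6 : ep / (2 * K1) * `|u t| <= ep / (2 * K1) * (K1 * t).
    by rewrite ler_wpM2l ?u_le // ltW.
  have h7 : ep / (2 * K1) * (K1 * t) = ep / 2 * t by field; rewrite gt_eqF.
  have h8 : t * (kb * K * `|z| + 1) <= ep / 2.
    have := ler_wpM2r (ltW q0) td3.
    by have -> : ep / (2 * (kb * K * `|z| + 1)) * (kb * K * `|z| + 1) = ep / 2 by field; rewrite gt_eqF.
  have h9 : t * (t * (kb * K * `|z| + 1)) <= t * (ep / 2) by rewrite ler_wpM2l.
  have h10 : `|Ad c (g t) z - z| <= `|Ad c (e (u t)) z - z - br (u t) z| + `|br (u t) z|.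
    by rewrite -{1}(subrK (br (u t) z) (Ad c (g t) z - z)) ler_normD.
  have := mulr_ge0 t0 t0; rewrite expr2 in h5; lra.
Qed.

(** Conjugating the curve by [g s] gives another solution of the halving equation, with tangent
    [Ad c (g s) z = z]. By uniqueness it coincides with [u] at short times, and [g_pow] reaches
    every [t]. *)
Let g_comm_small : exists2 d', 0 < d' & d' <= d /\
  forall s t, 0 <= s <= d' -> 0 <= t <= d -> commute (g s) (g t).
Proof.
have [d' d'0 [d'd Adz]] := Ad_g_z; exists d' => //; split=> // s t /Adz sz tt.
have dconj := conj_chart_differentiable hG Ac c_dom1 c1 (g s).
have conj0 := conj_chart0 c_dom1 c1 (g s).
have [k k0 lip] := differentiable_near_lipschitz dconj.
have lip' : \forall x \near (0 : E), `|conj_chart c (g s) x| <= k * `|x|.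
  by apply: filterS lip => x; rewrite conj0 !subr0.
have [d1 d10 [d1d P1]] := u_cvg lip'.
have [d2 d20 [d2d P2]] := u_cvg (conj_chart_dom c_dom1 c1 (g s)).
pose w (t : R) := conj_chart c (g s) (u t).
pose d3 := Num.min d1 (Num.min d2 (r / (k * K1))).
have d30 : 0 < d3 by rewrite !lt_min d10 d20 divr_gt0 // mulr_gt0.
have d31 x : x <= d3 -> [/\ x <= d1, x <= d2 & x <= r / (k * K1)].
  by rewrite !le_min => /and3P[].
have sq0 : (fun x => m (x, x)) 0 = 0 by rewrite /m /= e0 mulg1 c1.
have wP x : 0 <= x <= d3 -> [/\ `|w x| <= r, `|w x| <= (k + 1) * K1 * x &
    w x = m (w (x / 2), w (x / 2))].
  move=> /andP[x0 /d31[xd1 xd2 xr]].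
  have xx : 0 <= x <= d by rewrite x0 (le_trans xd1).
  have wx : `|w x| <= k * (K1 * x).
    apply: le_trans (P1 x _) _; first by rewrite x0.
    by rewrite ler_pM2l // u_le.
  split.
  - apply: le_trans wx _; have : x * (k * K1) <= r by rewrite -ler_pdivlMr // mulr_gt0.
    lra.
  - have := mulr_ge0 (ltW K1_gt0) x0; lra.
  have x2 : 0 <= x / 2 <= d2 by apply/andP; split; lra.
  rewrite /w /m /conj_chart /= chart_mapK; last exact: P2.
  have conjM (a b : G) : (a * (b * b) * a^-1 = (a * b * a^-1) * (a * b * a^-1))%g.
    by rewrite !mulgA mulgVK.
  congr (c _); rewrite -[e (u x)]/(g x) (gD2 xx).
  exact: conjM.
have uP' x : 0 <= x <= d3 -> [/\ `|u x| <= r, `|u x| <= (k + 1) * K1 * x &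
    u x = m (u (x / 2), u (x / 2))].
  move=> /andP[x0 /d31[xd1 xd2 xr]].
  have xx : 0 <= x <= d by rewrite x0 (le_trans xd1).
  have [h1 _ h2] := uP xx; split=> //.
  apply: le_trans (u_le xx) _; have := mulr_ge0 (mulr_ge0 (ltW k0) (ltW K1_gt0)) x0; lra.
have K2 : 0 < (k + 1) * K1 by rewrite mulr_gt0 // addr_gt0.
have [ep ep0|d4 d40 wu] := doubling_unique (sq := fun x : E => m (x, x)) C0 sqP d30 K2 wP uP'.
  have [kA kA0 kAP] : exists2 k : R, 0 < k & forall x, `|Ad c (g s) x| <= k * `|x|.
    by apply: linear_rV_bound; exact: (Ad_linear hG Ac c_dom1 c1).
  have ep1 : 0 < ep / (2 * K1) by rewrite divr_gt0 // mulr_gt0.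
  have [d5 d50 [d5d h5]] := u_cvg (differentiable_eps dconj ep1).
  have q0 : 0 < (kA + 1) * K by rewrite mulr_gt0 // addr_gt0.
  exists (Num.min d5 (ep / (2 * ((kA + 1) * K)))).
    by rewrite lt_min d50 divr_gt0 // mulr_gt0.
  move=> x /andP[x0]; rewrite le_min => /andP[xd5 xq].
  have xx : 0 <= x <= d by rewrite x0 (le_trans xd5).
  have := h5 x ltac:(by rewrite x0); rewrite conj0 !subr0 -(AdE hG Ac c_dom1 c1) -/(w x) => h.
  have split3 : w x - u x = (w x - Ad c (g s) (u x)) + (Ad c (g s) (u x - x *: z) - (u x - x *: z)).
    rewrite (AdB hG Ac c_dom1 c1) (AdZ hG Ac c_dom1 c1) sz.
    by apply/rowP => i; rewrite !mxE; ring.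
  have [_ h1 _] := uP xx.
  have h2 : `|Ad c (g s) (u x - x *: z) - (u x - x *: z)| <= (kA + 1) * `|u x - x *: z|.
    by rewrite (le_trans (ler_normB _ _)) // mulrDl mul1r lerD.
  have h3 : (kA + 1) * `|u x - x *: z| <= (kA + 1) * (K * x ^+ 2) by rewrite ler_pM2l // addr_gt0.
  have h4 : ep / (2 * K1) * `|u x| <= ep / (2 * K1) * (K1 * x) by rewrite ler_pM2l // u_le.
  have h6 : ep / (2 * K1) * (K1 * x) = ep / 2 * x by field; rewrite gt_eqF.
  have h7 : x * ((kA + 1) * K) <= ep / 2.
    have := ler_wpM2r (ltW q0) xq.
    by have -> : ep / (2 * ((kA + 1) * K)) * ((kA + 1) * K) = ep / 2
      by field; rewrite (gt_eqF K0) gt_eqF // addr_gt0.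
  have h8 : x * (x * ((kA + 1) * K)) <= x * (ep / 2) by rewrite ler_wpM2l.
  have := ler_normD (w x - Ad c (g s) (u x)) (Ad c (g s) (u x - x *: z) - (u x - x *: z)).
  by rewrite -split3; rewrite expr2 in h3; lra.
have small x : 0 <= x -> x <= d4 -> x <= d2 -> commute (g s) (g x).
  move=> x0 xd4 xd2.
  have := congr1 e (wu x ltac:(by rewrite x0)).
  rewrite /w /conj_chart chart_mapK; last by apply: P2; rewrite x0.
  rewrite -[e (u x)]/(g x) => h; rewrite /commute -[in RHS]h.
  by rewrite mulgVK.
have [j jP] : exists j : nat, t / 2 ^+ j <= Num.min d4 d2.
  have q0 : 0 < Num.min d4 d2 by rewrite lt_min d40.
  have /andP[t0 _] := tt.
  have [j jP] : exists j : nat, t / Num.min d4 d2 < j%:R.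
    by exists (Num.bound (t / Num.min d4 d2)); apply: archi_boundP; rewrite divr_ge0 // ltW.
  exists j; rewrite ler_pdivrMr ?exprn_gt0 // mulrC -ler_pdivrMr //.
  rewrite (le_trans (ltW jP)) // -natrX ler_nat; exact: ltnW (ltn_expl _ _).
move: jP; rewrite le_min => /andP[j1 j2].
rewrite (g_pow j tt); apply: commuteX; apply: small => //.
by have /andP[t0 _] := tt; rewrite divr_ge0 // exprn_ge0.
Qed.

Let g_comm s t : 0 <= s <= d -> 0 <= t <= d -> commute (g s) (g t).
Proof.
move=> sd td; have [d' d'0 [d'd h]] := g_comm_small.
have /andP[s0 _] := sd.
have [j jP] : exists j : nat, s / 2 ^+ j <= d'.
  have [j jP] : exists j : nat, s / d' < j%:R.
    by exists (Num.bound (s / d')); apply: archi_boundP; rewrite divr_ge0 // ltW.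
  exists j; rewrite ler_pdivrMr ?exprn_gt0 // mulrC -ler_pdivrMr //.
  rewrite (le_trans (ltW jP)) // -natrX ler_nat; exact: ltnW (ltn_expl _ _).
rewrite (g_pow j sd); apply/commute_sym/commuteX/commute_sym/h => //.
by rewrite jP divr_ge0 // exprn_ge0.
Qed.

(** Both [x => m (u (s * x), u (t * x))] and [x => u ((s + t) * x)] solve the halving equation, the
    first one because [g] commutes with itself, and both have tangent [(s + t) *: z]. They agree for
    small [x]. *)
Let g_add s t : 0 <= s -> 0 <= t -> s + t <= d -> g (s + t) = (g s * g t)%g.
Proof.
move=> s0 t0 std; pose M := s + t + 1.
have M0 : 0 < M by rewrite ltr_wpDl // addr_ge0.
have sM : s <= M by rewrite /M; lra.
have tM : t <= M by rewrite /M; lra.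
pose v (x : R) := m (u (s * x), u (t * x)).
pose w (x : R) := u ((s + t) * x).
have in01 x : 0 <= x <= 1 -> [/\ 0 <= s * x <= d, 0 <= t * x <= d & 0 <= (s + t) * x <= d].
  move=> /andP[x0 x1].
  have hs := ler_wpM2l s0 x1; have ht := ler_wpM2l t0 x1.
  by split; apply/andP; split; rewrite ?mulr_ge0 ?addr_ge0 //; lra.
have [q q0 qP] := mul_chart_near_add hG Ac c_dom1 c1 ltr01.
have nearq (q' : R) : 0 < q' -> \forall x \near (0 : E), `|x| <= q'.
  move=> q'0; apply/nbhs_normP; exists q' => // x; rewrite /ball_ /= sub0r normrN.
  exact: ltW.
have [d1 d10 [d1d P1]] := u_cvg (nearq q q0).
pose K2 := 2 * (K1 * M); have K20 : 0 < K2 by rewrite !mulr_gt0.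
pose d2 := Num.min 1 (Num.min (d1 / M) (r / K2)).
have d20 : 0 < d2 by rewrite !lt_min ltr01 !divr_gt0.
have d2P x : 0 <= x <= d2 -> [/\ 0 <= x <= 1, x * M <= d1 & x * K2 <= r].
  move=> /andP[x0]; rewrite !le_min => /and3P[x1 xd xr].
  by rewrite x0 x1 -!ler_pdivlMr.
have sub_le x y : 0 <= x -> 0 <= y <= M -> x * M <= d1 -> 0 <= y * x <= d1.
  move=> x0 /andP[y0 yM] xM; rewrite mulr_ge0 //= (le_trans _ xM) // mulrC.
  by rewrite ler_wpM2l.
have vP x : 0 <= x <= d2 -> [/\ `|v x| <= r, `|v x| <= K2 * x & v x = m (v (x / 2), v (x / 2))].
  move=> /[dup] xx /d2P[x1 xM xr]; have /andP[x0 _] := xx.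
  have [hs ht hst] := in01 x x1.
  have us := P1 _ (sub_le x s x0 ltac:(by rewrite s0) xM).
  have ut := P1 _ (sub_le x t x0 ltac:(by rewrite t0) xM).
  have h1 := qP _ _ us ut; rewrite mul1r -/(v x) in h1.
  have h2 := u_le hs; have h3 := u_le ht.
  have h4 : `|v x| <= `|v x - (u (s * x) + u (t * x))| + (`|u (s * x)| + `|u (t * x)|).
    rewrite -{1}(subrK (u (s * x) + u (t * x)) (v x)) (le_trans (ler_normD _ _)) //.
    by rewrite lerD2l ler_normD.
  have vK : `|v x| <= K2 * x.
    have := mulr_ge0 (ltW K1_gt0) x0; rewrite /K2 /M; lra.
  split=> //; first by rewrite (le_trans vK) // mulrC.
  have x2 : 0 <= x / 2 <= 1 by have /andP[] := x1; move=> *; apply/andP; split; lra.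
  have [hs2 ht2 _] := in01 _ x2.
  have [us2 _ _] := uP hs2; have [ut2 _ _] := uP ht2.
  have [_ _ dst] := dom us2 ut2.
  rewrite /v /m /= chart_mapK //; congr (c _).
  rewrite -[e (u (s * x))]/(g (s * x)) -[e (u (t * x))]/(g (t * x)).
  rewrite (gD2 hs) (gD2 ht) -!mulrA -[e (u (s * _))]/(g (s * (x / 2))) -[e (u (t * _))]/(g (t * (x / 2))).
  have := g_comm hs2 ht2; move: (g (s * (x / 2))) (g (t * (x / 2))) => a b ab.
  by rewrite -!mulgA (mulgA b a) -ab -!mulgA.
have wP x : 0 <= x <= d2 -> [/\ `|w x| <= r, `|w x| <= K2 * x & w x = m (w (x / 2), w (x / 2))].
  move=> /[dup] xx /d2P[x1 xM xr]; have /andP[x0 _] := xx.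
  have [hs ht hst] := in01 x x1.
  have [h1 _ h2] := uP hst; split=> //; last by rewrite /w [LHS]h2 mulrA.
  have := u_le hst; rewrite -/(w x).
  have := mulr_ge0 (ltW K1_gt0) x0; have := mulr_ge0 (ltW K1_gt0) (mulr_ge0 (addr_ge0 s0 t0) x0).
  by rewrite /K2 /M; lra.
have [ep ep0|d4 d40 vw] := doubling_unique (sq := fun x : E => m (x, x)) C0 sqP d20 K20 vP wP.
  have ep1 : 0 < ep / (2 * (K1 * M)) by rewrite divr_gt0 // !mulr_gt0.
  have [q1 q10 q1P] := mul_chart_near_add hG Ac c_dom1 c1 ep1.
  have [d5 d50 [d5d P5]] := u_cvg (nearq q1 q10).
  pose Q := 3 * K * M ^+ 2 + 1.
  have Q0 : 0 < Q by rewrite ltr_wpDl // mulr_ge0 ?sqr_ge0 // mulr_ge0 // ltW.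
  exists (Num.min d2 (Num.min (d5 / M) (ep / (2 * Q)))).
    by rewrite lt_min d20 lt_min !divr_gt0 // mulr_gt0.
  move=> x /andP[x0]; rewrite le_min => /andP[xd2]; rewrite le_min => /andP[xd5 xe].
  rewrite ler_pdivlMr // in xd5.
  have [x1 xM xr] := d2P x ltac:(by rewrite x0).
  have [hs ht hst] := in01 x x1.
  have sub5 y : 0 <= y <= M -> 0 <= y * x <= d5.
    move=> /andP[y0 yM]; rewrite mulr_ge0 //= (le_trans _ xd5) // mulrC.
    by rewrite ler_wpM2l.
  have us := P5 _ (sub5 s ltac:(by rewrite s0)).
  have ut := P5 _ (sub5 t ltac:(by rewrite t0)).
  have h1 := q1P _ _ us ut; rewrite -/(v x) in h1.
  have [_ hs1 _] := uP hs; have [_ ht1 _] := uP ht; have [_ hst1 _] := uP hst.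
  have split4 : v x - w x = (v x - (u (s * x) + u (t * x))) + ((u (s * x) - (s * x) *: z) +
      (u (t * x) - (t * x) *: z) - (w x - ((s + t) * x) *: z)).
    by move: (v x) (w x) (u (s * x)) (u (t * x)) => a1 a2 a3 a4; apply/rowP => i; rewrite !mxE; ring.
  have h2 := ler_normD (v x - (u (s * x) + u (t * x))) ((u (s * x) - (s * x) *: z) +
      (u (t * x) - (t * x) *: z) - (w x - ((s + t) * x) *: z)).
  have h3 := ler_normB ((u (s * x) - (s * x) *: z) + (u (t * x) - (t * x) *: z)) (w x - ((s + t) * x) *: z).
  have h4 := ler_normD (u (s * x) - (s * x) *: z) (u (t * x) - (t * x) *: z).
  have sq_le y : 0 <= y <= M -> K * (y * x) ^+ 2 <= K * M ^+ 2 * (x * x).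
    move=> /andP[y0 yM]; rewrite exprMn mulrA ler_wpM2r ?mulr_ge0 // ler_pM2l //.
    by rewrite lerXn2r // nnegrE ?(ltW M0).
  have k1 := sq_le s ltac:(by rewrite s0); have k2 := sq_le t ltac:(by rewrite t0).
  have k3 := sq_le (s + t) ltac:(by rewrite addr_ge0 //= /M; lra).
  have xQ : x * Q <= ep / 2.
    have := ler_wpM2r (ltW Q0) xe.
    by have -> : ep / (2 * Q) * Q = ep / 2 by field; rewrite gt_eqF.
  have xxQ : x * (x * Q) <= x * (ep / 2) by rewrite ler_wpM2l.
  have xx0 : 0 <= x * x by rewrite mulr_ge0.
  have l1 : ep / (2 * (K1 * M)) * (`|u (s * x)| + `|u (t * x)|) <= ep / (2 * (K1 * M)) * (K1 * M * x).
    rewrite ler_pM2l //; have := u_le hs; have := u_le ht.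
    by have := mulr_ge0 (ltW K1_gt0) x0; rewrite /M; lra.
  have l2 : ep / (2 * (K1 * M)) * (K1 * M * x) = ep / 2 * x by field; rewrite !gt_eqF.
  rewrite -split4 in h2; rewrite /Q in xxQ; rewrite -/(w x) in hst1; lra.
(* A dyadic scale at which the two curves agree; the powers of order [2 ^ j] of the commuting
   factors bring the identity back to scale 1. *)
have [j jP] : exists j : nat, 1 / 2 ^+ j <= Num.min d4 d2.
  have q2 : 0 < Num.min d4 d2 by rewrite lt_min d40.
  have [j jP] : exists j : nat, 1 / Num.min d4 d2 < j%:R.
    by exists (Num.bound (1 / Num.min d4 d2)); apply: archi_boundP; rewrite divr_ge0 // ltW.
  exists j; rewrite ler_pdivrMr ?exprn_gt0 // mulrC -ler_pdivrMr //.
  rewrite (le_trans (ltW jP)) // -natrX ler_nat; exact: ltnW (ltn_expl _ _).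
rewrite mul1r le_min in jP; have /andP[j4 j2] := jP.
set x : R := (2 ^+ j)^-1 in j4 j2.
have x0 : 0 <= x by rewrite invr_ge0 exprn_ge0.
have [x1 xM xr] := d2P x ltac:(by rewrite x0).
have [hs ht hst] := in01 x x1.
have [us _ _] := uP hs; have [ut _ _] := uP ht.
have [_ _ dst] := dom us ut.
have gx : g ((s + t) * x) = (g (s * x) * g (t * x))%g.
  have := congr1 e (vw x ltac:(by rewrite x0)).
  by rewrite /v /m /= chart_mapK // => <-.
have sd : 0 <= s <= d by rewrite s0; lra.
have td : 0 <= t <= d by rewrite t0; lra.
have std' : 0 <= s + t <= d by rewrite addr_ge0.
rewrite (g_pow j sd) (g_pow j td) (g_pow j std') -/x gx.
by rewrite expgMn //; exact: g_comm.
Qed.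

Let u_im t : 0 <= t <= d -> chart_im c (u t).
Proof. by move=> tt; have [h _ _] := uP tt; have [] := dom h h. Qed.

Lemma one_parameter_of_solution : exists f : R -> G, one_parameter_subgroup c z f.
Proof.
have [f [fD fg]] := extend_local_semigroup d0 g_add.
have f0 : f 0 = 1%g.
  by have := (fg 0 ltac:(by rewrite lexx ltW)).1; rewrite /g u0 e0.
exists f; split=> //.
  have cv0 : f t @[t --> (0 : R)] --> (1%g : G).
    move=> P nP.
    have n1 : \forall x \near (0 : E), P (e x) := chart_inv_cvg0 c_dom1 c1 nP.
    have n2 : \forall x \near (0 : E), P (e x)^-1%g.
      have cvi : (e x)^-1%g @[x --> (0 : E)] --> (1%g : G).
        rewrite -[X in _ --> X]invg1.
        by apply: (@cvg_invg _ _ (nbhs (0 : E))); exact: chart_inv_cvg0.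
      exact: (cvi _ nP).
    have [d1 d10 [d1d P1]] := u_cvg n1; have [d2 d20 [d2d P2]] := u_cvg n2.
    apply/nbhs_normP; exists (Num.min d1 d2); first by rewrite /= lt_min d10.
    move=> t; rewrite /ball_ /= sub0r normrN lt_min => /andP[t1 t2].
    have [t0|t0] := lerP 0 t.
      rewrite ger0_norm // in t1; rewrite (fg t _).1; last by rewrite t0 (le_trans (ltW t1)).
      by apply: P1; rewrite t0 ltW.
    rewrite ltr0_norm // in t2; have t0' : 0 <= - t by rewrite oppr_ge0 ltW.
    rewrite -[t]opprK (fg (- t) _).2; last by rewrite t0' (le_trans (ltW t2)).
    by apply: P2; rewrite t0' ltW.
  move=> t; have -> : f = (fun x => f t * f (x - t))%g.
    by apply/funext => x; rewrite -fD addrC subrK.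
  rewrite /continuous_at subrr f0.
  apply: (@cvg_mulg _ _ (nbhs t) _ (fun=> f t)); first exact: cvg_cst.
  apply: (@cvg_comp _ _ _ (fun x => x - t) f (nbhs t) (nbhs (0 : R))); last exact: cv0.
  by rewrite -(subrr t); apply: cvgB; [exact: cvg_id|exact: cvg_cst].
apply: is_derive_of_eps => ep ep0; rewrite /= f0 c1.
have ep1 : 0 < ep / (2 * K1) by rewrite divr_gt0 // mulr_gt0.
have [d1 d10 [d1d P1]] := u_cvg (inv_chart_near hG Ac c_dom1 c1 ep1).
apply/nbhs_normP; exists (Num.min d1 (ep / (2 * K))).
  by rewrite /= lt_min d10 divr_gt0 // mulr_gt0.
move=> t; rewrite /ball_ /= sub0r normrN lt_min => /andP[t1 t2]; rewrite !subr0.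
have quad x : 0 <= x -> x < ep / (2 * K) -> K * x ^+ 2 <= ep / 2 * x.
  move=> x0 /ltW xe; rewrite expr2 mulrA ler_wpM2r //.
  have := ler_wpM2l (ltW K0) xe.
  by have -> : K * (ep / (2 * K)) = ep / 2 by field; rewrite gt_eqF.
have [t0|t0] := lerP 0 t.
  rewrite ger0_norm // in t1 t2 *.
  have tt : 0 <= t <= d by rewrite t0 (le_trans (ltW t1)).
  rewrite (fg t tt).1 /g chart_invK; last exact: u_im.
  have [_ h _] := uP tt; have := quad t t0 t2.
  have := mulr_ge0 (ltW ep0) t0; lra.
rewrite ltr0_norm // in t1 t2 *; set x := - t in t1 t2 *.
have x0 : 0 <= x by rewrite oppr_ge0 ltW.
have xx : 0 <= x <= d by rewrite x0 (le_trans (ltW t1)).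
have -> : t = - x by rewrite opprK.
rewrite (fg x xx).2 /g -/(inv_chart c (u x)).
have [_ _ h1] := P1 x ltac:(by rewrite x0 ltW).
have [_ h _] := uP xx; have h2 := quad x x0 t2.
have -> : inv_chart c (u x) - - x *: z = (inv_chart c (u x) + u x) - (u x - x *: z).
  by rewrite scaleNr opprK opprB addrA -addrA -[in RHS]addrA [u x + _]addrC subrK.
have h3 := ler_normB (inv_chart c (u x) + u x) (u x - x *: z).
have h4 : ep / (2 * K1) * `|u x| <= ep / (2 * K1) * (K1 * x) by rewrite ler_pM2l // u_le.
have h5 : ep / (2 * K1) * (K1 * x) = ep / 2 * x by field; rewrite gt_eqF.
lra.
Qed.

End Existence.

Lemma one_parameter_exists z : exists f : R -> G, one_parameter_subgroup c z f.
Proof.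
have [r [C [r0 C0 dom sqP]]] := sq_chart_estimate hG Ac c_dom1 c1.
have sq0 : m (0, 0) = 0 by rewrite /m /= e0 mulg1 c1.
have [d [K [d0 K0 [u uP]]]] := halving_solution_exists (sq := fun x : E => m (x, x)) r0 C0 sq0 sqP z.
exact: (one_parameter_of_solution r0 C0 d0 K0 dom sqP uP).
Qed.

End OneParameter.

Section BilinearDerivative.
Context (R : realType) (n : nat) (V : normedModType R).
Notation E := 'rV[R]_n.

Lemma is_derive_bilinear (B : E -> E -> V) (a b : R -> E) (t : R) (a' b' : E) :
  (forall x, linear (B x)) -> (forall y, linear (B^~ y)) ->
  is_derive t (1 : R) a a' -> is_derive t (1 : R) b b' ->
  is_derive t (1 : R) (fun t => B (a t) (b t)) (B a' (b t) + B (a t) b').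
Proof.
move=> Br Bl da db; have [k k0 kP] := bilinear_rV_bound Br Bl.
have BBl x y v : B (x - y) v = B x v - B y v.
  have := Bl v (-1) y x; rewrite /= !scaleN1r (addrC (- y)) (addrC (- B y v)); exact.
have BBr x y v : B v (x - y) = B v x - B v y.
  have := Br v (-1) y x; rewrite /= !scaleN1r (addrC (- y)) (addrC (- B v y)); exact.
have B0l v : B 0 v = 0 by have := BBl 0 0 v; rewrite !subrr.
have B0r v : B v 0 = 0 by have := BBr 0 0 v; rewrite !subrr.
have BZl c x v : B (c *: x) v = c *: B x v by have := Bl v c x 0; rewrite /= B0l !addr0.
have BZr c x v : B v (c *: x) = c *: B v x by have := Br v c x 0; rewrite /= B0r !addr0.
apply: is_derive_of_eps => ep ep0.
pose Ka := `|a'| + 1; pose Kb := `|b'| + 1.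
have Ka0 : 0 < Ka by rewrite ltr_wpDl.
have Kb0 : 0 < Kb by rewrite ltr_wpDl.
pose S := k * (`|a t| + `|b t| + 1); have S0 : 0 < S by rewrite mulr_gt0 // ltr_wpDl // addr_ge0.
have e1 : 0 < Num.min 1 (ep / (3 * S)) by rewrite lt_min ltr01 divr_gt0 // mulr_gt0.
have h1 := is_derive_eps da e1; have h2 := is_derive_eps db e1.
have q0 : 0 < ep / (3 * (k * Ka * Kb)) by rewrite divr_gt0 // !mulr_gt0.
have h3 : \forall x \near t, `|x - t| <= ep / (3 * (k * Ka * Kb)).
  apply/nbhs_normP; exists (ep / (3 * (k * Ka * Kb))) => // x.
  by rewrite /ball_ /= distrC; exact: ltW.
apply: filterS3 h1 h2 h3 => x; set h := x - t; set e' := Num.min _ _.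
set Da := a x - a t; set Db := b x - b t => ha hb hh.
have e'1 : e' <= 1 by rewrite ge_min lexx.
have e'S : e' * S <= ep / 3.
  have : e' * S <= ep / (3 * S) * S by rewrite ler_wpM2r ?(ltW S0) // ge_min lexx orbT.
  by have -> : ep / (3 * S) * S = ep / 3 by field; rewrite gt_eqF.
have lip (D d : E) : `|D - h *: d| <= e' * `|h| -> `|D| <= (`|d| + 1) * `|h|.
  move=> hD; rewrite -(subrK (h *: d) D) (le_trans (ler_normD _ _)) // normrZ.
  by have := ler_wpM2r (normr_ge0 h) e'1; lra.
have DaK := lip _ _ ha; have DbK := lip _ _ hb.
have -> : B (a x) (b x) - B (a t) (b t) - h *: (B a' (b t) + B (a t) b') =
  B (Da - h *: a') (b t) + B (a t) (Db - h *: b') + B Da Db.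
  have BDl u v w : B (u + v) w = B u w + B v w by have := Bl w 1 u v; rewrite /= !scale1r.
  have BDr u v w : B w (u + v) = B w u + B w v by have := Br w 1 u v; rewrite /= !scale1r.
  have -> : B (a x) (b x) = B (a t) (b t) + (B (a t) Db + (B Da (b t) + B Da Db)).
    have -> : a x = a t + Da by rewrite addrC subrK.
    by have -> : b x = b t + Db; [rewrite addrC subrK|rewrite BDl !BDr !addrA].
  rewrite [_ + (_ + (_ + _))]addrC addrK scalerDr -BZl -BZr (BBl Da (h *: a') (b t)) (BBr Db (h *: b') (a t)).
  by rewrite [in RHS]addrACA -[in RHS]opprD [RHS]addrAC addrA [B (a t) Db + _]addrC.
rewrite (le_trans (ler_normD _ _)) //.
have n1 := kP (Da - h *: a') (b t); have n2 := kP (a t) (Db - h *: b'); have n3 := kP Da Db.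
have n4 := ler_normD (B (Da - h *: a') (b t)) (B (a t) (Db - h *: b')).
have m1 : k * `|Da - h *: a'| * `|b t| <= k * (e' * `|h|) * `|b t| by rewrite ler_wpM2r // ler_pM2l.
have m2 : k * `|a t| * `|Db - h *: b'| <= k * `|a t| * (e' * `|h|).
  by rewrite ler_wpM2l // mulr_ge0 // ltW.
have m3 : k * `|Da| * `|Db| <= k * (Ka * `|h|) * (Kb * `|h|).
  by rewrite ler_pM ?mulr_ge0 // ?(ltW k0) // ler_pM2l.
have e'0 := ltW e1.
have m4 : e' * S * `|h| <= ep / 3 * `|h| by rewrite ler_wpM2r.
have m5 : k * Ka * Kb * `|h| <= ep / 3.
  have := ler_wpM2l (ltW (mulr_gt0 (mulr_gt0 k0 Ka0) Kb0)) hh.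
  by have -> : k * Ka * Kb * (ep / (3 * (k * Ka * Kb))) = ep / 3 by field; rewrite !gt_eqF.
have m6 : k * Ka * Kb * `|h| * `|h| <= ep / 3 * `|h| by rewrite ler_wpM2r.
have : 0 <= k * e' * `|h| by rewrite !mulr_ge0 // ltW.
have := mulr_ge0 (ltW ep0) (normr_ge0 h).
rewrite /S in m4; lra.
Qed.

Lemma is_derive_linear (f : E -> V) (a : R -> E) (t : R) (a' : E) : linear f ->
  is_derive t (1 : R) a a' -> is_derive t (1 : R) (fun t => f (a t)) (f a').
Proof.
move=> lf da; pose g : {linear E -> V} := HB.pack f (GRing.isLinear.Build _ _ _ _ f lf).
have [k k0 kP] := linear_rV_bound lf.
apply: is_derive_of_eps => ep ep0; have e1 : 0 < ep / k by rewrite divr_gt0.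
apply: filterS (is_derive_eps da e1) => x h1.
rewrite -[f]/(g : E -> V) -[_ *: g _]linearZ -!linearB /= (le_trans (kP _)) // (le_trans (ler_wpM2l (ltW k0) h1)) //.
by rewrite mulrA mulrCA divff ?mulr1 // gt_eqF.
Qed.

End BilinearDerivative.

(** * The adjoint action along one-parameter subgroups and on [Kg] *)

Section AdjointAction.
Context (R : realType) (n : nat).
Notation E := 'rV[R]_n.
Context (br : {bilinear E -> E -> E}) (hbr : lie_bracket br).
Context (G : topGroupType) (A : set (chart G E)) (hG : lie_group A).
Context (c : chart G E) (hc : lie_algebra_of A c br).

Local Notation e := (chart_inv c).

Let Ac : A c. Proof. by case: hc. Qed.
Let c_dom1 : chart_dom c 1%g. Proof. by case: hc. Qed.
Let c1 : c 1%g = 0. Proof. by case: hc. Qed.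

Lemma one_parameter0 z f : one_parameter_subgroup c z f -> f 0 = 1%g.
Proof.
by move=> [fD _ _]; apply: (mulgI (f 0)); rewrite -fD mulg1 addr0.
Qed.

(** Multiplicativity of [Ad] and [f] reduces the claim to time zero, where the differential of [Ad]
    is the bracket. *)
Lemma is_derive_Ad z f x t : one_parameter_subgroup c z f ->
  is_derive t (1 : R) (fun t => Ad c (f t) x) (br z (Ad c (f t) x)).
Proof.
move=> fz; have [fD fc fd] := fz; have f0 := one_parameter0 fz.
set w := Ad c (f t) x.
apply: is_derive_of_eps => ep ep0.
have [k k0 kP] : exists2 k : R, 0 < k & forall x y, `|br x y| <= k * `|x| * `|y|.
  by apply: bilinear_rV_bound => [u|u] a u1 u2; [exact: linearPr|exact: linearPl].
pose S1 := `|z| + 1; pose S2 := k * (`|w| + 1).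
have S10 : 0 < S1 by rewrite ltr_wpDl.
have S20 : 0 < S2 by rewrite mulr_gt0 // ltr_wpDl.
have e1 : 0 < ep / (2 * S1) by rewrite divr_gt0 // mulr_gt0.
have e2 : 0 < Num.min 1 (ep / (2 * S2)) by rewrite lt_min ltr01 divr_gt0 // mulr_gt0.
have n1 := Ad_differentiable_br hG hc w e1.
have cc : c g @[g --> (1%g : G)] --> (0 : E) by rewrite -[X in _ --> X]c1; exact: chart_map_continuous.
have cf : f h @[h --> (0 : R)] --> (1%g : G) by rewrite -f0; exact: fc.
have n2 : \forall h \near (0 : R), `|Ad c (e (c (f h))) w - w - br (c (f h)) w| <= ep / (2 * S1) * `|c (f h)|.
  by have := cc _ n1; exact: cf.
have n3 : \forall h \near (0 : R), chart_dom c (f h) by have := chart_dom_near c_dom1; exact: cf.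
have n4 := is_derive_eps fd e2.
have : \forall h \near (0 : R), `|Ad c (f h) w - w - h *: br z w| <= ep * `|h|.
  apply: filterS3 n2 n3 n4 => h; rewrite /= f0 c1 !subr0.
  set v := c (f h); set e' := Num.min _ _ => h1 dh h2.
  rewrite /v chart_mapK // -/v in h1.
  have e'1 : e' <= 1 by rewrite ge_min lexx.
  have e'S : e' * S2 <= ep / 2.
    have : e' * S2 <= ep / (2 * S2) * S2 by rewrite ler_wpM2r ?(ltW S20) // ge_min lexx orbT.
    by have -> : ep / (2 * S2) * S2 = ep / 2 by field; rewrite gt_eqF.
  have vle : `|v| <= S1 * `|h|.
    rewrite -(subrK (h *: z) v) (le_trans (ler_normD _ _)) // normrZ.
    by have := ler_wpM2r (normr_ge0 h) e'1; rewrite /S1; lra.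
  have -> : Ad c (f h) w - w - h *: br z w = (Ad c (f h) w - w - br v w) + br (v - h *: z) w.
    by rewrite linearBl /= linearZl_LR /= [in RHS]addrA subrK.
  rewrite (le_trans (ler_normD _ _)) //.
  have h3 := kP (v - h *: z) w.
  have h4 : k * `|v - h *: z| * `|w| <= k * (e' * `|h|) * `|w| by rewrite ler_wpM2r // ler_pM2l.
  have h5 : ep / (2 * S1) * `|v| <= ep / (2 * S1) * (S1 * `|h|) by rewrite ler_pM2l.
  have h6 : ep / (2 * S1) * (S1 * `|h|) = ep / 2 * `|h| by field; rewrite gt_eqF.
  have h7 : e' * S2 * `|h| <= ep / 2 * `|h| by rewrite ler_wpM2r.
  have : 0 <= k * e' * `|h| by rewrite !mulr_ge0 // ltW.
  rewrite /S2 in h7; lra.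
rewrite (near_shift t 0) sub0r; apply: filterS => x' /=; rewrite -/(x' - t).
have -> : Ad c (f x') x = Ad c (f (x' - t)) w.
  by rewrite /w -(AdM hG Ac c_dom1 c1) -fD subrK.
by [].
Qed.

(** At the neutral element by [Ad_near_id], elsewhere by translation. *)
Lemma continuous_Ad x : continuous (fun g : G => Ad c g x).
Proof.
have cv1 y : Ad c g y @[g --> (1%g : G)] --> y.
  have [C C0 n1] := Ad_near_id hG Ac c_dom1 c1.
  have cc : c g @[g --> (1%g : G)] --> (0 : E) by rewrite -[X in _ --> X]c1; exact: chart_map_continuous.
  apply/(@cvgrPdist_le _ _ _ (nbhs (1%g : G)) (nbhs_filter _)) => ep ep0.
  have q0 : 0 < ep / (C * (`|y| + 1)) by rewrite divr_gt0 // mulr_gt0 // ltr_wpDl.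
  have n2 : \forall u \near (0 : E), `|u| <= ep / (C * (`|y| + 1)).
    apply/nbhs_normP; exists (ep / (C * (`|y| + 1))) => // u; rewrite /ball_ /= sub0r normrN.
    exact: ltW.
  have m1 : \forall g \near (1%g : G), forall y, `|Ad c (chart_inv c (c g)) y - y| <= C * `|c g| * `|y| := cc _ n1.
  have m2 : \forall g \near (1%g : G), `|c g| <= ep / (C * (`|y| + 1)) := cc _ n2.
  have m3 : \forall g \near (1%g : G), chart_dom c g := chart_dom_near c_dom1.
  apply: filterS3 m1 m2 m3 => g h1 h2 dg.
  have := h1 y; rewrite chart_mapK // distrC => /le_trans; apply.
  have := ler_wpM2r (ltW (mulr_gt0 C0 (ltr_wpDl (normr_ge0 y) ltr01))) h2.
  have -> : ep / (C * (`|y| + 1)) * (C * (`|y| + 1)) = ep.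
    by field; rewrite (gt_eqF C0) gt_eqF // ltr_wpDl.
  have := mulr_ge0 (ltW C0) (normr_ge0 (c g)); lra.
move=> g0.
have -> : (fun g => Ad c g x) = (fun g => Ad c g0 (Ad c (g0^-1 * g)%g x)).
  by apply/funext => g; rewrite -(AdM hG Ac c_dom1 c1) mulgA mulgV mul1g.
have cvg0 : (g0^-1 * g)%g @[g --> g0] --> (1%g : G).
  rewrite -[X in _ --> X](mulVg g0).
  by apply: (@cvg_mulg _ _ (nbhs g0) _ (fun=> g0^-1%g)); [exact: cvg_cst|exact: cvg_id].
rewrite /continuous_at mulVg (Ad1 hG Ac c_dom1 c1).
apply: (@cvg_comp _ _ _ (fun g => Ad c (g0^-1 * g)%g x) (Ad c g0) _ (nbhs x)).
  by move=> Q Qx; have Q1 : \forall g \near (1%g : G), Q (Ad c g x) := cv1 x Q Qx; exact: (cvg0 _ Q1).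
by apply: linear_rV_continuous; exact: (Ad_linear hG Ac c_dom1 c1).
Qed.

Section Invariance.
Context (s : {linear E -> E}) (hs : involutive_automorphism br s).
Context (ip : {biscalar E}) (hip : invariant_inner_product br s ip).
Context (Kg : set G) (hKg : Kg = analytic_subgroup c (fixed_part s)).

Let ip_sym x y : ip x y = ip y x. Proof. by case: hip. Qed.
Let ip_pos x : x != 0 -> 0 < ip x x. Proof. by case: hip => _ + _ _; exact. Qed.

Lemma Kg_subgroup : is_subgroup Kg.
Proof.
rewrite hKg; split.
- by move=> H [[]].
- by move=> g h Hg Hh H HH; have [[_ M _] _] := HH; apply: M; [exact: Hg|exact: Hh].
- by move=> g Hg H HH; have [[_ _ V] _] := HH; apply: V; exact: Hg.
Qed.

Lemma Kg_ind (P : G -> Prop) : is_subgroup P ->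
  (forall z f, s z = z -> one_parameter_subgroup c z f -> P (f 1)) ->
  forall g, Kg g -> P g.
Proof.
move=> HP gen g; rewrite hKg; apply; split=> // _ [z [f [zk fz ->]]].
exact: gen fz.
Qed.

(** The generators of [Kg] are values at time 1; the value at time [t] is one of them after
    reparametrisation, for the direction [t *: z]. *)
Lemma one_parameter_Kg z f t : s z = z -> one_parameter_subgroup c z f -> Kg (f t).
Proof.
move=> zk fz; have [fD fc fd] := fz; have f0 := one_parameter0 fz.
rewrite hKg => H [_]; apply.
exists (t *: z), (fun x => f (t * x)); split; last by rewrite mulr1.
  by rewrite /fixed_part /= linearZ zk.
split.
- by move=> x y; rewrite mulrDr fD.
- by move=> x; apply: (@continuous_comp _ _ _ (fun x => t * x) f); [exact: mulrl_continuous|exact: fc].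
apply: is_derive_of_eps => ep ep0; rewrite /= mulr0 f0 c1.
have e1 : 0 < ep / (`|t| + 1) by rewrite divr_gt0 // ltr_wpDl.
have n1 := is_derive_eps fd e1.
have cv : t * x @[x --> (0 : R)] --> (0 : R).
  by rewrite -[X in _ --> X](mulr0 t); exact: mulrl_continuous.
have n2 : \forall x \near (0 : R), `|(c \o f) (t * x) - (c \o f) 0 - (t * x - 0) *: z| <=
    ep / (`|t| + 1) * `|t * x - 0| := cv _ n1.
apply: filterS n2 => x /=; rewrite f0 c1 !subr0 scalerA (mulrC x) => /le_trans; apply.
rewrite normrM mulrA ler_wpM2r // mulrAC ler_pdivrMr ?ltr_wpDl // ler_pM2l // lerDl.
by [].
Qed.

(* [ad z] is skew for [ip]. *)
Lemma ip_constant z (chi : R -> E) : s z = z ->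
  (forall t, is_derive t (1 : R) chi (br z (chi t))) ->
  forall t, ip (chi t) (chi t) = ip (chi 0) (chi 0).
Proof.
move=> zk dchi.
have dip t : is_derive t (1 : R) (fun t => ip (chi t) (chi t) : R) 0.
  have := @is_derive_bilinear R n R^o (fun x y => ip x y) chi chi t _ _ _ _ (dchi t) (dchi t).
  rewrite (ip_sym (chi t)); case: hip => _ _ _ skew; rewrite {1}skew // (ip_sym (chi t)).
  rewrite addNr; apply.
    by move=> x a u v; rewrite linearPr.
  by move=> y a u v; rewrite /= linearPl.
move=> t; apply: (@is_derive_0_is_cst R (fun t => ip (chi t) (chi t) : R)).
Qed.

(** All three properties define a subgroup, so exponentials suffice. For the last two, the
    difference [chi] of the two sides solves [chi' = [z, chi]] with [chi 0 = 0]; as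
    [ip (chi t) (chi t)] is constant, [chi] vanishes. *)
Lemma Ad_Kg g : Kg g -> [/\ forall x, ip (Ad c g x) (Ad c g x) = ip x x,
  forall x, s (Ad c g x) = Ad c g (s x) &
  forall x y, Ad c g (br x y) = br (Ad c g x) (Ad c g y)].
Proof.
move: g; apply: Kg_ind.
  have K := AdK_inv hG Ac c_dom1 c1; have M := AdM hG Ac c_dom1 c1.
  have VK := Ad_invK hG Ac c_dom1 c1.
  split.
  - by split=> *; rewrite !(Ad1 hG Ac c_dom1 c1).
  - move=> g h [g1 g2 g3] [h1 h2 h3]; split=> [x|x|x y]; rewrite !M.
    + by rewrite g1 h1.
    + by rewrite g2 h2.
    + by rewrite h3 g3.
  - move=> g [g1 g2 g3]; split=> [x|x|x y].
    + by rewrite -g1 (K g x).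
    + have e1 : Ad c g (s (Ad c g^-1%g x)) = s x by rewrite -g2 (K g x).
      by rewrite -e1; apply: esym; exact: VK.
    + have e1 : br x y = Ad c g (br (Ad c g^-1%g x) (Ad c g^-1%g y)) by apply: esym; apply: etrans (g3 _ _) _; exact: (f_equal2 (fun u v => br u v) (K g x) (K g y)).
      by apply: etrans (congr1 _ e1) _; exact: VK.
move=> z f zk fz; have f0 := one_parameter0 fz.
have d x t := is_derive_Ad x t fz.
have A0 x : Ad c (f 0) x = x by rewrite f0 (Ad1 hG Ac c_dom1 c1).
split=> [x|x|x y].
- by have := ip_constant zk (d x) 1; rewrite A0.
- apply/eqP; rewrite -subr_eq0; apply/eqP/(ip_eq0 ip_pos).
  set chi := (fun t => s (Ad c (f t) x) - Ad c (f t) (s x)).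
  have dl t : is_derive t (1 : R) chi (br z (chi t)).
    rewrite /chi linearBr /=; apply: is_deriveB.
    by rewrite -{1}zk -hs.2; apply: is_derive_linear => //; exact: linearP.
  by have := ip_constant zk dl 1; rewrite {3 4}/chi !A0 subrr linear0r.
- apply/eqP; rewrite -subr_eq0; apply/eqP/(ip_eq0 ip_pos).
  set chi := (fun t => Ad c (f t) (br x y) - br (Ad c (f t) x) (Ad c (f t) y)).
  have dl t : is_derive t (1 : R) chi (br z (chi t)).
    rewrite /chi linearBr /=; apply: is_deriveB.
    rewrite (br_jacobi hbr).
    apply: is_derive_bilinear => u.
      by move=> k u1 u2; exact: linearPr.
    by move=> k u1 u2; exact: linearPl.
  by have := ip_constant zk dl 1; rewrite {3 4}/chi !A0 subrr linear0r.
Qed.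

Lemma Ad_ip g x y : Kg g -> ip (Ad c g x) (Ad c g y) = ip x y.
Proof.
move=> /Ad_Kg[iso _ _].
have polar u v : 2 * ip u v = ip (u + v) (u + v) - ip u u - ip v v.
  by rewrite linearDl /= !linearDr /= (ip_sym v u); ring.
have two0 : (2 : R) != 0 by rewrite pnatr_eq0.
apply: (mulfI two0); rewrite (polar x y) (polar (Ad c g x) (Ad c g y)).
have -> : Ad c g x + Ad c g y = Ad c g (x + y) by apply: esym; exact: (AdD hG Ac c_dom1 c1).
by congr (_ - _ - _); exact: iso.
Qed.

Lemma Ad_fixed g z : Kg g -> s z = z -> s (Ad c g z) = Ad c g z.
Proof. by move=> /Ad_Kg[_ sA _] sz; apply: etrans (sA z) _; exact: congr1. Qed.

Lemma Ad_anti g z : Kg g -> s z = - z -> s (Ad c g z) = - Ad c g z.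
Proof.
move=> /Ad_Kg[_ sA _] sz; apply: etrans (sA z) _; apply: etrans (congr1 _ sz) _.
by rewrite -(scaleN1r z) -(scaleN1r (Ad c g z)); exact: (AdZ hG Ac c_dom1 c1).
Qed.

End Invariance.
End AdjointAction.

(** * Real functions and measurable selections *)

(** If [m > 0], the derivative [g] is positive just to the right of 0, and the mean value theorem
    produces a value of [f] above [f 0]. *)
Lemma second_order_max (R : realType) (f g : R -> R) (m : R) :
  (forall t, is_derive t (1 : R) f (g t)) -> is_derive (0 : R) (1 : R) g m ->
  (forall t, f t <= f 0) -> g 0 = 0 /\ m <= 0.
Proof.
move=> df dg fmax.
have g0 : g 0 = 0.
  have := @derive1_at_max R f (-1) 1 0 _ _ _ _.
  have i0 : (0 : R) \in `](-1)%R, 1%R[ by rewrite in_itv /= oppr_lt0 !ltr01.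
  have i1 : (-1 : R) <= 1 by rewrite -subr_ge0 opprK addr_ge0.
  move=> /(_ i1 (fun t _ => @ex_derive _ _ _ _ _ _ _ (df t)) i0 (fun t _ => fmax t)) d0.
  by have [_ <-] := df 0; have [_ ->] := d0.
split => //; rewrite leNgt; apply/negP => m0.
have m20 : 0 < m / 2 by rewrite divr_gt0.
have [d /= d0 near] := (@nbhs_normP _ _ _ _).1 (is_derive_eps dg m20).
have gpos x : 0 < x -> x < d -> 0 < g x.
  move=> x0 xd; have := near x; rewrite /ball_ /= sub0r normrN gtr0_norm // => /(_ xd).
  rewrite g0 !subr0 -[_ *: _]/(_ * _) (gtr0_norm x0) ler_norml => /andP[h _].
  have := mulr_gt0 m20 x0; lra.
have d20 : 0 < d / 2 by rewrite divr_gt0.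
have [|x xi xE] := MVT d20 (fun x _ => df x).
  by apply: derivable_within_continuous => x _; exact: (@ex_derive _ _ _ _ _ _ _ (df x)).
move: xi; rewrite in_itv /= => /andP[x0 xd].
have h1 : 0 < g x by apply: gpos => //; lra.
have := fmax (d / 2); rewrite -subr_le0 xE subr0 leNgt mulr_gt0 //.
Qed.

(** Two points that are strict minima within the same radius [1 / (k + 1)] are at least that far
    apart, so [floor ((k + 1) t)] is injective on them. *)
Lemma countable_strict_min (R : realType) (f : R -> R) :
  countable [set t | exists2 d : R, 0 < d & forall r, 0 < `|r - t| < d -> f t < f r].
Proof.
pose S (k : nat) := [set t | forall r, 0 < `|r - t| < k.+1%:R^-1 -> f t < f r].
have Scount k : countable (S k).
  apply/countable_injP; exists (fun t => choice.pickle (Num.floor (k.+1%:R * t))).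
  move=> t u /set_mem St /set_mem Su /(pcan_inj choice.pickleK) tu.
  have k0 : 0 < k.+1%:R :> R by rewrite ltr0Sn.
  have := real_floor_itv (num_real (k.+1%:R * t)); have := real_floor_itv (num_real (k.+1%:R * u)).
  rewrite tu intrD => /andP[h1 h2] /andP[h3 h4].
  apply/eqP; rewrite -subr_eq0 -normr_eq0; apply: contrapT => /negP tu0.
  have tu1 : `|t - u| < k.+1%:R^-1.
    rewrite -(@ltr_pM2l _ k.+1%:R) // divff ?gt_eqF // -{1}(gtr0_norm k0) -normrM mulrBr ltr_norml.
    by apply/andP; split; lra.
  have tu2 : 0 < `|t - u| by rewrite lt_neqAle eq_sym tu0 normr_ge0.
  have a1 : f u < f t by apply: Su; rewrite tu2.
  have a2 : f t < f u by apply: St; rewrite distrC tu2.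
  by have := lt_trans a1 a2; rewrite ltxx.
apply: (@sub_countable _ _ _ (\bigcup_k S k)); last exact: bigcup_countable.
apply: subset_card_le => t [d d0 td].
have [N _ /(_ N (leqnn N)) hN] := near_infty_natSinv_lt (PosNum d0).
by exists N => // r /andP[r0 rN]; apply: td; rewrite r0 (lt_trans rN).
Qed.

(* Off a countable set, one-sided derivatives [m <= l] of any function agree: a
   rational slope strictly between them turns the point into a strict minimum. *)
Definition corner (R : realType) (f : R -> R) : set R :=
  \bigcup_(q : rat) [set t | exists2 d : R, 0 < d &
    forall r, 0 < `|r - t| < d -> f t - ratr q * t < f r - ratr q * r].

Lemma countable_corner (R : realType) (f : R -> R) : countable (corner f).
Proof. by apply: bigcup_countable => // q _; exact: (countable_strict_min (fun t => f t - ratr q * t)). Qed.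

Lemma not_corner (R : realType) (f : R -> R) (t m l : R) : ~ corner f t ->
  (forall ep : R, 0 < ep -> exists2 d : R, 0 < d & forall h, 0 < h < d ->
     l * h - ep * h <= f (t + h) - f t /\ - (m * h) - ep * h <= f (t - h) - f t) ->
  l <= m.
Proof.
move=> nc ap; rewrite leNgt; apply/negP => ml; apply: nc.
have [q qml] := rat_in_itvoo ml; exists q => //=.
move: qml; rewrite in_itv /= => /andP[mq ql].
have e0 : 0 < Num.min (ratr q - m) (l - ratr q) / 2 by rewrite divr_gt0 // lt_min !subr_gt0 mq.
have e1 : Num.min (ratr q - m) (l - ratr q) <= ratr q - m by rewrite ge_min lexx.
have e2 : Num.min (ratr q - m) (l - ratr q) <= l - ratr q by rewrite ge_min lexx orbT.
have [d d0 dP] := ap _ e0; exists d => // r /andP[r0 rd].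
move: (Num.min _ _) e0 e1 e2 dP => e e0 e1 e2 dP.
have [rt|tr] := ltP r t.
  have h0 : 0 < t - r by rewrite subr_gt0.
  have [|_] := dP (t - r); first by rewrite h0 -(gtr0_norm h0) distrC.
  have -> : t - (t - r) = r by ring.
  move=> hh.
  have := mulr_gt0 e0 h0; have := ler_wpM2r (ltW h0) e1; lra.
have h0 : 0 < r - t by move: r0; rewrite normr_gt0 subr_eq0 subr_gt0 lt_neqAle tr andbT eq_sym.
have [|hh _] := dP (r - t); first by rewrite h0 -{1}(gtr0_norm h0).
move: hh; have -> : t + (r - t) = r by ring.
move=> hh.
have := mulr_gt0 e0 h0; have := ler_wpM2r (ltW h0) e2; lra.
Qed.

(** [D] is the infimum of the difference quotients over [r > 0]; by convexity a quotient close to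
    the infimum bounds all those at smaller [r]. *)
Lemma convex_right_derivative (R : realType) (q : R -> R) (L : R) :
  (forall x y k, 0 <= k <= 1 -> q (k * x + (1 - k) * y) <= k * q x + (1 - k) * q y) ->
  (forall r, 0 <= r -> - (L * r) <= q r - q 0) ->
  exists D : R, (forall r, 0 <= r -> D * r <= q r - q 0) /\
    forall ep : R, 0 < ep -> exists2 d : R, 0 < d &
      forall r, 0 < r < d -> q r - q 0 <= D * r + ep * r.
Proof.
move=> qc qL; pose S := [set (q r - q 0) / r | r in [set r : R | 0 < r]].
have Slb : lbound S (- L).
  by move=> _ [r /= r0 <-]; rewrite ler_pdivlMr // mulNr qL // ltW.
have hS : has_inf S by split; [exists ((q 1 - q 0) / 1), 1 => //=; exact: ltr01|exists (- L)].
exists (inf S); split => [r|ep ep0].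
  rewrite le_eqVlt => /predU1P[<-|r0]; first by rewrite mulr0 subrr.
  rewrite -ler_pdivlMr //; apply: ge_inf; first by case: hS.
  by exists r.
have [_ [r /= r0 <-] rD] := inf_adherent ep0 hS.
exists r => // x /andP[x0 xr].
have k1 : 0 <= x / r <= 1 by rewrite divr_ge0 ?(ltW x0) ?(ltW r0) //= ler_pdivrMr // mul1r ltW.
have := qc r 0 _ k1; rewrite mulr0 addr0 divfK ?gt_eqF // => qx.
have := ler_wpM2r (ltW x0) (ltW rD); have -> : (q r - q 0) / r * x = x / r * q r - x / r * q 0.
  by rewrite mulrBl mulrBl; congr (_ - _); field; rewrite gt_eqF.
lra.
Qed.

(** First-order agreement with the convex [q] gives [f] a right derivative [Dr] and a left
    derivative [-Dl]. The linear minorant of slope [d] yields [-Dl <= d <= Dr], and [Dr <= -Dl]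
    holds away from corners. *)
Lemma is_derive_between (R : realType) (f q : R -> R) (t d L : R) :
  (forall x y k, 0 <= k <= 1 -> q (k * x + (1 - k) * y) <= k * q x + (1 - k) * q y) ->
  (forall r, - (L * `|r|) <= q r - q 0) ->
  ~ corner f t -> f t = q 0 ->
  (forall ep : R, 0 < ep -> \forall x \near t, `|f x - q (x - t)| <= ep * `|x - t|) ->
  (forall ep : R, 0 < ep -> \forall x \near t, (x - t) * d - ep * `|x - t| <= f x - f t) ->
  is_derive t (1 : R) f d.
Proof.
move=> qc qL nc ft fq fd.
have [|Dr [Dr1 Dr2]] := @convex_right_derivative R q L qc.
  by move=> r r0; have := qL r; rewrite ger0_norm.
have [|r r0|Dl [Dl1 Dl2]] := @convex_right_derivative R (fun r => q (- r)) L.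
- move=> x y k k1; have := qc (- x) (- y) k k1; congr (q _ <= _); ring.
- by have := qL (- r); rewrite normrN oppr0 ger0_norm.
have approx ep : 0 < ep -> exists2 e : R, 0 < e & forall h, 0 < h < e ->
   [/\ Dr * h - ep * h <= f (t + h) - f t <= Dr * h + ep * h,
       Dl * h - ep * h <= f (t - h) - f t <= Dl * h + ep * h,
       d * h - ep * h <= f (t + h) - f t & - (d * h) - ep * h <= f (t - h) - f t].
  move=> ep0; have e2 : 0 < ep / 2 by rewrite divr_gt0.
  have [d1 /= d10 P1] := (@nbhs_normP _ _ _ _).1 (fq _ e2).
  have [d2 /= d20 P2] := (@nbhs_normP _ _ _ _).1 (fd _ ep0).
  have [d3 d30 P3] := Dr2 _ e2; have [d4 d40 P4] := Dl2 _ e2.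
  exists (Num.min (Num.min d1 d2) (Num.min d3 d4)); first by rewrite !lt_min d10 d20 d30 d40.
  move=> h /andP[h0]; rewrite !lt_min => /andP[/andP[h1 h2] /andP[h3 h4]].
  have nh : `|h| = h by rewrite gtr0_norm.
  have p1 := P1 (t + h); have p2 := P1 (t - h); have p3 := P2 (t + h); have p4 := P2 (t - h).
  move: p1 p2 p3 p4; rewrite /ball_ /=.
  have -> : t - (t + h) = - h by ring.
  have -> : t - (t - h) = h by ring.
  have -> : t + h - t = h by ring.
  have -> : t - h - t = - h by ring.
  rewrite normrN nh => /(_ h1) p1 /(_ h1) p2 /(_ h2) p3 /(_ h2) p4.
  move: p1 p2; rewrite !ler_norml => /andP[p11 p12] /andP[p21 p22].
  have h00 := ltW h0; have r1 := Dr1 h h00; have r2 := Dl1 h h00.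
  have r3 : q h - q 0 <= Dr * h + ep / 2 * h by apply: P3; rewrite h0.
  have r4 : q (- h) - q (- 0) <= Dl * h + ep / 2 * h by apply: P4; rewrite h0.
  rewrite oppr0 in r2 r4; have eh := mulr_gt0 ep0 h0; rewrite ft in p3 p4 *.
  split; [apply/andP; split|apply/andP; split| |]; lra.
have Drd : d <= Dr.
  rewrite leNgt; apply/negP => ltd; have e0 : 0 < (d - Dr) / 4 by rewrite divr_gt0 // subr_gt0.
  have [e ee eP] := approx _ e0; have e2 : 0 < e / 2 < e by apply/andP; split; lra.
  have [/andP[_ h1] _ h2 _] := eP _ e2.
  have := mulr_gt0 e0 (andP e2).1; lra.
have Dld : - d <= Dl.
  rewrite leNgt; apply/negP => ltd; have e0 : 0 < (- d - Dl) / 4 by rewrite divr_gt0 // subr_gt0.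
  have [e ee eP] := approx _ e0; have e2 : 0 < e / 2 < e by apply/andP; split; lra.
  have [_ /andP[_ h1] _ h2] := eP _ e2.
  have := mulr_gt0 e0 (andP e2).1; lra.
have Drl : Dr <= - Dl.
  apply: (not_corner nc) => ep ep0; have [e e0 eP] := approx _ ep0; exists e => // h he.
  by have [/andP[h1 _] /andP[h2 _] _ _] := eP _ he; split => //; rewrite mulNr opprK.
have DrE : Dr = d by lra.
have DlE : Dl = - d by lra.
apply: is_derive_of_eps => ep ep0; have [e /= e0 eP] := approx _ ep0.
apply/nbhs_normP; exists e => // x; rewrite /ball_ /= -[_ *: _]/(_ * _) distrC.
have [xt|tx|->] := ltgtP x t.
- have h0 : 0 < t - x by rewrite subr_gt0.
  rewrite distrC (gtr0_norm h0) => xe; have [|_] := eP (t - x); first by rewrite h0.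
  have -> : t - (t - x) = x by ring.
  rewrite DlE => /andP[h1 h2] _ _; rewrite ler_norml; apply/andP; split; lra.
- have h0 : 0 < x - t by rewrite subr_gt0.
  rewrite (gtr0_norm h0) => xe; have [|+ _] := eP (x - t); first by rewrite h0.
  have -> : t + (x - t) = x by ring.
  rewrite DrE => /andP[h1 h2] _ _; rewrite ler_norml; apply/andP; split; lra.
- by rewrite !subrr mul0r subrr normr0 mulr0 lexx.
Qed.

Lemma compact_decreasing (T : topologicalType) (A : set T) (C : nat -> set T) :
  compact A -> C 0 `<=` A -> (forall j, closed (C j)) ->
  (forall j, C j.+1 `<=` C j) -> (forall j, C j !=set0) -> exists x, forall j, C j x.
Proof.
move=> cA C0A Ccl Cdec Cn0.
have Cmono i j : (i <= j)%N -> C j `<=` C i.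
  by move=> /subnK <-; elim: (j - i)%N => // k IH; apply: subset_trans IH; rewrite addSn.
pose F := filter_from [set: nat] C.
have FF : ProperFilter F.
  apply: filter_from_proper => //; apply: filter_from_filter; first by exists 0.
  move=> i j _ _; exists (maxn i j) => //.
  by rewrite subsetI; split; apply: Cmono; rewrite ?leq_maxl ?leq_maxr.
have FA : F A by exists 0.
have [x [_ xF]] := cA F FF FA; exists x => j.
apply: Ccl => B Bx; apply: xF => //; by exists j.
Qed.

(** The sets [S t] are shrunk along a countable base until one point is left. Compactness makes the
    condition that the final set meets a closed set the conjunction of the same conditions on the
    stages, which are measurable. *)
Lemma measurable_selection (R : realType) (T : topologicalType) (D : set R) (x0 : T)
    (A : set T) (S : R -> set T) :
  hausdorff_space T -> @second_countable T -> measurable D -> compact A ->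
  (forall t, D t -> [/\ S t !=set0, closed (S t) & S t `<=` A]) ->
  (forall F, closed F -> measurable [set t | D t /\ S t `&` F !=set0]) ->
  exists K : R -> T, (forall t, D t -> S t (K t)) /\
    forall U : set T, open U -> measurable (D `&` K @^-1` U).
Proof.
move=> hT [B Bc [Bo Bb]] mD cA SD Sm.
have [U [Uo Ub]] : exists U : nat -> set T, (forall j, open (U j)) /\
    forall x V, nbhs x V -> exists j, U j x /\ U j `<=` V.
  have /pfcard_geP[B0|[f]] := Bc.
    exists (fun=> setT); split=> [_|x V Vx]; first exact: openT.
    by have [b []] := Bb x V Vx; rewrite B0.
  exists f; split=> [j|x V Vx]; first by apply: Bo; exact: funS.
  have [b [Bb1 bx] bV] := Bb x V Vx.
  by have [j _ jb] := @surj _ _ _ _ f b Bb1; exists j; rewrite jb.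
(* Stage [j] discards the basic open set [U j], provided that something remains. *)
pose C t := fix C j := if j is j'.+1 then
   if pselect (C j' `\` U j' !=set0) then C j' `\` U j' else C j' else S t.
have CS t j : C t j.+1 `<=` C t j by move=> x /=; case: pselect => // _ [].
have Cprop t : D t -> forall j, C t j !=set0 /\ closed (C t j).
  move=> /SD[Sn0 Scl _]; elim=> [//|j [IH1 IH2]] /=; case: pselect => // h; split=> //.
  by apply: closedI => //; exact: open_closedC.
have Cm j F : closed F -> measurable [set t | D t /\ C t j `&` F !=set0].
  elim: j F => [|j IH] F Fcl; first exact: Sm.
  have UFcl : closed (F `\` U j) by rewrite setDE; apply: closedI => //; exact: open_closedC.
  have Ucl : closed (~` U j) by exact: open_closedC.
  rewrite (_ : [set t | _] = ([set t | D t /\ C t j `&` ~` U j !=set0] `&`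
       [set t | D t /\ C t j `&` (F `\` U j) !=set0]) `|`
     ([set t | D t /\ C t j `&` F !=set0] `\` [set t | D t /\ C t j `&` ~` U j !=set0])).
    by apply: measurableU; [apply: measurableI|apply: measurableD]; exact: IH.
  apply/seteqP; split=> t /=.
    move=> [Dt]; case: pselect => h [x [Cx Fx]].
      by left; split; split => //; exists x; case: Cx.
    by right; split; [split=> //; exists x|case=> _].
  move=> [[[Dt h1] [_ [x [Cx [Fx Ux]]]]]|[[Dt h1] h2]]; split=> //; case: pselect => // h.
  - by exists x.
  - by case: h2.
pose Z t := \bigcap_j C t j.
have Zcap t F : D t -> closed F -> (forall j, C t j `&` F !=set0) -> Z t `&` F !=set0.
  move=> Dt Fcl h; have [_ _ SA] := SD _ Dt.
  have [|j|j x [Cx Fx]|//|x Cx] := @compact_decreasing _ A (fun j => C t j `&` F) cA.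
  - by move=> x [/SA].
  - by apply: closedI => //; case: (Cprop t Dt j).
  - by split=> //; exact: CS.
  - by exists x; split; [move=> j _; case: (Cx j)|case: (Cx 0%N)].
have Zuniq t x y : D t -> Z t x -> Z t y -> x = y.
  move=> Dt Zx Zy; apply: contrapT => /eqP xy.
  move: hT; rewrite open_hausdorff => /(_ x y xy)[[V W] /= [/set_mem Vx /set_mem Wy] [Vo _ /eqP VW]].
  (* A basic open set contains [x] and misses [y]; at its stage [y] remains, so [x] was
     discarded. *)
  have [j [Ux UV]] := Ub x V (open_nbhs_nbhs (conj Vo Vx)).
  have := Zx j.+1 I; rewrite /=; case: pselect => [_ [_]|h _]; first exact.
  apply: h; exists y; split; first exact: Zy j I.
  by move=> /UV Vy; have : (V `&` W) y by []; rewrite VW.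
have Zne t : D t -> Z t !=set0.
  move=> Dt; have [|j|x [Zx _]] := Zcap t setT Dt; [exact: closedT| |by exists x].
  by rewrite setIT; case: (Cprop t Dt j).
pose K t := xget x0 (Z t).
have KZ t : D t -> Z t (K t) by move=> /Zne [x Zx]; apply: (xgetPex x0); exists x.
exists K; split=> [t Dt|V Vo]; first exact: (KZ t Dt 0 I).
have Vcl : closed (~` V) by exact: open_closedC.
(* As the final set is the point [K t], it meets the complement of [V] exactly when [K t] is outside
   [V]. *)
rewrite (_ : D `&` _ = D `\` \bigcap_j [set t | D t /\ C t j `&` ~` V !=set0]).
  by apply: measurableD => //; apply: bigcap_measurableType => j _; exact: Cm.
apply/seteqP; split=> t /= [Dt].
  move=> VK; split=> // h.
  have [|x [Zx nVx]] := Zcap t _ Dt Vcl; first by move=> j; case: (h j I).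
  by apply: nVx; rewrite (Zuniq t x (K t) Dt Zx (KZ t Dt)).
move=> h; split=> //; apply: contrapT => nV; apply: h => j _; split=> //.
by exists (K t); split=> //; exact: KZ.
Qed.

Lemma ae_not_countable (R : realType) (N : set R) : countable N ->
  {ae @lebesgue_measure R, forall t, ~ N t}.
Proof.
move=> cN; exists N; split; last by move=> t /= /contrapT.
  by apply: countable_measurable => // t; exact: measurable_set1.
exact: countable_lebesgue_measure0.
Qed.

Section AbsoluteContinuity.
Context (R : realType) (n : nat) (T : R).
Notation E := 'rV[R]_n.

Lemma absolutely_continuous_near (f : R -> E) t ep : absolutely_continuous_on T f ->
  0 <= t <= T -> 0 < ep -> \forall r \near t, 0 <= r <= T -> `|f r - f t| < ep.
Proof.
move=> fac /andP[t0 tT] ep0; have [d d0 dP] := fac ep ep0.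
apply/nbhs_normP; exists d => // r; rewrite /ball_ /= => rt /andP[r0 rT].
have [tr|rt'] := leP t r.
  have := dP 1%N (fun=> t) (fun=> r); rewrite !big_ord1; apply.
  - by move=> _; rewrite t0 tr rT.
  - by move=> i j; rewrite !ord1 eqxx.
  - by apply: le_lt_trans rt; rewrite distrC ler_norm.
have := dP 1%N (fun=> r) (fun=> t); rewrite !big_ord1 distrC; apply.
- by move=> _; rewrite r0 (ltW rt') tT.
- by move=> i j; rewrite !ord1 eqxx.
- by apply: le_lt_trans rt; rewrite ler_norm.
Qed.

Lemma absolutely_continuous_lipschitz (p f : R -> E) (L : R) : 0 < L ->
  (forall t r, 0 <= t <= T -> 0 <= r <= T -> `|f t - f r| <= L * `|p t - p r|) ->
  absolutely_continuous_on T p -> absolutely_continuous_on T f.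
Proof.
move=> L0 fp pac ep ep0; have [|d d0 dP] := pac (ep / L); first by rewrite divr_gt0.
exists d => // m a b ab dis /(dP m a b ab dis).
rewrite ltr_pdivlMr // mulrC mulr_sumr; apply: le_lt_trans; apply: ler_sum => i _.
have [/andP[a0 le_ab] bT] := ab i.
by apply: fp; [rewrite (le_trans a0 le_ab)|rewrite a0 (le_trans le_ab bT)].
Qed.

End AbsoluteContinuity.

(** * The chamber point of an orbit *)

Section ChamberProjection.
Context (R : realType) (n : nat).
Notation E := 'rV[R]_n.
Context (br : {bilinear E -> E -> E}) (hbr : lie_bracket br) (hss : semisimple br).
Context (s : {linear E -> E}) (hs : involutive_automorphism br s).
Context (ip : {biscalar E}) (hip : invariant_inner_product br s ip).
Context (G : topGroupType) (A : set (chart G E)) (hG : lie_group A).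
Context (c : chart G E) (hc : lie_algebra_of A c br).
Context (Kg : set G) (hKg : Kg = analytic_subgroup c (fixed_part s)).
Context (hKc : compact Kg).
Context (a : {vspace E}) (ha : maximal_abelian br (anti_fixed_part s) a).
Context (w : set E) (hw : closed_weyl_chamber br a w).
Context (horb : forall x, anti_fixed_part s x ->
     exists! y, quotient_map Kg (Ad c) x y /\ w y).

Let Ac : A c. Proof. by case: hc. Qed.
Let c_dom1 : chart_dom c 1%g. Proof. by case: hc. Qed.
Let c1 : c 1%g = 0. Proof. by case: hc. Qed.
Let ip_sym x y : ip x y = ip y x. Proof. by case: hip. Qed.
Let ip_pos x : x != 0 -> 0 < ip x x. Proof. by case: hip => _ + _ _; exact. Qed.
Let Kg1 : Kg 1%g. Proof. by case: (Kg_subgroup hKg). Qed.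
Let KgM g h : Kg g -> Kg h -> Kg (g * h)%g. Proof. by case: (Kg_subgroup hKg) => _ + _; apply. Qed.

Lemma chamber_sub x : w x -> x \in a.
Proof.
case: hw => h0 _ ->.
have cl : closed [set` a] by exact: vspace_rV_closed.
have : connected_component (regular_set br a) h0 `<=` [set` a].
  by move=> y /connected_component_sub [].
by move=> /closureS sub /sub; rewrite -(closure_id _).1.
Qed.

Lemma chamber_anti x : w x -> s x = - x.
Proof. by move=> /chamber_sub xa; case: ha => + _ _; apply. Qed.

Lemma orbit_chamber_unique g x : Kg g -> w x -> w (Ad c g x) -> Ad c g x = x.
Proof.
move=> Kgg wx wgx; have [y [_ uy]] := horb (chamber_anti wx).
rewrite -(uy (Ad c g x)); last by split=> //; exists g.
by apply: uy; split=> //; exists 1%g => //; exact: (Ad1 hG Ac c_dom1 c1).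
Qed.

Lemma ip_Ad_le h0 h x g : regular_set br a h0 ->
  w = closure (connected_component (regular_set br a) h0) ->
  connected_component (regular_set br a) h0 h -> w x -> Kg g ->
  ip h (Ad c g x) <= ip h x.
Proof.
move=> reg0 wE h0h wx Kgg; have reg := connected_component_sub h0h.
(* The chamber is also the closure of the component of [h], the form in which [critical_in_closure]
   places [b]. *)
have wEh : w = closure (connected_component (regular_set br a) h).
  by rewrite wE (same_connected_component h0h).
have cont : {within Kg, continuous (fun g => ip h (Ad c g x) : R)}.
  apply: continuous_subspaceT => u.
  apply: (@continuous_comp _ _ _ (fun g => Ad c g x) (fun y => ip h y : R)).
    exact: (continuous_Ad hG hc).
  exact: ip_continuousr.
have K0 : Kg !=set0 by exists 1%g.
have [g0 /set_mem Kg0 gmax] := compact_EVT_max K0 hKc cont.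
set b := Ad c g0 x.
have sb : s b = - b by exact: (Ad_anti hbr hG hc hs hip hKg Kg0 (chamber_anti wx)).
have crit z : s z = z -> ip h (br z b) = 0 /\ ip h (br z (br z b)) <= 0.
  move=> zk; have [f fz] := one_parameter_exists hG hbr hc z.
  have f0 := one_parameter0 fz.
  have lin1 : linear (ip h : E -> R^o) by move=> k u v; exact: linearPr.
  have lin2 : linear ((fun y => ip h (br z y)) : E -> R^o).
    by move=> k u v; rewrite /= linearPr /= linearPr.
  have d1 t : is_derive t (1 : R) (fun t => ip h (Ad c (f t) b) : R) (ip h (br z (Ad c (f t) b))).
    exact: (is_derive_linear lin1 (is_derive_Ad hG hc b t fz)).
  have d2 t : is_derive t (1 : R) (fun t => ip h (br z (Ad c (f t) b)) : R) (ip h (br z (br z (Ad c (f t) b)))).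
    exact: (is_derive_linear lin2 (is_derive_Ad hG hc b t fz)).
  have fb0 : Ad c (f 0) b = b by rewrite f0 (Ad1 hG Ac c_dom1 c1).
  have fm t : ip h (Ad c (f t) b) <= ip h (Ad c (f 0) b).
    rewrite fb0 /b -(AdM hG Ac c_dom1 c1); apply: gmax; apply/mem_set.
    by apply: KgM => //; exact: (one_parameter_Kg hc hKg t zk fz).
  have := second_order_max d1 (d2 0) fm.
  by rewrite fb0.
have wb : w b.
  rewrite wEh; apply: (critical_in_closure hbr hss hs hip ha reg sb) => z zk.
    exact: (crit z zk).1.
  exact: (crit z zk).2.
(* Both points lie in the chamber and on one orbit, so the maximum is [ip h x]. *)
have bx : b = x by exact: orbit_chamber_unique.
rewrite -[X in _ <= ip h X]bx; exact: gmax (mem_set Kgg).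
Qed.

(** The inequality is closed in [h], so it passes from the regular component to the chamber. *)
Lemma kostant_le h x g : w h -> w x -> Kg g -> ip h (Ad c g x) <= ip h x.
Proof.
case: hw => h0 reg0 wE; rewrite {1}wE => wh wx Kgg.
rewrite -subr_ge0 -linearBr /=.
have cl : closed [set y : E | 0 <= ip y (x - Ad c g x)].
  apply: (closed_comp (f := fun y => ip y (x - Ad c g x) : R) _ (@closed_ge R 0)) => y _.
  exact: ip_continuousl.
have : connected_component (regular_set br a) h0 `<=` [set y : E | 0 <= ip y (x - Ad c g x)].
  move=> y h0y /=; rewrite linearBr subr_ge0.
  exact: (ip_Ad_le reg0 wE h0y wx Kgg).
by move=> /closureS sub; have := sub _ wh; rewrite -(closure_id _).1.
Qed.

Let ipD x y z : ip x (y + z) = ip x y + ip x z. Proof. exact: linearDr. Qed.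
Let ipZ k x y : ip x (k *: y) = k * ip x y. Proof. exact: linearZr_LR. Qed.
Let KgV g : Kg g -> Kg g^-1%g. Proof. by case: (Kg_subgroup hKg) => _ _; apply. Qed.
Let AK := AdK_inv hG Ac c_dom1 c1.
Let VK := Ad_invK hG Ac c_dom1 c1.
Let AM := AdM hG Ac c_dom1 c1.
Let Aip g x y : Kg g -> ip (Ad c g x) (Ad c g y) = ip x y.
Proof. by move=> Kgg; exact: (Ad_ip hbr hG hc hs hip hKg x y Kgg). Qed.

#[local] Opaque Ad.

Definition chamber_point (x : E) : E :=
  xget 0 [set y | quotient_map Kg (Ad c) x y /\ w y].

Local Notation dn := chamber_point.

Lemma chamber_point_unique x y : s x = - x -> quotient_map Kg (Ad c) x y -> w y -> dn x = y.
Proof.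
move=> sx xy wy; have [y' [[xy' wy'] uy]] := horb sx.
have [h1 h2] := @xgetPex _ 0 [set y | quotient_map Kg (Ad c) x y /\ w y] (ex_intro _ y' (conj xy' wy')).
by rewrite /dn -(uy _ (conj h1 h2)) -(uy _ (conj xy wy)).
Qed.

Lemma chamber_pointP x : s x = - x -> w (dn x) /\ exists2 g, Kg g & x = Ad c g (dn x).
Proof.
move=> sx; have [y' [[xy' wy'] _]] := horb sx.
have [[g Kgg gx] wd] := @xgetPex _ 0 [set y | quotient_map Kg (Ad c) x y /\ w y] (ex_intro _ y' (conj xy' wy')).
split=> //; exists g^-1%g; first exact: KgV.
by apply: esym; apply: etrans (congr1 _ (esym gx)) _; exact: VK.
Qed.

#[local] Opaque chamber_point.

Lemma chamber_point_max h x g : w h -> s x = - x -> Kg g -> ip h (Ad c g x) <= ip h (dn x).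
Proof.
move=> wh sx Kgg; have [wd [g0 Kg0 xE]] := chamber_pointP sx.
rewrite [X in Ad c g X]xE -AM; apply: kostant_le => //.
exact: KgM.
Qed.

(** Orbits preserve length, so only the cross terms count: with [x = Ad g (dn x)],
    [ip x y = ip (dn x) (Ad g^-1 y)], which is at most [ip (dn x) (dn y)]. *)
Lemma chamber_point_contract x y : s x = - x -> s y = - y ->
  ip (dn x - dn y) (dn x - dn y) <= ip (x - y) (x - y).
Proof.
move=> sx sy; have [wx [g Kgg xE]] := chamber_pointP sx; have [wy [h Kgh yE]] := chamber_pointP sy.
have expand u v : ip (u - v) (u - v) = ip u u + ip v v - 2 * ip u v.
  by rewrite linearBl /= !linearBr /= (ip_sym v u); ring.
have nx : ip (dn x) (dn x) <= ip x x by rewrite {3 4}xE Aip.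
have ny : ip (dn y) (dn y) <= ip y y by rewrite {3 4}yE Aip.
have nxy : ip x y <= ip (dn x) (dn y).
  rewrite {1}xE -{1}(AK g y) Aip //; exact: (chamber_point_max wx sy (KgV Kgg)).
rewrite [leLHS](expand _ _) [leRHS](expand _ _).
by apply: lerB; [exact: lerD|rewrite ler_pM2l].
Qed.

Lemma chamber_point_lipschitz : exists2 L : R, 0 < L & forall x y, s x = - x -> s y = - y ->
  `|dn x - dn y| <= L * `|x - y|.
Proof.
have [L L0 LP] := ip_le_norm_le ip_pos; exists L => // x y sx sy.
exact/LP/chamber_point_contract.
Qed.

(** One group element carries the intermediate point into the chamber; applied to the two end
    points, it gives values at most their maxima. *)
Lemma chamber_point_convex h x v : w h -> s x = - x -> s v = - v ->
  forall r1 r2 k : R, 0 <= k <= 1 ->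
  ip h (dn (x + (k * r1 + (1 - k) * r2) *: v)) <=
  k * ip h (dn (x + r1 *: v)) + (1 - k) * ip h (dn (x + r2 *: v)).
Proof.
move=> wh sx sv r1 r2 k /andP[k0 k1].
have sxv r : s (x + r *: v) = - (x + r *: v) by rewrite linearD linearZ /= sx sv opprD scalerN.
have [_ [g Kgg E0]] := chamber_pointP (sxv (k * r1 + (1 - k) * r2)).
have E1 : x + (k * r1 + (1 - k) * r2) *: v = k *: (x + r1 *: v) + (1 - k) *: (x + r2 *: v).
  by apply/rowP => i; rewrite !mxE; ring.
have -> : dn (x + (k * r1 + (1 - k) * r2) *: v) =
    k *: Ad c g^-1%g (x + r1 *: v) + (1 - k) *: Ad c g^-1%g (x + r2 *: v).
  rewrite -(VK g (dn _)) -E0 E1 (AdD hG Ac c_dom1 c1).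
  by congr (_ + _); exact: (AdZ hG Ac c_dom1 c1).
rewrite [leLHS]ipD; apply: lerD; rewrite [leLHS]ipZ ler_wpM2l ?subr_ge0 //; apply: chamber_point_max => //; exact: KgV.
Qed.

Lemma is_derive_chamber_pairing h (p f : R -> E) t v g :
  w h -> (\forall r \near t, s (p r) = - p r /\ f r = dn (p r)) ->
  s v = - v -> is_derive t (1 : R) p v ->
  ~ corner (fun r => ip h (f r)) t -> Kg g -> p t = Ad c g (f t) ->
  is_derive t (1 : R) (fun r => ip h (f r) : R) (ip h (Ad c g^-1%g v)).
Proof.
move=> wh near sv dp nc Kgg ptE; have [spt ft] := nbhs_singleton near.
have KgVg := KgV Kgg.
have [L L0 LP] := chamber_point_lipschitz; have [M M0 MP] := ip_bound ip.
pose B := M * (`|h| + 1) * L; have h10 : 0 < `|h| + 1 by rewrite ltr_wpDl.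
have B0 : 0 < B by rewrite !mulr_gt0.
have hip_le u : `|ip h u| <= M * (`|h| + 1) * `|u|.
  apply: (le_trans (MP h u)); rewrite ler_wpM2r // ler_pM2l // lerDl //.
have sxv r : s (p t + r *: v) = - (p t + r *: v) by rewrite linearD linearZ /= spt sv opprD scalerN.
have lipq x y : s x = - x -> s y = - y -> `|ip h (dn x) - ip h (dn y)| <= B * `|x - y|.
  move=> sx sy; rewrite -linearBr /= (le_trans (hip_le _)) // /B -[in leRHS]mulrA ler_pM2l ?mulr_gt0 //.
  exact: LP.
(* The convex comparison function is taken along the tangent line of [p] at [t]. *)
apply: (@is_derive_between R _ (fun r => ip h (dn (p t + r *: v))) t _ (B * (`|v| + 1)) _ _ nc).
- exact: chamber_point_convex.
- move=> r; have := lipq _ _ (sxv r) (sxv 0); rewrite scale0r addr0 [p t + _]addrC addrK normrZ ler_norml.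
  move=> /andP[h1 _]; apply: le_trans h1; rewrite lerN2 -mulrA ler_pM2l // mulrC ler_wpM2r // lerDl //.
- by rewrite scale0r addr0 ft.
- move=> ep ep0; have e1 : 0 < ep / B by rewrite divr_gt0.
  apply: filterS2 near (is_derive_eps dp e1) => r [spr fr] hr; rewrite fr.
  apply: (le_trans (lipq _ _ spr (sxv _))); rewrite opprD addrA -ler_pdivlMl //.
  by rewrite mulrA [B^-1 * ep]mulrC.
- move=> ep ep0.
  have [N N0 NP] := ip_le_norm_le ip_pos.
  have D0 : 0 < M * (`|h| + 1) * N by rewrite !mulr_gt0.
  have e1 : 0 < ep / (M * (`|h| + 1) * N) by rewrite divr_gt0.
  apply: filterS2 near (is_derive_eps dp e1) => r [spr fr] hr; rewrite fr.
  (* The lower bound: [ip h (Ad g^-1 (p r))] stays below [ip h (f r)], meets it at [r = t], and has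
     slope [ip h (Ad g^-1 v)] there. *)
  have m1 := chamber_point_max wh spr KgVg.
  have m2 : ip h (f t) = ip h (Ad c g^-1%g (p t)).
    by congr (ip h _); apply: esym; apply: etrans (congr1 _ ptE) _; exact: VK.
  rewrite m2; apply: le_trans (lerB m1 (lexx _)).
  set x := p r - p t - (r - t) *: v in hr.
  have pE : p r = p t + (r - t) *: v + x by rewrite /x; apply/rowP => i; rewrite !mxE; ring.
  have hE : ip h (Ad c g^-1%g (p r)) =
      ip h (Ad c g^-1%g (p t)) + (r - t) * ip h (Ad c g^-1%g v) + ip h (Ad c g^-1%g x).
    apply: etrans (congr1 (fun u => ip h (Ad c g^-1%g u)) pE) _.
    apply: etrans (congr1 (ip h) (AdD hG Ac c_dom1 c1 _ _ _)) _.
    apply: etrans (ipD _ _ _) _; congr (_ + _).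
    apply: etrans (congr1 (ip h) (AdD hG Ac c_dom1 c1 _ _ _)) _.
    apply: etrans (ipD _ _ _) _; congr (_ + _).
    by apply: etrans (congr1 (ip h) (AdZ hG Ac c_dom1 c1 _ _ _)) _; exact: ipZ.
  have aux (x1 x2 x3 x4 : R) : - x4 <= x3 -> x2 - x4 <= x1 + x2 + x3 - x1.
    have -> : x1 + x2 + x3 - x1 = x2 + x3 by ring.
    by rewrite lerD2l.
  rewrite [X in _ <= X - _]hE; apply: aux.
  have : `|ip h (Ad c g^-1%g x)| <= ep * `|r - t|.
    apply: (le_trans (hip_le _)).
    have nx : `|Ad c g^-1%g x| <= N * `|x| by apply: NP; rewrite Aip.
    have := ler_wpM2l (ltW (mulr_gt0 M0 h10)) nx; move=> /le_trans; apply.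
    by rewrite mulrA -ler_pdivlMl // mulrA [_^-1 * ep]mulrC.
  by rewrite ler_norml => /andP[].
Qed.

(** Around a regular [h0] there is room in every direction of [a]; the differences [h i - h0] are
    multiples of a basis, so pairings with chamber points determine those with all of [a]. *)
Lemma chamber_spans : exists (h0 : E) (h : 'I_(\dim a) -> E) (t : 'I_(\dim a) -> R),
  w h0 /\ forall i, [/\ w (h i), 0 < t i & h i = h0 + t i *: (vbasis a)`_i].
Proof.
case: hw => h0 reg wE.
have /choice[t tP] : forall i : 'I_(\dim a), exists t, 0 < t /\ w (h0 + t *: (vbasis a)`_i).
  move=> i; have ei : (vbasis a)`_i \in a by apply: vbasis_mem; apply: mem_nth; rewrite size_tuple.
  have [t t0 tP] := regular_near hbr hss hs hip ha reg ei; exists t; split=> //.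
  by rewrite wE; apply: subset_closure; apply: segment_component => //; exact: ltW.
exists h0, (fun i => h0 + t i *: (vbasis a)`_i), t; split=> [|i].
  by rewrite wE; apply: subset_closure; exact: connected_component_refl.
by have [] := tP i.
Qed.

Lemma is_derive_chamber_point (h0 : E) (h : 'I_(\dim a) -> E) (tau : 'I_(\dim a) -> R)
    (p f : R -> E) t v y g :
  w h0 -> (forall i, [/\ w (h i), 0 < tau i & h i = h0 + tau i *: (vbasis a)`_i]) ->
  (\forall r \near t, s (p r) = - p r /\ f r = dn (p r)) ->
  s v = - v -> is_derive t (1 : R) p v ->
  ~ corner (fun r => ip h0 (f r)) t -> (forall i, ~ corner (fun r => ip (h i) (f r)) t) ->
  Kg g -> p t = Ad c g (f t) ->
  y \in a -> (forall z, z \in a -> ip (Ad c g^-1%g v - y) z = 0) ->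
  is_derive t (1 : R) f y.
Proof.
move=> wh0 hP near sv dp nc0 nc Kgg ptE ya yP.
have D x : w x -> ~ corner (fun r => ip x (f r)) t ->
    is_derive t (1 : R) (fun r => ip x (f r) : R) (ip x (Ad c g^-1%g v)).
  move=> wx ncx.
  exact: (is_derive_chamber_pairing wx near sv dp ncx Kgg ptE).
apply: (is_derive_pairings ip_sym ip_pos ya).
  apply: filterS near => r [sr ->]; apply: chamber_sub.
  by have [] := chamber_pointP sr.
move=> i; have [whi ti hiE] := hP i.
set e := (vbasis a)`_i in hiE *.
have ea : e \in a by apply: vbasis_mem; apply: mem_nth; rewrite size_tuple.
have ipE x : ip e x = (tau i)^-1 * (ip (h i) x - ip h0 x).
  rewrite hiE ip_sym (ip_sym _ x) ipD ipZ (ip_sym x h0) addrC addKr mulrA mulVf ?mul1r //.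
  by rewrite gt_eqF.
have -> : (fun r => ip e (f r) : R) = (fun r => (tau i)^-1 * (ip (h i) (f r) - ip h0 (f r)) : R).
  by apply/funext => r; rewrite ipE.
have -> : ip e y = (tau i)^-1 *: (ip (h i) (Ad c g^-1%g v) - ip h0 (Ad c g^-1%g v) : R^o).
  rewrite -[RHS]/(_ * _) -ipE; apply/esym/eqP; rewrite -subr_eq0; apply/eqP.
  by rewrite -(yP e ea) ip_sym (ip_sym e y) -linearBl.
apply: is_deriveZ; apply: is_deriveB; exact: D.
Qed.

Section Trajectory.
Context (T : R) (p f : R -> E).
Context (p_anti : forall t, 0 <= t <= T -> s (p t) = - p t).
Context (p_ac : absolutely_continuous_on T p) (f_ac : absolutely_continuous_on T f).
Context (fE : forall t, 0 <= t <= T -> f t = dn (p t)).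

(** The times at which an admissible [g] exists in a closed set [F] form a closed set: if none
    exists at [t], the distance from [Ad g (f t)] to [p t] has a positive minimum [m] over the
    compact [Kg] intersected with [F], and this persists nearby. *)
Lemma measurable_lift : exists K : R -> G, measurable_control Kg T K /\
  forall t, 0 <= t <= T -> p t = Ad c (K t) (f t).
Proof.
pose S t := [set g | Kg g /\ Ad c g (f t) = p t].
have [hT [hsc _]] : hausdorff_space G /\ @second_countable G /\ True by case: hG.
have Kcl : closed Kg by exact: compact_closed.
have Acont x := continuous_Ad hG hc x.
have Scl t : closed (S t).
  apply: closedI => //.
  apply: (closed_comp (f := fun g => Ad c g (f t)) (D := [set p t])); first by move=> g _; exact: Acont.
  exact: (accessible_closed_set1 (hausdorff_accessible (@norm_hausdorff _ _))).
have [L L0 LP] := ip_le_norm_le ip_pos.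
have AL g x : Kg g -> `|Ad c g x| <= L * `|x| by move=> Kgg; apply: LP; rewrite Aip.
have [|t|F Fcl|K [KS Km]] := @measurable_selection R G `[0, T]%classic 1%g Kg S hT hsc _ hKc.
- exact: measurable_itv.
- rewrite /= in_itv /= => t0T; split=> //; last by move=> g [].
  have [_ [g Kgg pE]] := chamber_pointP (p_anti t0T).
  exists g; split; first exact: Kgg.
  by rewrite (fE t0T); exact: esym.
- rewrite [X in measurable X](_ : _ = [set t | `[0, T]%classic t /\ exists2 g, (Kg `&` F) g & Ad c g (f t) = p t]); last first.
    apply/seteqP; split=> t /= [tT].
      by move=> [g [[Kgg gE] Fg]]; split=> //; exists g.
    by move=> [g [Kgg Fg] gE]; split=> //; exists g.
  apply: measurable_realfun.closed_measurable; rewrite -[X in closed X]setCK; apply: open_closedC.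
  rewrite openE => t nZ.
  have [tT|tT] := pselect (`[0, T]%classic t); last first.
    have : open (~` `[0, T]%classic : set R) by apply: closed_openC; exact: interval_closed.
    by rewrite openE => /(_ t tT); apply: filterS => r rT [].
  have [[g0 KFg0]|KF0] := pselect (Kg `&` F !=set0); last first.
    by apply: filterE => r [_ [g KFg _]]; apply: KF0; exists g.
  have cKF : compact (Kg `&` F) by exact: compact_closedI.
  have phic : {within Kg `&` F, continuous (fun g => `|Ad c g (f t) - p t| : R)}.
    apply: continuous_subspaceT => g.
    apply: (@continuous_comp _ _ _ (fun g => Ad c g (f t)) (fun y => `|y - p t| : R)).
      exact: Acont.
    move: (Ad c g (f t)) => y; apply/(@cvgrPdist_le R R^o E (nbhs y) (nbhs_filter y)) => ep ep0.
    suff : \forall u \near (y : E), `| `|y - p t| - `|u - p t| | <= ep by [].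
    apply/nbhs_normP; exists ep => // u; rewrite /ball_ /= => yu.
    apply: (le_trans (ler_dist_dist _ _)); rewrite opprB addrA subrK; exact: ltW.
  have [g1 /set_mem KFg1 g1min] := compact_EVT_min (ex_intro _ g0 KFg0) cKF phic.
  set m := `|Ad c g1 (f t) - p t| in g1min.
  have m0 : 0 < m.
    rewrite normr_gt0; apply/eqP => /eqP; rewrite subr_eq0 => /eqP gE.
    by apply: nZ; split=> //; exists g1.
  have t0T : 0 <= t <= T by move: tT; rewrite /= in_itv.
  (* [Ad] is [L]-bounded on [Kg], so the movements of [f] and of [p] contribute less than [m / 4]
     each. *)
  have e1 : 0 < m / (4 * L) by rewrite divr_gt0 // mulr_gt0.
  have e2 : 0 < m / 4 by rewrite divr_gt0.
  apply: filterS2 (absolutely_continuous_near f_ac t0T e1) (absolutely_continuous_near p_ac t0T e2).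
  move=> r fr pr [rT [g KFg gE]].
  have r0T : 0 <= r <= T by move: rT; rewrite /= in_itv.
  have := g1min g (mem_set KFg); rewrite leNgt => /negP; apply.
  have -> : Ad c g (f t) - p t = (p r - p t) - Ad c g (f r - f t).
    rewrite (AdB hG Ac c_dom1 c1) gE; apply/rowP => i; rewrite !mxE; ring.
  apply: (le_lt_trans (ler_normB _ _)).
  have [Kgg _] := KFg; have l1 := AL g (f r - f t) Kgg.
  have l2 : L * `|f r - f t| < L * (m / (4 * L)) by rewrite ltr_pM2l //; exact: fr.
  have l3 : L * (m / (4 * L)) = m / 4 by field; rewrite gt_eqF.
  have l4 : `|p r - p t| < m / 4 by exact: pr.
  have l5 : m / 4 + m / 4 <= m.
    have -> : m / 4 + m / 4 = m * 2^-1 by field.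
    by rewrite ler_piMr ?(ltW m0) // invf_le1 // ler1n.
  apply: lt_le_trans l5; apply: ltrD => //; rewrite -l3; exact: le_lt_trans l2.
exists K; split; first by split => // t tT; case: (KS t tT).
by move=> t t0T; have [] := KS t t0T.
Qed.

End Trajectory.
End ChamberProjection.

(** * The reduced system *)

Lemma generates_sub (R : realType) (n m : nat) (br : {bilinear 'rV[R]_n -> 'rV[R]_n -> 'rV[R]_n})
    (k : 'I_m -> 'rV[R]_n) (S : set 'rV[R]_n) : generates br k S -> forall i, S (k i).
Proof. by move=> <- i H [_]; apply; exists i. Qed.

Lemma sum_anti (R : realType) (n m : nat) (s : {linear 'rV[R]_n -> 'rV[R]_n}) (u : 'I_m -> R) (b : 'I_m -> 'rV[R]_n) :
  (forall i, s (b i) = - b i) -> s (\sum_(i < m) u i *: b i) = - \sum_(i < m) u i *: b i.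
Proof.
move=> sb; rewrite linear_sum /= -sumrN; apply: eq_bigr => i _.
by rewrite linearZ /= sb scalerN.
Qed.

Lemma sum_orthogonal (R : realType) (n m : nat) (ip : {biscalar 'rV[R]_n}) (e : 'rV[R]_n)
    (u : 'I_m -> R) (b : 'I_m -> 'rV[R]_n) : (forall x y, ip x y = ip y x) ->
  (forall i, ip (b i) e = 0) -> ip (\sum_(i < m) u i *: b i) e = 0.
Proof.
move=> ip_sym be; rewrite ip_sym linear_sumr /= big1 // => i _.
by rewrite linearZr_LR /= ip_sym be mulr0.
Qed.

Lemma solution_R_C (R : realType) (n : nat) (G : topGroupType) (Kg : set G)
    (act : G -> 'rV[R]_n -> 'rV[R]_n) proj X (a : {vspace 'rV[R]_n}) T f :
  solution_R Kg act proj X a T f -> solution_C Kg act proj X a T f.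
Proof.
move=> [fac fa [K [KK _] Kae]]; split=> //.
have FF := ae_filter_ringOfSetsType (@lebesgue_measure R).
apply: (@filterS _ _ FF _ _ _ Kae) => t tae tT; exists (induced_field act proj X (K t) (f t)); first exact: tae.
exists 1%N, (fun=> 1), (fun=> induced_field act proj X (K t) (f t)); split.
- by move=> _; split=> //; exists (K t) => //; exact: KK.
- by rewrite big_ord1.
- by rewrite big_ord1 scale1r.
Qed.

Unset Implicit Arguments.
Set Strict Implicit.

Theorem theorem3p8 (R : realType) (n : nat)
  (br : {bilinear 'rV[R]_n -> 'rV[R]_n -> 'rV[R]_n})
  (hbr : lie_bracket br) (hss : semisimple br)
  (s : {linear 'rV[R]_n -> 'rV[R]_n}) (hs : involutive_automorphism br s)
  (hk : compactly_embedded br (fixed_part s))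
  (ip : {biscalar 'rV[R]_n}) (hip : invariant_inner_product br s ip)
  (G : topGroupType) (A : set (chart G 'rV[R]_n)) (hG : lie_group A)
  (c : chart G 'rV[R]_n) (hc : lie_algebra_of A c br)
  (Kg : set G) (hKg : Kg = analytic_subgroup c (fixed_part s))
  (hKc : compact Kg)
  (a : {vspace 'rV[R]_n}) (ha : maximal_abelian br (anti_fixed_part s) a)
  (w : set 'rV[R]_n) (hw : closed_weyl_chamber br a w)
  (horb : forall x, anti_fixed_part s x ->
     exists! y, quotient_map Kg (Ad c) x y /\ w y)
  (X : 'rV[R]_n -> 'rV[R]_n)
  (hX : forall x, anti_fixed_part s x -> anti_fixed_part s (X x))
  (m : nat) (k : 'I_m -> 'rV[R]_n) (hkgen : generates br k (fixed_part s))
  (T : R) (hT : 0 <= T) (p : R -> 'rV[R]_n)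
  (hp : solution_A br (anti_fixed_part s) X k T p)
  (adown : R -> 'rV[R]_n)
  (hadown : forall t, t \in `[0, T] -> w (adown t))
  (hpi : forall t, t \in `[0, T] ->
     quotient_map Kg (Ad c) (adown t) = quotient_map Kg (Ad c) (p t)) :
  solution_R Kg (Ad c) (orth_proj ip a) X a T adown /\
  solution_C Kg (Ad c) (orth_proj ip a) X a T adown.
Proof.
suff H : solution_R Kg (Ad c) (orth_proj ip a) X a T adown by split=> //; exact: solution_R_C.
have ip_sym x y : ip x y = ip y x by case: hip.
have ip_pos x : x != 0 -> 0 < ip x x by case: hip => _ + _ _; exact.
have [Ac c_dom1 c1 _] := hc.
have [Kg1 KgM KgV] := Kg_subgroup hKg.
have [pac pp [u _ pae]] := hp.
have p_anti t : 0 <= t <= T -> s (p t) = - p t by move=> t0T; apply: pp; rewrite in_itv.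
have fE t : 0 <= t <= T -> adown t = chamber_point c Kg w (p t).
  move=> t0T; have tT : t \in `[0, T] by rewrite in_itv.
  apply: esym; apply: (chamber_point_unique horb (p_anti t t0T)); last exact: hadown.
  by rewrite -hpi //; exists 1%g => //; exact: (Ad1 hG Ac c_dom1 c1).
have fac : absolutely_continuous_on T adown.
  have [L L0 LP] := chamber_point_lipschitz hbr hss hs hip hG hc hKg hKc ha hw horb.
  apply: absolutely_continuous_lipschitz L0 _ pac => t r tT rT.
  by rewrite (fE t tT) (fE r rT); apply: LP; exact: p_anti.
have fa t : t \in `[0, T] -> adown t \in a by move=> /hadown; exact: (chamber_sub hw).
have [K [Kc KE]] := measurable_lift hbr hs hip hG hc hKg hKc horb p_anti pac fac fE.
split=> //; exists K => //.
have [h0 [h [tau [wh0 hP]]]] := chamber_spans hbr hss hs hip ha hw.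
have cN : countable (\bigcup_i corner (fun r => ip (h i) (adown r))).
  by apply: bigcup_countable => // i _; exact: countable_corner.
have cE : countable [set 0; T] by exact: finite_set_countable.
have FF := ae_filter_ringOfSetsType (@lebesgue_measure R).
(* Discarded besides the exceptional set of the control system are the two endpoints, where no
   two-sided neighbourhood lies in [[0, T]], and the corners of finitely many pairings: countable
   sets. *)
apply: (@filterS3 _ _ FF _ _ _ _ _ (ae_not_countable cE)
  (@filterI _ _ FF _ _ (ae_not_countable (countable_corner (fun r => ip h0 (adown r)))) (ae_not_countable cN)) pae).
move=> t tE [tN0 tN] dp tT.
have t0T : 0 <= t <= T by move: tT; rewrite in_itv.
have tin : t \in `]0, T[.
  have /andP[t0 t1] := t0T; rewrite in_itv /= !lt_neqAle t0 t1 !andbT.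
  by apply/andP; split; apply/eqP => E0; apply: tE; [left|right].
have near : \forall r \near t, s (p r) = - p r /\ adown r = chamber_point c Kg w (p r).
  apply: filterS (near_in_itvoo tin) => r; rewrite in_itv /= => /andP[r0 r1].
  have r0T : 0 <= r <= T by rewrite !ltW.
  by split; [exact: p_anti|exact: fE].
have ki i : s (k i) = k i := generates_sub hkgen i.
have KgK : Kg (K t) by case: Kc => + _; apply.
have KgKV := KgV _ KgK.
set z := \sum_(i < m) u i t *: br (k i) (p t) in dp.
have sz : s z = - z by apply: sum_anti => i; exact: (br_kp hs (ki i) (p_anti t t0T)).
have sXp : s (X (p t)) = - X (p t) by apply: hX; exact: p_anti.
have sv : s (X (p t) + z) = - (X (p t) + z) by rewrite linearD /= sXp sz opprD.
set y := induced_field (Ad c) (orth_proj ip a) X (K t) (adown t).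
have yE : y = orth_proj ip a (Ad c (K t)^-1%g (X (p t))) by rewrite /y /induced_field -(KE t t0T).
have [ya yP] := orth_projP ip_pos a (Ad c (K t)^-1%g (X (p t))).
apply: (is_derive_chamber_point hbr hss hs hip hG hc hKg hKc ha hw horb wh0 hP near sv (dp tT) _ _ KgK (KE t t0T)).
- exact: tN0.
- by move=> i h1; apply: tN; exists i.
- by rewrite yE.
move=> e ea; rewrite yE.
have -> : Ad c (K t)^-1%g (X (p t) + z) = Ad c (K t)^-1%g (X (p t)) + Ad c (K t)^-1%g z.
  exact: (AdD hG Ac c_dom1 c1).
rewrite addrAC linearDl /= (yP e ea) add0r.
(* Moved back to [adown t], the control term becomes a combination of brackets of elements of [k]
   with [adown t], all orthogonal to [a]; the controls thus leave no trace in the projection. *)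
have -> : Ad c (K t)^-1%g z = \sum_(i < m) u i t *: br (Ad c (K t)^-1%g (k i)) (adown t).
  have bE i : Ad c (K t)^-1%g (br (k i) (p t)) = br (Ad c (K t)^-1%g (k i)) (adown t).
    have [_ _ Abr] := Ad_Kg hbr hG hc hs hip hKg KgKV; apply: etrans (Abr _ _) _.
    apply: (congr1 (fun x => br _ x)).
    by apply: etrans (congr1 _ (KE t t0T)) _; exact: (Ad_invK hG Ac c_dom1 c1).
  rewrite /z; elim/big_rec2: _ => [|i b1 b2 _ IH]; first exact: (Ad0 hG Ac c_dom1 c1).
  apply: etrans (AdD hG Ac c_dom1 c1 _ _ _) _; apply: (f_equal2 +%R _ IH).
  by apply: etrans (AdZ hG Ac c_dom1 c1 _ _ _) _; exact: (congr1 ( *:%R (u i t)) (bE i)).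
apply: (@sum_orthogonal R n m ip e (fun i => u i t)
  (fun i => br (Ad c (K t)^-1%g (k i)) (adown t)) ip_sym) => i.
exact: (ip_br_ka hbr hss hs hip ha (Ad_fixed hbr hG hc hs hip hKg KgKV (ki i)) (fa t tT) ea).
Qed.
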